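(* Let $\alpha,\beta>0$ with $\beta\le\alpha$, and let $\rho\in C^{0,\gamma}(0,1)$ ($0<\gamma<1$) with $\rho\ge 0$, $\rho\not\equiv 0$. Assume that $0<q\le p\le 1$ and $\sigma\ge 0$. Then the system $$\begin{cases}u''-\alpha u+\dfrac{u^p}{v^q}+\rho(x)=0 & \text{in }(0,1),\\[2mm] v''-\beta v+\dfrac{u^{p+\sigma}}{v^{q+\sigma}}=0 & \text{in }(0,1),\\[1mm] u(0)=u(1)=0,\quad v(0)=v(1)=0\end{cases}$$ has a unique solution $(u,v)\in C^2[0,1]\times C^2[0,1]$.
   Context: A solution means a positive classical solution: $u,v>0$ in $(0,1)$ and the equations hold pointwise. $C^{0,\gamma}(0,1)$ denotes functions that are Hölder continuous on $(0,1)$ with exponent $\gamma$ (hence extending continuously to $[0,1]$). *)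

(* Defs.v *)
From Stdlib Require Import Reals.
From Coquelicot Require Import Coquelicot.
Open Scope R_scope.

(** Functions on (0,1) or [0,1] are represented by total functions [R -> R];
    their values outside the interval play no role. *)

Definition in_open01 (x : R) : Prop := 0 < x < 1.
Definition in_closed01 (x : R) : Prop := 0 <= x <= 1.

(** [x <> y] because [Rpower 0 gamma = 1] in the library. *)
Definition holder01 (gamma : R) (f : R -> R) : Prop :=
  exists C : R, forall x y : R, in_open01 x -> in_open01 y -> x <> y ->
    Rabs (f x - f y) <= C * Rpower (Rabs (x - y)) gamma.

(** C^2[0,1]: [f] is twice differentiable in (0,1), and [f], [f'], [f'']
    extend continuously to [0,1]; the extension of [f] is [f] itself, those of
    its derivatives are [f1] and [f2].  [continuous_on in_closed01] is
    continuity relative to [0,1], so one-sided at the endpoints. *)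
Definition C2_closed01 (f : R -> R) : Prop :=
  exists f1 f2 : R -> R,
    (forall x : R, in_open01 x -> is_derive f x (f1 x)) /\
    (forall x : R, in_open01 x -> is_derive f1 x (f2 x)) /\
    continuous_on in_closed01 f /\
    continuous_on in_closed01 f1 /\
    continuous_on in_closed01 f2.

(** The powers are only evaluated where [u] and [v] are positive, and
    [Derive_n _ 2] is used only for functions in [C2_closed01], for which it
    is the genuine second derivative in (0,1). *)
Definition positive_solution (alpha beta p q sigma : R) (rho u v : R -> R)
  : Prop :=
  (forall x : R, in_open01 x -> 0 < u x /\ 0 < v x) /\
  (forall x : R, in_open01 x ->
     Derive_n u 2 x - alpha * u x
       + Rpower (u x) p / Rpower (v x) q + rho x = 0) /\
  (forall x : R, in_open01 x ->
     Derive_n v 2 x - beta * v x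
       + Rpower (u x) (p + sigma) / Rpower (v x) (q + sigma) = 0) /\
  (u 0 = 0 /\ u 1 = 0) /\
  (v 0 = 0 /\ v 1 = 0).

Definition C2_positive_solution (alpha beta p q sigma : R) (rho u v : R -> R)
  : Prop :=
  C2_closed01 u /\ C2_closed01 v /\
  positive_solution alpha beta p q sigma rho u v.

(* Main.v *)
(** Uniqueness.  Let [U], [V] be the differences of the components of two solutions.
    A Wronskian argument (the [u]-nonlinearity is sublinear because [p <= 1]) and the
    maximum principle show that every component of [{U > 0}] contains a point of
    [{V < 0}], which lies in a component containing a point of [{U < 0}], and so on.
    The resulting chain of sign changes moves monotonically and accumulates at a point where
    all Cauchy data of [U] and [V] vanish.  Since [u] and [v] are comparable to
    [x (1 - x)] and [q <= p], the difference of the nonlinearities is bounded by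
    [K (|U| + |V|) / (x (1 - x))], which still gives unique continuation there.

    Existence.  Let [m'' - alpha m + rho = 0] with zero boundary values.  Truncate so that
    [m <= u <= M x (1 - x)] and [v >= c d (1 + d)], [v >= u - m], where [d = x (1 - x)] and
    [(d (1 + d))'' = - 12 d].  The truncated nonlinearities are bounded with Lipschitz
    constant [K / d], so the initial value problem is solved by Picard iteration in the weight
    [x exp (4 K x)], and the two slopes at [0] are found by the Poincare-Miranda theorem.
    The maximum principle removes the truncation; [v >= u - m] is where [beta <= alpha]
    is used. *)

Require Import Defs.
From Stdlib Require Import Reals Lra Lia Psatz IndefiniteDescription Bool.
From Coquelicot Require Import Coquelicot.
Open Scope R_scope.

(** * Calculus and the minimum principle *)

(** A larger [u] increases the source of [v], while a larger [v] decreases that of [u], so the pair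
    obeys no comparison principle. Uniqueness is read off the plane curve [(U, V)], which each
    detection forces through one more quarter turn in the same sense.

    For existence the delicate bound is [u <= M d]. From [v >= c d] alone the source of [u] is of
    order [M^p], which [2 M = - (M d)''] need not absorb when [p = 1]. From [v >= u - m], with [m]
    below a multiple of [c d], one gets [u <= C v], and the order drops to [M^(p - q)] with
    [p - q < 1]. Where [v >= u - m] fails, the truncated quotient has denominator [u - m < u], so
    adding [sigma] to both exponents increases it; this is what the minimum principle needs.

    The source of [v] is only bounded below by a multiple of [d], so the second derivative of the
    lower barrier must be of order [d] as well. This excludes [d] itself, whose second derivative is
    [-2].

    The factor [1 / x] in the Lipschitz constant is cancelled because differences of solutions are
    of order [x]; the factor [1 / (1 - x)] disappears on integrating twice. *)

Lemma in01_locally (x : R) : in_open01 x -> locally x in_open01.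
Proof.
  intros [H0 H1].
  exists (mkposreal (Rmin x (1 - x)) (Rmin_pos _ _ H0 (proj2 (Rlt_0_minus _ _) H1))).
  intros y Hy. unfold ball in Hy; simpl in Hy.
  unfold AbsRing_ball, abs, minus, plus, opp in Hy; simpl in Hy.
  generalize (Rmin_l x (1 - x)) (Rmin_r x (1 - x)); intros.
  apply Rabs_def2 in Hy; unfold in_open01; lra.
Qed.

Lemma continuous_eps (f : R -> R) (x e : R) :
  continuous f x -> 0 < e ->
  exists d, 0 < d /\ forall y, Rabs (y - x) < d -> Rabs (f y - f x) < e.
Proof.
  intros Hc He.
  destruct (proj1 (filterlim_locally f (f x)) Hc (mkposreal e He)) as [d Hd].
  exists d; split; [apply cond_pos | exact Hd].
Qed.

Lemma eps_continuous (f : R -> R) (x : R) :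
  (forall e, 0 < e ->
     exists d, 0 < d /\ forall y, Rabs (y - x) < d -> Rabs (f y - f x) < e) ->
  continuous f x.
Proof.
  intros H. apply filterlim_locally. intros e.
  destruct (H e (cond_pos e)) as [d [Hd H']].
  exists (mkposreal d Hd). exact H'.
Qed.

Lemma continuous_pos_near (f : R -> R) (x : R) :
  continuous f x -> 0 < f x ->
  exists d, 0 < d /\ forall y, Rabs (y - x) < d -> 0 < f y.
Proof.
  intros Hc Hp. destruct (continuous_eps f x (f x) Hc Hp) as [d [Hd H]].
  exists d; split; auto. intros y Hy. specialize (H y Hy).
  apply Rabs_def2 in H; lra.
Qed.

Lemma continuous_opp_R (f : R -> R) (x : R) :
  continuous f x -> continuous (fun y => - f y) x.
Proof. intros H; apply (continuous_opp (V := R_NormedModule)); exact H. Qed.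

Lemma is_derive_opp_R (f : R -> R) (x l : R) :
  is_derive f x l -> is_derive (fun y => - f y) x (- l).
Proof. intros H; apply (is_derive_opp (V := R_NormedModule)); exact H. Qed.

Lemma is_derive_minus_R (f g : R -> R) (x l m : R) :
  is_derive f x l -> is_derive g x m -> is_derive (fun y => f y - g y) x (l - m).
Proof.
  intros Hf Hg; apply (is_derive_minus (V := R_NormedModule)); assumption.
Qed.

Lemma is_derive_reflect (f : R -> R) (x l : R) :
  is_derive f (1 - x) l -> is_derive (fun y => f (1 - y)) x (- l).
Proof.
  intros H.
  replace (- l) with (scal (-1) l) by (unfold scal; simpl; unfold mult; simpl; ring).
  apply (is_derive_comp f (fun y => 1 - y)); [exact H | auto_derive; auto; ring].
Qed.

Lemma continuous_reflect (f : R -> R) (x : R) :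
  continuous f (1 - x) -> continuous (fun y => f (1 - y)) x.
Proof.
  intros H. apply (continuous_comp (fun y => 1 - y) f); [|exact H].
  apply (continuous_minus (V := R_NormedModule));
    [apply continuous_const | apply continuous_id].
Qed.

Lemma MVT_open (f f1 : R -> R) (a b : R) :
  a < b -> (forall x, a <= x <= b -> continuous f x) ->
  (forall x, a < x < b -> is_derive f x (f1 x)) ->
  exists c, a < c < b /\ f b - f a = f1 c * (b - a).
Proof.
  intros Hab Hc Hd.
  assert (pr : forall c, a < c < b -> derivable_pt f c).
  { intros c Hc'. exists (f1 c). apply is_derive_Reals, Hd, Hc'. }
  assert (pr' : forall c, a < c < b -> derivable_pt id c)
    by (intros; apply derivable_pt_id).
  destruct (MVT f id a b pr pr' Hab) as [c [Hc' E]].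
  - intros x Hx. apply continuity_pt_filterlim, Hc, Hx.
  - intros x Hx. apply derivable_continuous_pt, derivable_pt_id.
  - exists c. split; [exact Hc'|].
    replace (derive_pt id c (pr' c Hc')) with 1 in E
      by (symmetry; rewrite <- (derive_pt_id c); apply pr_nu).
    assert (E2 : derive_pt f c (pr c Hc') = f1 c).
    { apply derive_pt_eq, is_derive_Reals, Hd, Hc'. }
    rewrite E2 in E. unfold id in E. lra.
Qed.

Lemma continuous_min_ab (f : R -> R) (a b : R) :
  a <= b -> (forall x, a <= x <= b -> continuous f x) ->
  exists m, a <= m <= b /\ forall x, a <= x <= b -> f m <= f x.
Proof.
  intros Hab Hc.
  destruct (continuity_ab_min f a b Hab) as [m [H1 H2]].
  - intros x Hx. apply continuity_pt_filterlim, Hc, Hx.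
  - exists m; split; auto.
Qed.

Lemma continuous_max_ab (f : R -> R) (a b : R) :
  a <= b -> (forall x, a <= x <= b -> continuous f x) ->
  exists m, a <= m <= b /\ forall x, a <= x <= b -> f x <= f m.
Proof.
  intros Hab Hc.
  destruct (continuity_ab_maj f a b Hab) as [m [H1 H2]].
  - intros x Hx. apply continuity_pt_filterlim, Hc, Hx.
  - exists m; split; auto.
Qed.

(** [f] need not be differentiable at [a]: [f1 a] is the limit of its derivative. If it were
    negative, the mean value theorem would make [f] drop to the right of [a]. This yields the signs
    of the slopes at the ends of a component. *)
Lemma derive_nonneg_left_min (f f1 : R -> R) (a b : R) :
  a < b -> (forall x, a <= x <= b -> continuous f x) ->
  (forall x, a < x < b -> is_derive f x (f1 x)) ->
  continuous f1 a -> (forall x, a < x < b -> f a <= f x) -> 0 <= f1 a.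
Proof.
  intros Hab Hc Hd Hc1 Hmin.
  destruct (Rle_lt_dec 0 (f1 a)) as [H|H]; [exact H|exfalso].
  destruct (continuous_pos_near (fun x => - f1 x) a) as [d [Hd0 Hn]].
  { apply continuous_opp_R, Hc1. } { lra. }
  set (t := a + Rmin (d / 2) ((b - a) / 2)).
  assert (Ht : 0 < Rmin (d / 2) ((b - a) / 2)) by (apply Rmin_pos; lra).
  generalize (Rmin_l (d / 2) ((b - a) / 2)) (Rmin_r (d / 2) ((b - a) / 2)); intros.
  destruct (MVT_open f f1 a t) as [c [Hc' E]].
  - unfold t; lra.
  - intros x Hx; apply Hc; unfold t in Hx; lra.
  - intros x Hx; apply Hd; unfold t in Hx; lra.
  - specialize (Hmin t). specialize (Hn c).
    assert (f a <= f t) by (apply Hmin; unfold t; lra).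
    assert (0 < - f1 c).
    { apply Hn. unfold t in Hc'. rewrite Rabs_pos_eq; lra. }
    assert (0 < (- f1 c) * (t - a)) by (apply Rmult_lt_0_compat; [lra | unfold t; lra]).
    lra.
Qed.

Lemma derive_zero_local_min (f f1 : R -> R) (a b m : R) :
  a < m < b -> (forall x, a < x < b -> is_derive f x (f1 x)) ->
  (forall x, a < x < b -> f m <= f x) -> f1 m = 0.
Proof.
  intros Hm Hd Hmin.
  assert (pr : derivable_pt f m).
  { exists (f1 m). apply is_derive_Reals, Hd, Hm. }
  rewrite <- (deriv_minimum f a b m pr (proj1 Hm) (proj2 Hm)).
  - symmetry. apply derive_pt_eq, is_derive_Reals, Hd, Hm.
  - intros x H1 H2. apply Hmin; lra.
Qed.

Lemma second_derive_nonneg_min (f f1 : R -> R) (f2m a b m : R) :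
  a < m < b -> (forall x, a < x < b -> is_derive f x (f1 x)) ->
  is_derive f1 m f2m ->
  (forall x, a < x < b -> f m <= f x) -> 0 <= f2m.
Proof.
  intros Hm Hd Hd2 Hmin.
  destruct (Rle_lt_dec 0 f2m) as [H|H]; [exact H|exfalso].
  assert (E := derive_zero_local_min f f1 a b m Hm Hd Hmin).
  apply is_derive_Reals in Hd2.
  destruct (Hd2 (- f2m / 2) ltac:(lra)) as [d Hd3].
  set (h := Rmin (d / 2) ((b - m) / 2)).
  assert (Hdp := cond_pos d).
  assert (Ht : 0 < h) by (apply Rmin_pos; lra).
  assert (Hl : h <= d / 2) by apply Rmin_l.
  assert (Hr : h <= (b - m) / 2) by apply Rmin_r.
  destruct (MVT_open f f1 m (m + h)) as [c [Hc' E2]].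
  - lra.
  - intros x Hx. apply (ex_derive_continuous f). exists (f1 x); apply Hd; lra.
  - intros x Hx; apply Hd; lra.
  - assert (f m <= f (m + h)) by (apply Hmin; lra).
    specialize (Hd3 (c - m)).
    replace (m + (c - m)) with c in Hd3 by ring.
    rewrite E in Hd3.
    assert (A : Rabs ((f1 c - 0) / (c - m) - f2m) < - f2m / 2).
    { apply Hd3; [lra | rewrite Rabs_pos_eq; lra]. }
    apply Rabs_def2 in A.
    assert (B : (f1 c - 0) / (c - m) < 0) by lra.
    assert (C : f1 c = ((f1 c - 0) / (c - m)) * (c - m)) by (field; lra).
    assert (D : 0 < - ((f1 c - 0) / (c - m)) * (c - m))
      by (apply Rmult_lt_0_compat; lra).
    assert (F : 0 < - f1 c * (m + h - m)) by (apply Rmult_lt_0_compat; lra).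
    lra.
Qed.

(* The perturbation by [e * x^2] makes the second-order condition at the minimum strict. *)
Lemma min_principle (z z1 z2 : R -> R) (a b : R) :
  0 <= a -> a <= b -> b <= 1 -> (forall x, a <= x <= b -> continuous z x) ->
  (forall x, a < x < b -> is_derive z x (z1 x)) ->
  (forall x, a < x < b -> is_derive z1 x (z2 x)) ->
  0 <= z a -> 0 <= z b ->
  (forall x, a < x < b -> z x < 0 -> z2 x <= 0) ->
  forall x, a <= x <= b -> 0 <= z x.
Proof.
  intros Ha Hab Hb Hc Hd1 Hd2 Hza Hzb Hz2 t Ht.
  destruct (Rle_lt_dec 0 (z t)) as [H|H]; [exact H|exfalso].
  (* At its minimum the perturbed function is at most [z t = - 4 e], whereas at both ends it is at
     least [- e]; so the minimum is interior and [z m < 0]. *)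
  set (e := - z t / 4).
  assert (He : 0 < e) by (unfold e; lra).
  destruct (continuous_min_ab (fun x => z x - e * (x * x)) a b Hab) as [m [Hm Hmin]].
  { intros x Hx. apply (continuous_minus (V := R_NormedModule)); [apply Hc, Hx|].
    apply (ex_derive_continuous (fun x => e * (x * x))). auto_derive; auto. }
  assert (M1 := Hmin t Ht). simpl in M1.
  assert (0 <= e * (t * t)) by (apply Rmult_le_pos; [lra | nra]).
  assert (Hsq : forall x, a <= x <= b -> e * (x * x) <= e).
  { intros x Hx. rewrite <- (Rmult_1_r e) at 2. apply Rmult_le_compat_l; nra. }
  assert (M2 := Hsq m Hm).
  assert (Hzm : z m < 0) by (unfold e in *; lra).
  assert (Hm' : a < m < b).
  { split; apply Rnot_le_lt; intro Hle.
    - assert (m = a) by lra. subst m. lra.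
    - assert (m = b) by lra. subst m. lra. }
  assert (Hpos : 0 <= z2 m - 2 * e).
  { apply (second_derive_nonneg_min (fun x => z x - e * (x * x))
             (fun x => z1 x - e * (2 * x)) _ a b m Hm').
    - intros x Hx. apply is_derive_minus_R; [apply Hd1, Hx|].
      auto_derive; auto; ring.
    - apply is_derive_minus_R; [apply Hd2, Hm'|]. auto_derive; auto; ring.
    - intros x Hx. apply Hmin; lra. }
  specialize (Hz2 m Hm' Hzm). lra.
Qed.

(** The comparison function [c x exp (l x)] has second derivative [c (2 l + l^2 x) exp (l x)], which
    is at least [l] times the function because [x <= 1]. It vanishes at [0] and equals [w] at [x0],
    so the minimum principle places it below [w]. *)
Lemma hopf_bound_left (l : R) (w w1 w2 : R -> R) (x0 : R) :
  0 < l -> 0 < x0 < 1 -> (forall x, continuous w x) ->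
  (forall x, in_open01 x -> is_derive w x (w1 x)) ->
  (forall x, in_open01 x -> is_derive w1 x (w2 x)) ->
  (forall x, in_open01 x -> w2 x <= l * w x) ->
  0 <= w 0 -> 0 < w x0 ->
  exists c, 0 < c /\ forall x, 0 <= x <= x0 -> c * x <= w x.
Proof.
  intros Hl Hx0 Hc Hd1 Hd2 Hw2 Hw0 Hwx.
  set (c := w x0 / (x0 * exp (l * x0))).
  assert (Hp : 0 < x0 * exp (l * x0))
    by (apply Rmult_lt_0_compat; [lra | apply exp_pos]).
  assert (Hcp : 0 < c) by (apply Rdiv_lt_0_compat; lra).
  exists c; split; [exact Hcp|]. intros x Hx.
  assert (Hexp : forall y, 0 <= y -> 1 <= exp (l * y)).
  { intros y Hy. rewrite <- exp_0. destruct (Rle_lt_or_eq_dec 0 (l * y)) as [H|H].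
    - apply Rmult_le_pos; lra.
    - left; apply exp_increasing, H.
    - rewrite <- H; lra. }
  assert (Hmp : 0 <= w x - c * (x * exp (l * x))).
  { apply (min_principle (fun y => w y - c * (y * exp (l * y)))
      (fun y => w1 y - c * ((1 + l * y) * exp (l * y)))
      (fun y => w2 y - c * ((2 * l + l * (l * y)) * exp (l * y))) 0 x0);
      try lra.
    - intros y _. apply (continuous_minus (V := R_NormedModule)); [apply Hc|].
      apply (ex_derive_continuous (fun y => c * (y * exp (l * y)))).
      auto_derive; auto.
    - intros y Hy. apply is_derive_minus_R; [apply Hd1; split; lra|].
      auto_derive; auto; ring.
    - intros y Hy. apply is_derive_minus_R; [apply Hd2; split; lra|].
      auto_derive; auto; ring.
    - replace (c * (x0 * exp (l * x0))) with (w x0) by (unfold c; field; split;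
        [apply Rgt_not_eq, exp_pos | lra]). lra.
    - intros y Hy Hneg.
      assert (Hy2 := Hw2 y ltac:(split; lra)).
      assert (He := exp_pos (l * y)).
      assert (l * (c * (y * exp (l * y))) <= c * ((2 * l + l * (l * y)) * exp (l * y))).
      { replace (l * (c * (y * exp (l * y)))) with (c * ((l * y) * exp (l * y))) by ring.
        apply Rmult_le_compat_l; [lra|]. apply Rmult_le_compat_r; [lra|].
        assert (0 <= l * (l * y)) by (apply Rmult_le_pos; [lra | apply Rmult_le_pos; lra]).
        assert (l * y <= l * 1) by (apply Rmult_le_compat_l; lra).
        lra. }
      assert (l * w y <= l * (c * (y * exp (l * y)))) by (apply Rmult_le_compat_l; lra).
      lra. }
  assert (c * (x * 1) <= c * (x * exp (l * x))).
  { apply Rmult_le_compat_l; [lra|]. apply Rmult_le_compat_l; [lra|]. apply Hexp; lra. }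
  lra.
Qed.

Lemma hopf_bound (l : R) (w w1 w2 : R -> R) (x0 : R) :
  0 < l -> 0 < x0 < 1 -> (forall x, continuous w x) ->
  (forall x, in_open01 x -> is_derive w x (w1 x)) ->
  (forall x, in_open01 x -> is_derive w1 x (w2 x)) ->
  (forall x, in_open01 x -> w2 x <= l * w x) ->
  0 <= w 0 -> 0 <= w 1 -> 0 < w x0 ->
  exists c, 0 < c /\ forall x, 0 <= x <= 1 -> c * (x * (1 - x)) <= w x.
Proof.
  intros Hl Hx0 Hc Hd1 Hd2 Hw2 Hw0 Hw1 Hwx.
  destruct (hopf_bound_left l w w1 w2 x0) as [c [Hcp H]]; auto.
  destruct (hopf_bound_left l (fun x => w (1 - x)) (fun x => - w1 (1 - x))
      (fun x => w2 (1 - x)) (1 - x0)) as [c' [Hcp' H']]; auto; try lra.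
  - intros x. apply continuous_reflect, Hc.
  - intros x Hx. apply is_derive_reflect, Hd1. unfold in_open01 in *; lra.
  - intros x Hx. rewrite <- (Ropp_involutive (w2 (1 - x))).
    apply is_derive_opp_R, is_derive_reflect, Hd2. unfold in_open01 in *; lra.
  - intros x Hx. apply Hw2. unfold in_open01 in *; lra.
  - replace (1 - 0) with 1 by ring. exact Hw1.
  - replace (1 - (1 - x0)) with x0 by ring. exact Hwx.
  - exists (Rmin c c'). split; [apply Rmin_pos; assumption|].
    intros x Hx. assert (Rmin c c' <= c) by apply Rmin_l.
    assert (Rmin c c' <= c') by apply Rmin_r.
    assert (0 < Rmin c c') by (apply Rmin_pos; assumption).
    destruct (Rle_lt_dec x x0) as [Hle|Hlt].
    + specialize (H x ltac:(lra)). apply Rle_trans with (2 := H).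
      apply Rmult_le_compat; try lra; nra.
    + specialize (H' (1 - x) ltac:(lra)). replace (1 - (1 - x)) with x in H' by ring.
      apply Rle_trans with (2 := H').
      apply Rmult_le_compat; try lra; nra.
Qed.

(** * Interlacing sign changes *)

Lemma zero_accumulation_value (F : R -> R) (s : R) :
  continuous F s ->
  (forall e, 0 < e -> exists c, s - e < c < s /\ F c = 0) -> F s = 0.
Proof.
  intros Hc H. destruct (Req_dec (F s) 0) as [E|N]; [exact E|exfalso].
  destruct (continuous_eps F s (Rabs (F s)) Hc (Rabs_pos_lt _ N)) as [d [Hd H']].
  destruct (H d Hd) as [c [Hc' E]].
  specialize (H' c). rewrite E, Rminus_0_l, Rabs_Ropp in H'.
  assert (Hd' : Rabs (c - s) < d) by (apply Rabs_def1; lra).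
  specialize (H' Hd'). lra.
Qed.

(** Between a zero [c] and [s], which is itself a zero, Rolle's theorem gives a zero of [F1]. *)
Lemma zero_accumulation_derive (F F1 : R -> R) (s : R) :
  0 < s <= 1 -> (forall x, continuous F x) -> continuous F1 s ->
  (forall x, in_open01 x -> is_derive F x (F1 x)) ->
  (forall e, 0 < e -> exists c, s - e < c < s /\ F c = 0) -> F1 s = 0.
Proof.
  intros Hs Hc Hc1 Hd H.
  assert (E := zero_accumulation_value F s (Hc s) H).
  apply zero_accumulation_value; [exact Hc1|].
  intros e He.
  destruct (H (Rmin e s)) as [c [Hc' E']]; [apply Rmin_pos; lra|].
  assert (Rmin e s <= e) by apply Rmin_l. assert (Rmin e s <= s) by apply Rmin_r.
  destruct (MVT_open F F1 c s) as [t [Ht Et]]; try lra; auto.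
  - intros x Hx; apply Hd; unfold in_open01; lra.
  - exists t; split; [lra|]. rewrite E, E' in Et.
    apply Rmult_eq_reg_r with (s - c); lra.
Qed.

Lemma continuous_zero_between (F : R -> R) (a b : R) :
  (forall x, continuous F x) -> a < b -> F a * F b < 0 ->
  exists c, a < c < b /\ F c = 0.
Proof.
  intros Hc Hab Hs.
  assert (Hc' : continuity F) by (intros x; apply continuity_pt_filterlim, Hc).
  destruct (IVT_cor F a b Hc' ltac:(lra) ltac:(lra)) as [c [H1 H2]].
  exists c; split; [|exact H2].
  split; apply Rnot_le_lt; intro Hle.
  - assert (c = a) by lra. subst. rewrite H2 in Hs. lra.
  - assert (c = b) by lra. subst. rewrite H2 in Hs. lra.
Qed.

Lemma Rabs_le_derive_bound (F F1 : R -> R) (a s M : R) :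
  (forall x, continuous F x) -> (forall x, a < x < s -> is_derive F x (F1 x)) ->
  F s = 0 -> (forall x, a < x < s -> Rabs (F1 x) <= M) ->
  forall t, a <= t <= s -> Rabs (F t) <= M * (s - t).
Proof.
  intros Hc Hd E HM t Ht.
  destruct (Req_dec t s) as [->|N].
  - rewrite E, Rabs_R0. lra.
  - destruct (MVT_open F F1 t s) as [c [Hc' E']]; try lra; auto.
    + intros x Hx; apply Hd; lra.
    + rewrite E in E'. replace (F t) with (- (F1 c * (s - t))) by lra.
      rewrite Rabs_Ropp, Rabs_mult, (Rabs_pos_eq (s - t)) by lra.
      apply Rmult_le_compat_r; [lra | apply HM; lra].
Qed.

(** Unique continuation to the left of [s], including [s = 1], where the bound is singular. With [A]
    the maximum of [|U1| + |V1|] on a short window, the vanishing data give [|U|, |V| <= A (s - x)],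
    and [s - x <= 1 - x] cancels the singular factor. Integrating the second derivatives then bounds
    [A] by half of itself. *)
Lemma cauchy_data_zero_left (U U1 U2 V V1 V2 : R -> R) (K s : R) :
  0 < K -> 0 < s <= 1 ->
  (forall x, continuous U x) -> (forall x, continuous U1 x) ->
  (forall x, continuous V x) -> (forall x, continuous V1 x) ->
  (forall x, in_open01 x -> is_derive U x (U1 x)) ->
  (forall x, in_open01 x -> is_derive U1 x (U2 x)) ->
  (forall x, in_open01 x -> is_derive V x (V1 x)) ->
  (forall x, in_open01 x -> is_derive V1 x (V2 x)) ->
  (forall x, in_open01 x ->
     Rabs (U2 x) <= K * (Rabs (U x) + Rabs (V x)) / (x * (1 - x))) ->
  (forall x, in_open01 x ->
     Rabs (V2 x) <= K * (Rabs (U x) + Rabs (V x)) / (x * (1 - x))) ->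
  U s = 0 -> U1 s = 0 -> V s = 0 -> V1 s = 0 ->
  exists d, 0 < d /\ forall x, s - d < x < s -> U x = 0 /\ V x = 0.
Proof.
  intros HK Hs cU cU1 cV cV1 dU dU1 dV dV1 bU bV U0 U10 V0 V10.
  (* For [x >= s / 2] one has [2 K (s - x) / (x (1 - x)) <= 4 K / s]. A window of length at most
     [1 / (4 L)] then makes each of [|U1 m|] and [|V1 m|] at most [A / 4]. *)
  set (L := 4 * K / s).
  assert (HL : 0 < L) by (apply Rdiv_lt_0_compat; lra).
  set (d := Rmin (s / 2) (/ (4 * L))).
  assert (Hd : 0 < d) by (apply Rmin_pos; [lra | apply Rinv_0_lt_compat; lra]).
  assert (Hd1 : d <= s / 2) by apply Rmin_l.
  assert (Hd2 : d <= / (4 * L)) by apply Rmin_r.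
  destruct (continuous_max_ab (fun x => Rabs (U1 x) + Rabs (V1 x)) (s - d) s)
    as [m [Hm Hmax]]; [lra| |].
  { intros x _.
    apply (continuous_plus (V := R_NormedModule));
      (apply continuous_comp; [auto | apply continuous_Rabs]). }
  set (A := Rabs (U1 m) + Rabs (V1 m)) in *.
  assert (HA : 0 <= A) by (unfold A; generalize (Rabs_pos (U1 m)) (Rabs_pos (V1 m)); lra).
  assert (BU : forall t, s - d <= t <= s -> Rabs (U t) <= A * (s - t)).
  { apply Rabs_le_derive_bound with U1; auto.
    - intros x Hx; apply dU; unfold in_open01; lra.
    - intros x Hx. specialize (Hmax x ltac:(lra)). generalize (Rabs_pos (V1 x)); simpl in Hmax; lra. }
  assert (BV : forall t, s - d <= t <= s -> Rabs (V t) <= A * (s - t)).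
  { apply Rabs_le_derive_bound with V1; auto.
    - intros x Hx; apply dV; unfold in_open01; lra.
    - intros x Hx. specialize (Hmax x ltac:(lra)). generalize (Rabs_pos (U1 x)); simpl in Hmax; lra. }
  assert (B2 : forall x, s - d < x < s ->
    K * (Rabs (U x) + Rabs (V x)) / (x * (1 - x)) <= L * A).
  { intros x Hx. specialize (BU x ltac:(lra)). specialize (BV x ltac:(lra)).
    assert (Hxx : 0 < x * (1 - x)) by (apply Rmult_lt_0_compat; lra).
    apply Rmult_le_reg_r with (x * (1 - x)); [exact Hxx|].
    unfold Rdiv. rewrite Rmult_assoc, Rinv_l, Rmult_1_r by lra.
    apply Rle_trans with (K * (2 * A * (s - x))).
    - apply Rmult_le_compat_l; lra.
    - replace (L * A * (x * (1 - x))) with (K * (2 * A * ((2 / s * x) * (1 - x))))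
        by (unfold L; field; lra).
      apply Rmult_le_compat_l; [lra|]. apply Rmult_le_compat_l; [lra|].
      assert (1 <= 2 / s * x).
      { apply Rmult_le_reg_r with s; [lra|]. replace (2 / s * x * s) with (2 * x) by (field; lra). lra. }
      apply Rle_trans with (1 * (1 - x)); [lra|]. apply Rmult_le_compat_r; lra. }
  assert (CU : Rabs (U1 m) <= L * A * (s - m)).
  { apply (Rabs_le_derive_bound U1 U2 (s - d)); auto.
    - intros x Hx; apply dU1; unfold in_open01; lra.
    - intros x Hx. apply Rle_trans with (2 := B2 x Hx). apply bU; unfold in_open01; lra. }
  assert (CV : Rabs (V1 m) <= L * A * (s - m)).
  { apply (Rabs_le_derive_bound V1 V2 (s - d)); auto.
    - intros x Hx; apply dV1; unfold in_open01; lra.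
    - intros x Hx. apply Rle_trans with (2 := B2 x Hx). apply bV; unfold in_open01; lra. }
  assert (HA0 : A = 0).
  { assert (L * A * (s - m) <= A / 4).
    { apply Rle_trans with (L * A * / (4 * L)).
      - apply Rmult_le_compat_l; [apply Rmult_le_pos; lra | lra].
      - right; field; lra. }
    unfold A in *; lra. }
  exists d; split; [exact Hd|]. intros x Hx.
  specialize (BU x ltac:(lra)). specialize (BV x ltac:(lra)).
  rewrite HA0, Rmult_0_l in BU, BV.
  generalize (Rabs_pos (U x)) (Rabs_pos (V x)); intros.
  split; apply Rabs_eq_0; lra.
Qed.

(* The component of [{F > 0}] at [z] meets [{G < 0}]. *)
Definition detects (F G : R -> R) : Prop :=
  forall z, in_open01 z -> 0 < F z ->
  exists y, in_open01 y /\ G y < 0 /\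
    forall t, Rmin z y <= t <= Rmax z y -> 0 < F t.

(** A clockwise quarter turn of the curve [(F, G)]: from the fourth to the third quadrant, within
    the lower half-plane. *)
Definition crossing (F G : R -> R) (z y : R) : Prop :=
  0 < z /\ z < y /\ y < 1 /\ F y < 0 < F z /\ (forall t, z <= t <= y -> G t < 0).

(** The component of [{F < 0}] at [y] contains a point [y'] with [G y' > 0]. This point is not in
    [[z, y]], where [G < 0], and not to the left of [z], because [F z > 0] bounds the component. So
    the chain can only move to the right. *)
Lemma crossing_step (F G : R -> R) (z y : R) :
  detects (fun x => - F x) (fun x => - G x) -> crossing F G z y ->
  exists y', y < y' /\ crossing (fun x => - G x) F y y'.
Proof.
  intros D [H0 [H1 [H2 [[H3 H4] H5]]]].
  destruct (D y) as [y' [Hy' [HG Hpos]]]; [split; lra | lra |].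
  destruct (Rle_lt_dec y' y) as [Hle|Hlt].
  - exfalso. destruct (Rle_lt_dec z y') as [Hz|Hz].
    + specialize (H5 y' ltac:(lra)). lra.
    + specialize (Hpos z). rewrite Rmin_right, Rmax_left in Hpos by lra.
      specialize (Hpos ltac:(lra)). lra.
  - exists y'. split; [exact Hlt|]. destruct Hy' as [Ha Hb].
    split; [lra|]. split; [lra|]. split; [lra|].
    specialize (H5 y ltac:(lra)). split; [lra|].
    intros t Ht. specialize (Hpos t). rewrite Rmin_left, Rmax_right in Hpos by lra.
    specialize (Hpos Ht). lra.
Qed.

(** The four quarter turns of one rotation, in order: each pair arises from the previous one by
    [(F, G) -> (- G, F)]. *)
Definition any_crossing (U V : R -> R) (z y : R) : Prop :=
  crossing U V z y \/ crossing (fun x => - V x) U z y \/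
  crossing (fun x => - U x) (fun x => - V x) z y \/ crossing V (fun x => - U x) z y.

Definition rotation_detects (U V : R -> R) : Prop :=
  detects U V /\ detects (fun x => - V x) U /\
  detects (fun x => - U x) (fun x => - V x) /\ detects V (fun x => - U x).

Lemma detects_ext (F F' G G' : R -> R) :
  (forall x, F x = F' x) -> (forall x, G x = G' x) -> detects F G -> detects F' G'.
Proof.
  intros EF EG D z Hz Hp. rewrite <- EF in Hp.
  destruct (D z Hz Hp) as [y [H1 [H2 H3]]]. exists y.
  rewrite <- EG. split; [exact H1|]. split; [exact H2|].
  intros t Ht. rewrite <- EF. auto.
Qed.

Lemma crossing_ext (F F' G G' : R -> R) (z y : R) :
  (forall x, F x = F' x) -> (forall x, G x = G' x) ->
  crossing F G z y -> crossing F' G' z y.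
Proof.
  intros EF EG [H0 [H1 [H2 [H3 H4]]]]. unfold crossing. rewrite <- !EF.
  repeat split; try tauto. intros t Ht. rewrite <- EG. auto.
Qed.

Lemma any_crossing_step (U V : R -> R) (z y : R) :
  rotation_detects U V -> any_crossing U V z y ->
  exists y', y < y' /\ any_crossing U V y y'.
Proof.
  intros [D1 [D2 [D3 D4]]] [H|[H|[H|H]]].
  - destruct (crossing_step U V z y D3 H) as [y' [Hl H']].
    exists y'; split; [exact Hl|]. right; left; exact H'.
  - destruct (crossing_step (fun x => - V x) U z y) as [y' [Hl H']]; auto.
    + apply (detects_ext V _ (fun x => - U x) _); auto; intros; ring.
    + exists y'; split; [exact Hl|]. right; right; left; exact H'.
  - destruct (crossing_step (fun x => - U x) (fun x => - V x) z y) as [y' [Hl H']]; auto.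
    + apply (detects_ext U _ V _); auto; intros; ring.
    + exists y'; split; [exact Hl|]. right; right; right.
      revert H'; apply crossing_ext; intros; ring.
  - destruct (crossing_step V (fun x => - U x) z y) as [y' [Hl H']]; auto.
    + apply (detects_ext (fun x => - V x) _ U _); auto; intros; ring.
    + exists y'; split; [exact Hl|]. left.
      revert H'; apply crossing_ext; intros; ring.
Qed.

(** A quarter turn changes the sign of one of the two functions, and the next quarter turn that of
    the other. *)
Lemma any_crossing_zero (U V : R -> R) (z y : R) :
  (forall x, continuous U x) -> (forall x, continuous V x) ->
  rotation_detects U V ->
  any_crossing U V z y ->
  exists y', y < y' /\ any_crossing U V y y' /\
  (exists c, z < c < y' /\ U c = 0) /\ (exists c, z < c < y' /\ V c = 0).
Proof.
  intros cU cV D H.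
  destruct (any_crossing_step U V z y D H) as [t [Ht H']].
  exists t; split; [exact Ht|]. split; [exact H'|].
  assert (Z : forall F a b, (forall x, continuous F x) -> z <= a -> b <= t -> a < b ->
     F a * F b < 0 -> exists c, z < c < t /\ F c = 0).
  { intros F a b cF Ha Hb Hab Hneg.
    destruct (continuous_zero_between F a b cF Hab Hneg) as [c [Hc E]].
    exists c; split; [lra | exact E]. }
  unfold any_crossing, crossing in H, H'.
  assert (G1 : z < y) by intuition.
  destruct H as [H|[H|[H|H]]]; destruct H as [_ [_ [_ [S1 S2]]]];
  assert (Gy := S2 y ltac:(lra));
  destruct H' as [H'|[H'|[H'|H']]]; destruct H' as [_ [_ [_ [S3 S4]]]];
  assert (Gy' := S4 y ltac:(lra)); try lra;
  (split; [first [apply (Z U z y); auto; [lra|lra|nra] | apply (Z U y t); auto; [lra|lra|nra]]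
          |first [apply (Z V z y); auto; [lra|lra|nra] | apply (Z V y t); auto; [lra|lra|nra]]]).
Qed.

(* Crossings march to the right forever, so both functions have zeros accumulating at the
   supremum of their positions, and all Cauchy data vanish there. *)
Lemma no_crossing (U U1 V V1 : R -> R) (z y : R) :
  (forall x, continuous U x) -> (forall x, continuous U1 x) ->
  (forall x, continuous V x) -> (forall x, continuous V1 x) ->
  (forall x, in_open01 x -> is_derive U x (U1 x)) ->
  (forall x, in_open01 x -> is_derive V x (V1 x)) ->
  (forall s, 0 < s <= 1 -> U s = 0 -> U1 s = 0 -> V s = 0 -> V1 s = 0 ->
     exists d, 0 < d /\ forall x, s - d < x < s -> U x = 0 /\ V x = 0) ->
  rotation_detects U V -> ~ any_crossing U V z y.
Proof.
  intros cU cU1 cV cV1 dU dV loc D H.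
  (* The right ends of all crossings. Their supremum [s] is not attained, because each crossing has
     a successor that ends further to the right. *)
  set (E := fun t => exists z, any_crossing U V z t).
  assert (HE : forall t, E t -> 0 < t < 1).
  { intros t [z' H']. unfold any_crossing, crossing in H'. intuition lra. }
  destruct (completeness E) as [s [Hub Hlub]].
  { exists 1. intros t Ht. specialize (HE t Ht). lra. }
  { exists y, z. exact H. }
  assert (Hnext : forall t, E t -> t < s).
  { intros t [z' H']. destruct (any_crossing_step U V z' t D H') as [t' [Hl H'']].
    assert (E t') by (exists t; exact H''). specialize (Hub t' H0). lra. }
  assert (Hs : 0 < s <= 1).
  { split.
    - assert (Ey : E y) by (exists z; exact H). specialize (HE y Ey). specialize (Hnext y Ey). lra.
    - apply Hlub. intros t Ht. specialize (HE t Ht). lra. }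
  assert (Hclose : forall e, 0 < e -> exists t, s - e < t < s /\ E t).
  { intros e He. destruct (Classical_Prop.classic (exists t, s - e < t < s /\ E t)) as [C|C]; [exact C|exfalso].
    assert (s <= s - e); [|lra]. apply Hlub. intros t Ht.
    apply Rnot_lt_le; intro Hl. apply C. exists t. specialize (Hnext t Ht). split; [lra|exact Ht]. }
  assert (Hzero : forall e, 0 < e ->
    (exists c, s - e < c < s /\ U c = 0) /\ (exists c, s - e < c < s /\ V c = 0)).
  { intros e He. destruct (Hclose e He) as [t [Ht [z' Hz']]].
    destruct (any_crossing_step U V z' t D Hz') as [t' [Hl H'']].
    destruct (any_crossing_zero U V t t' cU cV D H'') as [t2 [Hl2 [H2 [[c [Hc Ec]] [c' [Hc' Ec']]]]]].
    assert (t2 < s) by (apply Hnext; exists t'; exact H2).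
    split; [exists c | exists c']; (split; [lra | assumption]). }
  assert (HU : U s = 0) by (apply zero_accumulation_value; auto; intros e He; apply (Hzero e He)).
  assert (HV : V s = 0) by (apply zero_accumulation_value; auto; intros e He; apply (Hzero e He)).
  assert (HU1 : U1 s = 0) by (apply (zero_accumulation_derive U U1); auto; intros e He; apply (Hzero e He)).
  assert (HV1 : V1 s = 0) by (apply (zero_accumulation_derive V V1); auto; intros e He; apply (Hzero e He)).
  destruct (loc s Hs HU HU1 HV HV1) as [d [Hd Hl]].
  (* Some crossing ends in the window where both functions vanish, although one of them is nonzero
     at its end. *)
  destruct (Hclose d Hd) as [t [Ht [z' Hz']]].
  specialize (Hl t Ht). destruct Hl as [L1 L2].
  unfold any_crossing, crossing in Hz'.
  destruct Hz' as [H'|[H'|[H'|H']]]; destruct H' as [_ [_ [_ [S3 S4]]]];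
  lra.
Qed.

Lemma detects_reflect (F G : R -> R) :
  detects F G -> detects (fun x => F (1 - x)) (fun x => G (1 - x)).
Proof.
  intros D z Hz Hp. unfold in_open01 in *.
  destruct (D (1 - z)) as [y [H1 [H2 H3]]]; [unfold in_open01; lra | exact Hp |].
  unfold in_open01 in H1.
  exists (1 - y). replace (1 - (1 - y)) with y by ring.
  split; [unfold in_open01; lra|]. split; [exact H2|].
  intros t Ht. apply H3. unfold Rmin, Rmax in *.
  destruct (Rle_dec z (1 - y)); destruct (Rle_dec (1 - z) y); lra.
Qed.

(** If one of [U], [- V], [- U], [V] is positive somewhere, two consecutive detections produce a
    crossing that runs to the right or to the left. [no_crossing] excludes the first kind for
    [(U, V)] and the second for the pair reflected in [1/2]. *)
Lemma detects_vanish (U U1 U2 V V1 V2 : R -> R) (K : R) :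
  0 < K ->
  (forall x, continuous U x) -> (forall x, continuous U1 x) ->
  (forall x, continuous V x) -> (forall x, continuous V1 x) ->
  (forall x, in_open01 x -> is_derive U x (U1 x)) ->
  (forall x, in_open01 x -> is_derive U1 x (U2 x)) ->
  (forall x, in_open01 x -> is_derive V x (V1 x)) ->
  (forall x, in_open01 x -> is_derive V1 x (V2 x)) ->
  (forall x, in_open01 x ->
     Rabs (U2 x) <= K * (Rabs (U x) + Rabs (V x)) / (x * (1 - x))) ->
  (forall x, in_open01 x ->
     Rabs (V2 x) <= K * (Rabs (U x) + Rabs (V x)) / (x * (1 - x))) ->
  rotation_detects U V ->
  forall x, in_open01 x -> U x = 0 /\ V x = 0.
Proof.
  intros HK cU cU1 cV cV1 dU dU1 dV dV1 bU bV D.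
  assert (C1 : forall z y, ~ any_crossing U V z y).
  { intros z y. apply (no_crossing U U1 V V1); auto.
    intros s Hs E1 E2 E3 E4. apply (cauchy_data_zero_left U U1 U2 V V1 V2 K s); auto. }
  assert (refl1 : forall x, in_open01 x -> in_open01 (1 - x))
    by (unfold in_open01; intros; lra).
  assert (C2 : forall z y, ~ any_crossing (fun x => U (1 - x)) (fun x => V (1 - x)) z y).
  { intros z y.
    assert (R2 : forall F1 F2 : R -> R, (forall x, in_open01 x -> is_derive F1 x (F2 x)) ->
      forall x, in_open01 x -> is_derive (fun t => - F1 (1 - t)) x (F2 (1 - x))).
    { intros F1 F2 H x Hx. rewrite <- (Ropp_involutive (F2 (1 - x))).
      apply is_derive_opp_R, is_derive_reflect; auto. }
    assert (R3 : forall F : R -> R, (forall x, continuous F x) ->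
      forall x, continuous (fun t => - F (1 - t)) x).
    { intros F H x. apply continuous_opp_R, continuous_reflect; auto. }
    assert (R4 : forall F F1 : R -> R, (forall x, in_open01 x -> is_derive F x (F1 x)) ->
      forall x, in_open01 x -> is_derive (fun t => F (1 - t)) x (- F1 (1 - x))).
    { intros F F1 H x Hx. apply is_derive_reflect; auto. }
    apply (no_crossing _ (fun x => - U1 (1 - x)) _ (fun x => - V1 (1 - x)));
      try (intros x; apply continuous_reflect; auto); auto.
    - intros s Hs E1 E2 E3 E4.
      apply (cauchy_data_zero_left (fun x => U (1 - x)) (fun x => - U1 (1 - x)) (fun x => U2 (1 - x))
         (fun x => V (1 - x)) (fun x => - V1 (1 - x)) (fun x => V2 (1 - x)) K s); auto;
      try (intros x; apply continuous_reflect; auto);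
      try (apply R2; assumption);
      intros x Hx; replace (x * (1 - x)) with ((1 - x) * (1 - (1 - x))) by ring; auto.
    - destruct D as [D1 [D2 [D3 D4]]].
      split; [|split; [|split]]; apply detects_reflect in D1, D2, D3, D4; assumption. }
  assert (P : forall F G, detects F G -> detects (fun x => - G x) F ->
     (forall z y, ~ crossing F G z y) ->
     (forall z y, ~ crossing (fun x => F (1 - x)) (fun x => G (1 - x)) z y) ->
     forall x, in_open01 x -> F x <= 0).
  { clear. intros F G D1 D2 N1 N2 x Hx. apply Rnot_lt_le; intro Hp.
    destruct (D1 x Hx Hp) as [y [Hy [Gy Fpos]]].
    destruct (D2 y Hy ltac:(lra)) as [y' [Hy' [Fy' Gneg]]].
    assert (Fy : 0 < F y).
    { apply Fpos. split; [apply Rmin_r | apply Rmax_r]. }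
    unfold in_open01 in *.
    destruct (Rtotal_order y y') as [Hl|[He|Hl]].
    - apply (N1 y y'). repeat split; try lra.
      intros t Ht. specialize (Gneg t). rewrite Rmin_left, Rmax_right in Gneg by lra.
      specialize (Gneg Ht); lra.
    - subst; lra.
    - apply (N2 (1 - y) (1 - y')). repeat split; try lra.
      + replace (1 - (1 - y')) with y' by ring; lra.
      + replace (1 - (1 - y)) with y by ring; lra.
      + intros t Ht. specialize (Gneg (1 - t)). rewrite Rmin_right, Rmax_left in Gneg by lra.
        specialize (Gneg ltac:(lra)); lra. }
  destruct D as [D1 [D2 [D3 D4]]].
  assert (N1 : forall x, in_open01 x -> U x <= 0).
  { apply (P U V); auto; intros z y C; [apply (C1 z y) | apply (C2 z y)]; left; exact C. }
  assert (N2 : forall x, in_open01 x -> - V x <= 0).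
  { apply (P (fun x => - V x) U); auto; intros z y C; [apply (C1 z y) | apply (C2 z y)];
    right; left; exact C. }
  assert (N3 : forall x, in_open01 x -> - U x <= 0).
  { apply (P (fun x => - U x) (fun x => - V x)); auto.
    - apply (detects_ext V _ (fun x => - U x) _); auto; intros; ring.
    - intros z y C; apply (C1 z y); right; right; left; exact C.
    - intros z y C; apply (C2 z y); right; right; left; exact C. }
  assert (N4 : forall x, in_open01 x -> V x <= 0).
  { apply (P V (fun x => - U x)); auto.
    - apply (detects_ext U _ V _); auto; intros; ring.
    - intros z y C; apply (C1 z y); right; right; right; exact C.
    - intros z y C; apply (C2 z y); right; right; right; exact C. }
  intros x Hx. specialize (N1 x Hx). specialize (N2 x Hx).
  specialize (N3 x Hx). specialize (N4 x Hx). lra.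
Qed.

Lemma last_zero_before (F : R -> R) (z : R) :
  (forall x, continuous F x) -> 0 < z -> F 0 = 0 -> 0 < F z ->
  exists l, 0 <= l < z /\ F l = 0 /\ forall t, l < t <= z -> 0 < F t.
Proof.
  intros Hc Hz F0 Fz.
  set (E := fun t => 0 <= t <= z /\ F t <= 0).
  destruct (completeness E) as [l [Hub Hlub]].
  { exists z. intros t [Ht _]. lra. }
  { exists 0. split; lra. }
  assert (Hl0 : 0 <= l) by (apply Hub; split; lra).
  assert (Hlz : l <= z) by (apply Hlub; intros t [Ht _]; lra).
  assert (Hpos : forall t, l < t <= z -> 0 < F t).
  { intros t Ht. apply Rnot_le_lt; intro C. assert (t <= l); [|lra].
    apply Hub. split; lra. }
  assert (Fl : F l <= 0).
  { apply Rnot_lt_le; intro C. destruct (continuous_pos_near F l (Hc l) C) as [d [Hd H]].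
    assert (l <= l - d); [|lra]. apply Hlub. intros t Ht. assert (t <= l) by (apply Hub; exact Ht).
    apply Rnot_lt_le; intro C'. destruct Ht as [_ Ht]. specialize (H t).
    assert (0 < F t) by (apply H, Rabs_def1; lra). lra. }
  assert (Hlz' : l < z).
  { destruct Hlz as [H|H]; [exact H | subst; lra]. }
  exists l. split; [lra|]. split; [|exact Hpos].
  apply Rle_antisym; [exact Fl|]. apply Rnot_lt_le; intro C.
  destruct (continuous_pos_near (fun x => - F x) l) as [d [Hd H]].
  { apply continuous_opp_R, Hc. } { lra. }
  set (t := l + Rmin (d / 2) (z - l)).
  assert (0 < Rmin (d / 2) (z - l)) by (apply Rmin_pos; lra).
  assert (Rmin (d / 2) (z - l) <= d / 2) by apply Rmin_l.
  assert (Rmin (d / 2) (z - l) <= z - l) by apply Rmin_r.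
  specialize (H t). specialize (Hpos t).
  assert (0 < - F t) by (apply H, Rabs_def1; unfold t; lra).
  assert (0 < F t) by (apply Hpos; unfold t; lra). lra.
Qed.

Lemma first_zero_after (F : R -> R) (z : R) :
  (forall x, continuous F x) -> z < 1 -> F 1 = 0 -> 0 < F z ->
  exists r, z < r <= 1 /\ F r = 0 /\ forall t, z <= t < r -> 0 < F t.
Proof.
  intros Hc Hz F1 Fz.
  destruct (last_zero_before (fun x => F (1 - x)) (1 - z)) as [l [Hl [El Hp]]].
  - intros x; apply continuous_reflect, Hc.
  - lra.
  - rewrite Rminus_0_r; exact F1.
  - replace (1 - (1 - z)) with z by ring; exact Fz.
  - exists (1 - l). split; [lra|]. split; [exact El|].
    intros t Ht. specialize (Hp (1 - t)). replace (1 - (1 - t)) with t in Hp by ring.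
    apply Hp; lra.
Qed.

Lemma detects_intro (F G : R -> R) :
  (forall x, continuous F x) -> F 0 = 0 -> F 1 = 0 ->
  (forall l r, 0 <= l -> l < r -> r <= 1 -> F l = 0 -> F r = 0 ->
     (forall t, l < t < r -> 0 < F t) -> (forall t, l < t < r -> 0 <= G t) -> False) ->
  detects F G.
Proof.
  intros Hc F0 F1 H z [Hz1 Hz2] Fz.
  destruct (last_zero_before F z Hc Hz1 F0 Fz) as [l [Hl [El Pl]]].
  destruct (first_zero_after F z Hc Hz2 F1 Fz) as [r [Hr [Er Pr]]].
  assert (Pos : forall t, l < t < r -> 0 < F t).
  { intros t Ht. destruct (Rle_lt_dec t z); [apply Pl | apply Pr]; lra. }
  destruct (Classical_Prop.classic (exists y, l < y < r /\ G y < 0)) as [[y [Hy Gy]]|N].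
  - exists y. split; [split; lra|]. split; [exact Gy|].
    intros t Ht. apply Pos.
    unfold Rmin, Rmax in Ht. destruct (Rle_dec z y); lra.
  - exfalso. apply (H l r); auto; try lra.
    intros t Ht. apply Rnot_lt_le; intro C. apply N. exists t; auto.
Qed.

(** * Quotients of powers *)

Definition power_ratio (P Q u v : R) : R := Rpower u P / Rpower v Q.

(** In this form comparisons of quotients become linear inequalities in [ln u] and [ln v]. *)
Lemma power_ratio_exp (P Q u v : R) :
  power_ratio P Q u v = exp (P * ln u - Q * ln v).
Proof.
  unfold power_ratio, Rpower, Rdiv. rewrite <- exp_Ropp, <- exp_plus. f_equal; ring.
Qed.

Lemma power_ratio_pos (P Q u v : R) : 0 < power_ratio P Q u v.
Proof. rewrite power_ratio_exp; apply exp_pos. Qed.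

Lemma exp_le (a b : R) : a <= b -> exp a <= exp b.
Proof. intros [H| ->]; [left; apply exp_increasing, H | right; reflexivity]. Qed.

Lemma ln_le_mono (a b : R) : 0 < a -> a <= b -> ln a <= ln b.
Proof. intros Ha [H| ->]; [left; apply ln_increasing; auto | right; reflexivity]. Qed.

Lemma power_ratio_le (P Q u u' v v' : R) :
  0 <= P -> 0 <= Q -> 0 < u <= u' -> 0 < v' <= v ->
  power_ratio P Q u v <= power_ratio P Q u' v'.
Proof.
  intros HP HQ Hu Hv. rewrite !power_ratio_exp. apply exp_le.
  assert (P * ln u <= P * ln u') by (apply Rmult_le_compat_l; [auto | apply ln_le_mono; lra]).
  assert (Q * ln v' <= Q * ln v) by (apply Rmult_le_compat_l; [auto | apply ln_le_mono; lra]).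
  lra.
Qed.

(** Homogeneity of degree [P - Q]: if [u] and [v] both have the size of the distance [d] to the
    boundary, the quotient has the size of [d^(P - Q)], which stays bounded when [Q <= P]. *)
Lemma power_ratio_scale (P Q a b d : R) :
  0 < a -> 0 < b -> 0 < d ->
  power_ratio P Q (a * d) (b * d) = power_ratio P Q a b * Rpower d (P - Q).
Proof.
  intros Ha Hb Hd. rewrite !power_ratio_exp. unfold Rpower. rewrite <- exp_plus.
  f_equal. rewrite !ln_mult by assumption. ring.
Qed.

Lemma Rpower_le_1 (d e : R) : 0 < d <= 1 -> 0 <= e -> Rpower d e <= 1.
Proof.
  intros Hd He. unfold Rpower. rewrite <- exp_0. apply exp_le.
  assert (ln d <= 0) by (rewrite <- ln_1; apply ln_le_mono; lra).
  nra.
Qed.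

Lemma Rpower_ge_self (d e : R) : 0 < d <= 1 -> e <= 1 -> d <= Rpower d e.
Proof.
  intros Hd He. rewrite <- (exp_ln d) at 1 by lra. apply exp_le.
  assert (ln d <= 0) by (rewrite <- ln_1; apply ln_le_mono; lra).
  nra.
Qed.

Lemma exp_diff_le (a b B : R) :
  exp a <= B -> exp b <= B -> Rabs (exp a - exp b) <= B * Rabs (a - b).
Proof.
  assert (W : forall a b, exp a <= B -> b <= a -> Rabs (exp a - exp b) <= B * Rabs (a - b)).
  { clear. intros a b Ha Hab. assert (Hba := exp_le b a Hab).
    rewrite !Rabs_pos_eq by lra.
    apply Rle_trans with (exp a * (a - b)); [|apply Rmult_le_compat_r; lra].
    assert (H := exp_ineq1_le (b - a)). assert (Hp := exp_pos a).
    replace (exp b) with (exp a * exp (b - a)) by (rewrite <- exp_plus; f_equal; ring).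
    nra. }
  intros Ha Hb. destruct (Rle_lt_dec b a).
  - apply W; auto.
  - rewrite Rabs_minus_sym, (Rabs_minus_sym a b). apply W; auto; lra.
Qed.

Lemma ln_diff_le (a b m : R) :
  0 < m -> m <= a -> m <= b -> Rabs (ln a - ln b) <= Rabs (a - b) / m.
Proof.
  intros Hm.
  assert (W : forall a b, m <= b -> b <= a -> Rabs (ln a - ln b) <= Rabs (a - b) / m).
  { clear a b. intros a b Hb Hab. assert (H := ln_le_mono b a ltac:(lra) Hab).
    rewrite !Rabs_pos_eq by lra.
    apply Rle_trans with ((a - b) / b).
    - assert (Hab' : 0 < a / b) by (apply Rdiv_lt_0_compat; lra).
      rewrite <- ln_div by lra. assert (I := exp_ineq1_le (ln (a / b))).
      rewrite exp_ln in I by exact Hab'.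
      replace ((a - b) / b) with (a / b - 1) by (field; lra). lra.
    - apply Rmult_le_compat_l; [lra|]. apply Rinv_le_contravar; lra. }
  intros Ha Hb. destruct (Rle_lt_dec b a).
  - apply W; auto.
  - rewrite Rabs_minus_sym, (Rabs_minus_sym a b). apply W; auto; lra.
Qed.

Lemma power_ratio_bound (P Q M c d u v : R) :
  0 <= Q <= P -> 0 < M -> 0 < c -> 0 < d <= 1 ->
  0 < u <= M * d -> c * d <= v ->
  power_ratio P Q u v <= power_ratio P Q M c.
Proof.
  intros HPQ HM Hc Hd Hu Hv.
  apply Rle_trans with (power_ratio P Q (M * d) (c * d)).
  - apply power_ratio_le; try lra. split; [apply Rmult_lt_0_compat; lra | exact Hv].
  - rewrite power_ratio_scale by lra.
    rewrite <- (Rmult_1_r (power_ratio P Q M c)) at 2.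
    apply Rmult_le_compat_l; [left; apply power_ratio_pos|].
    apply Rpower_le_1; lra.
Qed.

(** The quotient is the exponential of [P ln u - Q ln v]. On the given range it is at most
    [power_ratio P Q M c], and [ln] has Lipschitz constants [1 / (k d)] for [u] and [1 / (c d)] for
    [v]. The summand [1] in the constant keeps [K] positive when [P = Q = 0]. *)
Lemma power_ratio_lipschitz (P Q k M c : R) :
  0 <= Q <= P -> 0 < k -> 0 < M -> 0 < c ->
  exists K, 0 < K /\ forall d u u' v v', 0 < d <= 1 ->
    k * d <= u <= M * d -> k * d <= u' <= M * d -> c * d <= v -> c * d <= v' ->
    Rabs (power_ratio P Q u v - power_ratio P Q u' v')
      <= K * (Rabs (u - u') + Rabs (v - v')) / d.
Proof.
  intros HPQ Hk HM Hc.
  set (B := power_ratio P Q M c).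
  assert (HB : 0 < B) by apply power_ratio_pos.
  assert (Pk : 0 <= P / k) by (apply Rdiv_le_0_compat; lra).
  assert (Qc : 0 <= Q / c) by (apply Rdiv_le_0_compat; lra).
  exists (B * (P / k + Q / c + 1)). split; [apply Rmult_lt_0_compat; lra|].
  intros d u u' v v' Hd Hu Hu' Hv Hv'.
  assert (Hkd : 0 < k * d) by (apply Rmult_lt_0_compat; lra).
  assert (Hcd : 0 < c * d) by (apply Rmult_lt_0_compat; lra).
  assert (V1 : power_ratio P Q u v <= B) by (apply power_ratio_bound with d; lra).
  assert (V2 : power_ratio P Q u' v' <= B) by (apply power_ratio_bound with d; lra).
  rewrite !power_ratio_exp in *.
  apply Rle_trans with (1 := exp_diff_le _ _ B V1 V2).
  assert (L1 := ln_diff_le u u' (k * d) Hkd ltac:(lra) ltac:(lra)).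
  assert (L2 := ln_diff_le v v' (c * d) Hcd ltac:(lra) ltac:(lra)).
  replace (B * (P / k + Q / c + 1) * (Rabs (u - u') + Rabs (v - v')) / d)
    with (B * ((P / k + Q / c + 1) * (Rabs (u - u') + Rabs (v - v')) / d)) by (field; lra).
  apply Rmult_le_compat_l; [lra|].
  replace (P * ln u - Q * ln v - (P * ln u' - Q * ln v'))
    with (P * (ln u - ln u') - Q * (ln v - ln v')) by ring.
  apply Rle_trans with (1 := Rabs_triang _ _).
  rewrite Rabs_Ropp, !Rabs_mult, (Rabs_pos_eq P), (Rabs_pos_eq Q) by lra.
  apply Rle_trans with (P * (Rabs (u - u') / (k * d)) + Q * (Rabs (v - v') / (c * d))).
  - apply Rplus_le_compat; apply Rmult_le_compat_l; lra.
  - assert (A1 := Rabs_pos (u - u')). assert (A2 := Rabs_pos (v - v')).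
    apply Rmult_le_reg_r with d; [lra|].
    replace ((P * (Rabs (u - u') / (k * d)) + Q * (Rabs (v - v') / (c * d))) * d)
      with (P / k * Rabs (u - u') + Q / c * Rabs (v - v')) by (field; lra).
    replace ((P / k + Q / c + 1) * (Rabs (u - u') + Rabs (v - v')) / d * d)
      with ((P / k + Q / c + 1) * (Rabs (u - u') + Rabs (v - v'))) by (field; lra).
    nra.
Qed.

(** * Uniqueness *)

(** Composition with it turns continuity relative to [[0, 1]] into continuity on the whole line
    without changing values on [[0, 1]], so the calculus lemmas can assume plain continuity. *)
Definition clamp01 (x : R) : R := Rmax 0 (Rmin 1 x).

Lemma clamp01_in (x : R) : in_closed01 (clamp01 x).
Proof.
  unfold clamp01, in_closed01, Rmax, Rmin.
  destruct (Rle_dec 1 x); destruct (Rle_dec 0 _); lra.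
Qed.

Lemma clamp01_id (x : R) : in_closed01 x -> clamp01 x = x.
Proof.
  unfold clamp01, in_closed01, Rmax, Rmin. intros H.
  destruct (Rle_dec 1 x); destruct (Rle_dec 0 _); lra.
Qed.

Lemma clamp01_contract (x y : R) : Rabs (clamp01 x - clamp01 y) <= Rabs (x - y).
Proof.
  unfold clamp01, Rmax, Rmin, Rabs.
  destruct (Rle_dec 1 x); destruct (Rle_dec 1 y); repeat destruct (Rle_dec 0 _);
  repeat destruct (Rcase_abs _); lra.
Qed.

Lemma continuous_clamp01 (f : R -> R) (x : R) :
  continuous_on in_closed01 f -> continuous (fun y => f (clamp01 y)) x.
Proof.
  intros H. apply eps_continuous. intros e He.
  specialize (H (clamp01 x) (clamp01_in x)).
  destruct (proj1 (filterlim_locally f (f (clamp01 x))) H (mkposreal e He)) as [d Hd].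
  exists d. split; [apply cond_pos|]. intros y Hy.
  apply (Hd (clamp01 y)); [|apply clamp01_in].
  apply Rle_lt_trans with (2 := Hy). apply clamp01_contract.
Qed.

Lemma open_closed01 (x : R) : in_open01 x -> in_closed01 x.
Proof. unfold in_open01, in_closed01; lra. Qed.

Lemma is_derive_clamp01 (f : R -> R) (x l : R) :
  in_open01 x -> is_derive f x l -> is_derive (fun y => f (clamp01 y)) x l.
Proof.
  intros Hx. apply is_derive_ext_loc.
  generalize (in01_locally x Hx). apply filter_imp. intros y Hy.
  rewrite clamp01_id; [reflexivity | apply open_closed01, Hy].
Qed.

(** The working form of a solution: globally continuous first derivatives are carried along, so that
    boundary slopes are values of [u1] and [v1], and the second derivatives are given in [(0, 1)] by
    the equations. Their limits at the boundary are treated separately at the end. *)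
Record regular_solution (alpha beta p q sigma : R) (rho u u1 v v1 : R -> R) : Prop := {
  reg_cu : forall x, continuous u x;
  reg_cu1 : forall x, continuous u1 x;
  reg_cv : forall x, continuous v x;
  reg_cv1 : forall x, continuous v1 x;
  reg_du : forall x, in_open01 x -> is_derive u x (u1 x);
  reg_dv : forall x, in_open01 x -> is_derive v x (v1 x);
  reg_du1 : forall x, in_open01 x ->
    is_derive u1 x (alpha * u x - power_ratio p q (u x) (v x) - rho x);
  reg_dv1 : forall x, in_open01 x ->
    is_derive v1 x (beta * v x - power_ratio (p + sigma) (q + sigma) (u x) (v x));
  reg_pu : forall x, in_open01 x -> 0 < u x;
  reg_pv : forall x, in_open01 x -> 0 < v x;
  reg_u0 : u 0 = 0;
  reg_u1 : u 1 = 0;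
  reg_v0 : v 0 = 0;
  reg_v1 : v 1 = 0
}.

Lemma Derive_n_2_open01 (f f1 f2 : R -> R) (x : R) :
  (forall y, in_open01 y -> is_derive f y (f1 y)) ->
  (forall y, in_open01 y -> is_derive f1 y (f2 y)) ->
  in_open01 x -> Derive_n f 2 x = f2 x.
Proof.
  intros H1 H2 Hx. simpl. apply is_derive_unique.
  apply (is_derive_ext_loc f1); [|apply H2, Hx].
  generalize (in01_locally x Hx). apply filter_imp. intros y Hy.
  symmetry. apply is_derive_unique, H1, Hy.
Qed.

Lemma C2_positive_solution_regular (alpha beta p q sigma : R) (rho u v : R -> R) :
  C2_positive_solution alpha beta p q sigma rho u v ->
  exists u1 v1, regular_solution alpha beta p q sigma rho
    (fun x => u (clamp01 x)) u1 (fun x => v (clamp01 x)) v1.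
Proof.
  intros [[u1 [u2 [Du [Du1 [Cu [Cu1 _]]]]]] [[v1 [v2 [Dv [Dv1 [Cv [Cv1 _]]]]]]
    [Pos [Eu [Ev [[U0 U1] [V0 V1]]]]]]].
  assert (K0 : clamp01 0 = 0) by (apply clamp01_id; unfold in_closed01; lra).
  assert (K1 : clamp01 1 = 1) by (apply clamp01_id; unfold in_closed01; lra).
  exists (fun x => u1 (clamp01 x)), (fun x => v1 (clamp01 x)).
  constructor; try (rewrite ?K0, ?K1; assumption);
    try (intros x; apply continuous_clamp01; assumption);
    intros x Hx; rewrite ?(clamp01_id x) by (apply open_closed01, Hx);
    try (apply is_derive_clamp01; auto); try apply (Pos x Hx).
  - replace (alpha * u x - power_ratio p q (u x) (v x) - rho x) with (u2 x); auto.
    specialize (Eu x Hx). rewrite (Derive_n_2_open01 u u1 u2 x Du Du1 Hx) in Eu.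
    unfold power_ratio; lra.
  - replace (beta * v x - power_ratio (p + sigma) (q + sigma) (u x) (v x)) with (v2 x); auto.
    specialize (Ev x Hx). rewrite (Derive_n_2_open01 v v1 v2 x Dv Dv1 Hx) in Ev.
    unfold power_ratio; lra.
Qed.

(** After division by [u u'] this says that [u^(p - 1) / v^q] is nonincreasing in both variables. *)
Lemma power_ratio_sublinear (p q u u' v v' : R) :
  p <= 1 -> 0 <= q -> 0 < u' <= u -> 0 < v' <= v ->
  u' * power_ratio p q u v <= u * power_ratio p q u' v'.
Proof.
  intros Hp Hq Hu Hv. rewrite !power_ratio_exp.
  rewrite <- (exp_ln u') at 1 by lra. rewrite <- (exp_ln u) at 2 by lra.
  rewrite <- !exp_plus. apply exp_le.
  assert (ln u' <= ln u) by (apply ln_le_mono; lra).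
  assert (ln v' <= ln v) by (apply ln_le_mono; lra).
  assert (q * ln v' <= q * ln v) by (apply Rmult_le_compat_l; lra).
  assert ((1 - p) * ln u' <= (1 - p) * ln u) by (apply Rmult_le_compat_l; lra).
  lra.
Qed.

Lemma nonincreasing_of_derive (f f1 : R -> R) (a b : R) :
  (forall x, a <= x <= b -> continuous f x) ->
  (forall x, a < x < b -> is_derive f x (f1 x)) ->
  (forall x, a < x < b -> f1 x <= 0) ->
  forall x y, a <= x -> x <= y -> y <= b -> f y <= f x.
Proof.
  intros Hc Hd Hn x y Hx Hxy Hy. destruct Hxy as [Hl| ->]; [|lra].
  destruct (MVT_open f f1 x y Hl) as [c [Hc' E]].
  - intros t Ht; apply Hc; lra.
  - intros t Ht; apply Hd; lra.
  - specialize (Hn c ltac:(lra)). assert (0 <= - f1 c * (y - x)) by (apply Rmult_le_pos; lra).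
    lra.
Qed.

Lemma is_derive_locally_zero (f : R -> R) (x l : R) :
  locally x (fun y => f y = 0) -> is_derive f x l -> l = 0.
Proof.
  intros H D. rewrite <- (is_derive_unique f x l D).
  rewrite (Derive_ext_loc f (fun _ => 0) x H). apply Derive_const.
Qed.

Lemma locally_interval (x l r : R) : l < x < r -> locally x (fun y => l < y < r).
Proof.
  intros Hx. assert (Hp : 0 < Rmin (x - l) (r - x)) by (apply Rmin_pos; lra).
  exists (mkposreal _ Hp). intros y Hy.
  change (Rabs (y - x) < Rmin (x - l) (r - x)) in Hy.
  generalize (Rmin_l (x - l) (r - x)) (Rmin_r (x - l) (r - x)); intros.
  apply Rabs_def2 in Hy; lra.
Qed.

Lemma is_derive_mult_R (f g : R -> R) (x l m : R) :
  is_derive f x l -> is_derive g x m ->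
  is_derive (fun y => f y * g y) x (l * g x + f x * m).
Proof.
  intros Hf Hg. apply (is_derive_mult f g x l m Hf Hg). intros n k; apply Rmult_comm.
Qed.

Lemma continuous_mult_R (f g : R -> R) (x : R) :
  continuous f x -> continuous g x -> continuous (fun y => f y * g y) x.
Proof. intros Hf Hg; apply (continuous_mult (K := R_AbsRing)); assumption. Qed.

Lemma continuous_minus_R (f g : R -> R) (x : R) :
  continuous f x -> continuous g x -> continuous (fun y => f y - g y) x.
Proof. intros Hf Hg; apply (continuous_minus (V := R_NormedModule)); assumption. Qed.

(** The derivative of [u / w] is minus the Wronskian divided by [w^2], so [u / w] is constant. *)
Lemma wronskian_zero_proportional (u u1 w w1 : R -> R) (a b : R) :
  a < b -> (forall x, continuous u x) -> (forall x, continuous w x) ->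
  (forall x, a < x < b -> is_derive u x (u1 x)) ->
  (forall x, a < x < b -> is_derive w x (w1 x)) ->
  (forall x, a <= x <= b -> 0 < w x) ->
  (forall x, a < x < b -> u x * w1 x - u1 x * w x = 0) ->
  u b * w a = u a * w b.
Proof.
  intros Hab Cu Cw Du Dw Pw W.
  destruct (MVT_open (fun x => u x / w x)
     (fun x => (u1 x * w x - u x * w1 x) / (w x * w x)) a b) as [c [Hc E]]; auto.
  - intros x Hx. apply (continuous_mult_R u (fun y => / w y)); auto.
    apply continuous_Rinv_comp; auto. specialize (Pw x Hx). lra.
  - intros x Hx. specialize (Pw x ltac:(lra)).
    replace (w x * w x) with (w x ^ 2) by ring.
    apply is_derive_div; auto; lra.
  - assert (Ec := W c Hc). assert (Pa := Pw a ltac:(lra)). assert (Pb := Pw b ltac:(lra)).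
    replace (u1 c * w c - u c * w1 c) with 0 in E by lra.
    unfold Rdiv in E. rewrite !Rmult_0_l in E.
    apply Rminus_diag_uniq in E.
    replace (u b * w a) with (u b * / w b * (w a * w b)) by (field; lra).
    rewrite E. field; lra.
Qed.

Lemma derive_bound_parabola (F F1 : R -> R) :
  (forall x, continuous F x) -> (forall x, continuous F1 x) ->
  (forall x, in_open01 x -> is_derive F x (F1 x)) -> F 0 = 0 -> F 1 = 0 ->
  exists M, 0 < M /\ forall x, in_open01 x -> F x <= M * (x * (1 - x)).
Proof.
  intros C C1 D F0 F1'.
  destruct (continuous_max_ab (fun x => Rabs (F1 x)) 0 1 ltac:(lra)) as [m [Hm Hmax]].
  { intros x _. apply continuous_comp; [apply C1 | apply continuous_Rabs]. }
  set (A := Rabs (F1 m) + 1). assert (HA : 0 < A) by (unfold A; generalize (Rabs_pos (F1 m)); lra).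
  exists (2 * A). split; [lra|]. intros x [Hx0 Hx1].
  assert (B : forall c, 0 <= c <= 1 -> - A <= F1 c <= A).
  { intros c Hc. specialize (Hmax c Hc). simpl in Hmax.
    apply Rabs_le_between. unfold A; lra. }
  destruct (MVT_open F F1 0 x Hx0) as [c [Hc E]]; auto.
  { intros t Ht; apply D; split; lra. }
  destruct (MVT_open F F1 x 1 Hx1) as [c' [Hc' E']]; auto.
  { intros t Ht; apply D; split; lra. }
  assert (B1 := B c ltac:(lra)). assert (B2 := B c' ltac:(lra)).
  rewrite F0 in E. rewrite F1' in E'.
  assert (E1 : F x <= A * x) by nra.
  assert (E2 : F x <= A * (1 - x)) by nra.
  destruct (Rle_lt_dec x (1/2)).
  - assert (0 <= A * x * (1 - 2 * x)) by (apply Rmult_le_pos; [apply Rmult_le_pos|]; lra).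
    lra.
  - assert (0 <= A * (1 - x) * (2 * x - 1)) by (apply Rmult_le_pos; [apply Rmult_le_pos|]; lra).
    lra.
Qed.

Section Uniqueness.
Variables (alpha beta p q sigma : R) (rho : R -> R).
Hypothesis (halpha : 0 < alpha) (hbeta : 0 < beta).
Hypothesis (hrho_nonneg : forall x : R, in_open01 x -> 0 <= rho x).
Hypothesis (hrho_nonzero : exists x : R, in_open01 x /\ rho x <> 0).
Hypothesis (hq : 0 < q) (hqp : q <= p) (hp : p <= 1) (hsigma : 0 <= sigma).

(* On a component where [u > u'] and [v' <= v] the Wronskian of [u] and [u'] is
   nonincreasing, with boundary values of the wrong signs; so it vanishes. *)
Lemma difference_detects_u (u u1 v v1 u' u1' v' v1' : R -> R) :
  regular_solution alpha beta p q sigma rho u u1 v v1 ->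
  regular_solution alpha beta p q sigma rho u' u1' v' v1' ->
  detects (fun x => u x - u' x) (fun x => v x - v' x).
Proof.
  intros S S'. apply detects_intro.
  - intros x. apply continuous_minus_R; [apply S | apply S'].
  - rewrite (reg_u0 _ _ _ _ _ _ _ _ _ _ S), (reg_u0 _ _ _ _ _ _ _ _ _ _ S'); ring.
  - rewrite (reg_u1 _ _ _ _ _ _ _ _ _ _ S), (reg_u1 _ _ _ _ _ _ _ _ _ _ S'); ring.
  - intros l r Hl Hlr Hr El Er PF PG.
    assert (I : forall x, l < x < r -> in_open01 x) by (intros; split; lra).
    set (W := fun x => u x * u1' x - u1 x * u' x).
    set (W1 := fun x => (u' x * power_ratio p q (u x) (v x)
        - u x * power_ratio p q (u' x) (v' x)) + rho x * (u' x - u x)).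
    assert (CW : forall x, continuous W x).
    { intros x. apply continuous_minus_R; apply continuous_mult_R; first [apply S | apply S']. }
    assert (DW : forall x, l < x < r -> is_derive W x (W1 x)).
    { intros x Hx. specialize (I x Hx).
      replace (W1 x) with ((u1 x * u1' x
           + u x * (alpha * u' x - power_ratio p q (u' x) (v' x) - rho x))
         - ((alpha * u x - power_ratio p q (u x) (v x) - rho x) * u' x + u1 x * u1' x))
        by (unfold W1; ring).
      apply is_derive_minus_R; apply is_derive_mult_R; first [apply S | apply S']; exact I. }
    assert (T1 : forall x, l < x < r -> u' x * power_ratio p q (u x) (v x)
        - u x * power_ratio p q (u' x) (v' x) <= 0).
    { intros x Hx. specialize (PF x Hx). specialize (PG x Hx). specialize (I x Hx).
      assert (A1 := reg_pu _ _ _ _ _ _ _ _ _ _ S' x I).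
      assert (A2 := reg_pv _ _ _ _ _ _ _ _ _ _ S' x I).
      assert (A3 := power_ratio_sublinear p q (u x) (u' x) (v x) (v' x)). lra. }
    assert (T2 : forall x, l < x < r -> rho x * (u' x - u x) <= 0).
    { intros x Hx. specialize (PF x Hx). specialize (hrho_nonneg x (I x Hx)). nra. }
    assert (Mono := nonincreasing_of_derive W W1 l r (fun x _ => CW x) DW).
    assert (NW : forall x, l < x < r -> W1 x <= 0).
    { intros x Hx. specialize (T1 x Hx). specialize (T2 x Hx). unfold W1; lra. }
    specialize (Mono NW).
    assert (DU : forall x, l < x < r -> is_derive (fun t => u t - u' t) x (u1 x - u1' x)).
    { intros x Hx. apply is_derive_minus_R; first [apply S | apply S']; apply I, Hx. }
    assert (Pos : forall x, 0 <= x <= 1 -> 0 <= u x).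
    { intros x Hx. destruct (Req_dec x 0) as [->|N0]; [rewrite (reg_u0 _ _ _ _ _ _ _ _ _ _ S); lra|].
      destruct (Req_dec x 1) as [->|N1]; [rewrite (reg_u1 _ _ _ _ _ _ _ _ _ _ S); lra|].
      left; apply S; split; lra. }
    (* At [l] the two functions agree, so [W l = u l * (u1' l - u1 l)], and [u - u'] has nonnegative
       slope there. The other end is treated by reflection. *)
    assert (Wl : W l <= 0).
    { assert (0 <= u1 l - u1' l).
      { apply (derive_nonneg_left_min (fun t => u t - u' t) (fun t => u1 t - u1' t) l r Hlr); auto.
        - intros x _. apply continuous_minus_R; first [apply S | apply S'].
        - apply continuous_minus_R; first [apply S | apply S'].
        - intros x Hx. specialize (PF x Hx). lra. }
      specialize (Pos l ltac:(lra)). unfold W. replace (u' l) with (u l) by lra. nra. }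
    assert (Wr : 0 <= W r).
    { assert (0 <= - (u1 (1 - (1 - r)) - u1' (1 - (1 - r)))).
      { apply (derive_nonneg_left_min (fun t => u (1 - t) - u' (1 - t))
           (fun t => - (u1 (1 - t) - u1' (1 - t))) (1 - r) (1 - l)); try lra.
        - intros x _. apply (continuous_reflect (fun t => u t - u' t)).
          apply continuous_minus_R; first [apply S | apply S'].
        - intros x Hx. apply (is_derive_reflect (fun t => u t - u' t)), DU; lra.
        - apply continuous_opp_R, (continuous_reflect (fun t => u1 t - u1' t)).
          apply continuous_minus_R; first [apply S | apply S'].
        - intros x Hx. specialize (PF (1 - x) ltac:(lra)).
          replace (1 - (1 - r)) with r by ring. lra. }
      replace (1 - (1 - r)) with r in H by ring.
      specialize (Pos r ltac:(lra)). unfold W. replace (u' r) with (u r) by lra. nra. }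
    assert (W0 : forall x, l <= x <= r -> W x = 0).
    { intros x Hx. assert (W x <= W l) by (apply Mono; lra).
      assert (W r <= W x) by (apply Mono; lra). lra. }
    assert (W10 : forall x, l < x < r -> W1 x = 0).
    { intros x Hx. apply (is_derive_locally_zero W x); [|apply DW, Hx].
      generalize (locally_interval x l r Hx). apply filter_imp.
      intros y Hy. apply W0; lra. }
    set (m := (l + r) / 2).
    assert (Hm : l < m < r) by (unfold m; lra).
    assert (Pm := PF m Hm).
    assert (D1 : forall x, l < x < r -> is_derive u x (u1 x)) by (intros; apply S; auto).
    assert (D2 : forall x, l < x < r -> is_derive u' x (u1' x)) by (intros; apply S'; auto).
    assert (Pu' : forall x, 0 < x < 1 -> 0 < u' x) by (intros; apply S'; auto).
    assert (cU : forall x, continuous u x) by apply S.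
    assert (cU' : forall x, continuous u' x) by apply S'.
    (* At an end of the component inside [(0, 1)] the two functions have a common positive value, so
       the constant ratio [u / u'] is [1], against [u m > u' m]. *)
    destruct (Rlt_le_dec 0 l) as [Hl0|Hl0].
    { assert (E : u m * u' l = u l * u' m).
      { apply (wronskian_zero_proportional u u1 u' u1' l m); auto; try lra.
        - intros; apply D1; lra.
        - intros; apply D2; lra.
        - intros; apply Pu'; lra.
        - intros x Hx; apply W0; lra. }
      assert (0 < u' l) by (apply Pu'; lra).
      replace (u l) with (u' l) in E by lra. nra. }
    destruct (Rlt_le_dec r 1) as [Hr1|Hr1].
    { assert (E : u r * u' m = u m * u' r).
      { apply (wronskian_zero_proportional u u1 u' u1' m r); auto; try lra.
        - intros; apply D1; lra.
        - intros; apply D2; lra.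
        - intros; apply Pu'; lra.
        - intros x Hx; apply W0; lra. }
      assert (0 < u' r) by (apply Pu'; lra).
      replace (u r) with (u' r) in E by lra. nra. }
    (* Now the component is all of [(0, 1)]. Both nonpositive terms of [W1] vanish, and
       [rho (u' - u) = 0] with [u > u'] forces [rho = 0]. *)
    destruct hrho_nonzero as [x [Hx Nx]]. apply Nx.
    assert (Hx' : l < x < r) by (unfold in_open01 in Hx; lra).
    specialize (W10 x Hx'). specialize (T1 x Hx'). specialize (T2 x Hx').
    specialize (PF x Hx'). unfold W1 in W10.
    assert (Z : rho x * (u' x - u x) = 0) by lra.
    apply Rmult_integral in Z. destruct Z as [Z|Z]; [exact Z | lra].
Qed.

(** On a component where [v' > v] and [u >= u'], the quotient of the first solution has the larger
    numerator and the smaller denominator. Hence [(v - v')'' <= 0] there, and the minimum principle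
    gives [v >= v'], a contradiction. *)
Lemma difference_detects_v (u u1 v v1 u' u1' v' v1' : R -> R) :
  regular_solution alpha beta p q sigma rho u u1 v v1 ->
  regular_solution alpha beta p q sigma rho u' u1' v' v1' ->
  detects (fun x => v' x - v x) (fun x => u x - u' x).
Proof.
  intros S S'. apply detects_intro.
  - intros x. apply continuous_minus_R; [apply S' | apply S].
  - rewrite (reg_v0 _ _ _ _ _ _ _ _ _ _ S), (reg_v0 _ _ _ _ _ _ _ _ _ _ S'); ring.
  - rewrite (reg_v1 _ _ _ _ _ _ _ _ _ _ S), (reg_v1 _ _ _ _ _ _ _ _ _ _ S'); ring.
  - intros l r Hl Hlr Hr El Er PF PG.
    assert (I : forall x, l < x < r -> in_open01 x) by (intros; split; lra).
    assert (H : 0 <= v ((l + r) / 2) - v' ((l + r) / 2)).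
    { apply (min_principle (fun x => v x - v' x) (fun x => v1 x - v1' x)
        (fun x => (beta * v x - power_ratio (p + sigma) (q + sigma) (u x) (v x))
          - (beta * v' x - power_ratio (p + sigma) (q + sigma) (u' x) (v' x))) l r); try lra.
      - intros x _. apply continuous_minus_R; first [apply S | apply S'].
      - intros x Hx. apply is_derive_minus_R; first [apply S | apply S']; auto.
      - intros x Hx. apply is_derive_minus_R; first [apply S | apply S']; auto.
      - intros x Hx Hn. specialize (PG x Hx). specialize (I x Hx).
        assert (A1 := reg_pu _ _ _ _ _ _ _ _ _ _ S' x I).
        assert (A2 := reg_pv _ _ _ _ _ _ _ _ _ _ S x I).
        assert (A3 := power_ratio_le (p + sigma) (q + sigma) (u' x) (u x) (v' x) (v x)).
        nra. }
    specialize (PF ((l + r) / 2)). lra.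
Qed.

Lemma regular_solution_lower (u u1 v v1 : R -> R) :
  regular_solution alpha beta p q sigma rho u u1 v v1 ->
  exists k c, 0 < k /\ 0 < c /\ forall x, in_open01 x ->
    k * (x * (1 - x)) <= u x /\ c * (x * (1 - x)) <= v x.
Proof.
  intros S.
  destruct (hopf_bound alpha u u1 (fun x => alpha * u x - power_ratio p q (u x) (v x) - rho x) (1/2))
    as [k [Hk Bk]]; auto; try lra; try apply S.
  { intros x Hx. specialize (hrho_nonneg x Hx).
    generalize (power_ratio_pos p q (u x) (v x)); lra. }
  { right; symmetry; apply S. } { right; symmetry; apply S. } { split; lra. }
  destruct (hopf_bound beta v v1 (fun x => beta * v x - power_ratio (p + sigma) (q + sigma) (u x) (v x)) (1/2))
    as [c [Hc Bc]]; auto; try lra; try apply S.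
  { intros x Hx. generalize (power_ratio_pos (p + sigma) (q + sigma) (u x) (v x)); lra. }
  { right; symmetry; apply S. } { right; symmetry; apply S. } { split; lra. }
  exists k, c. repeat split; auto; [apply Bk | apply Bc]; unfold in_open01 in *; lra.
Qed.

Lemma regular_solution_unique (u u1 v v1 u' u1' v' v1' : R -> R) :
  regular_solution alpha beta p q sigma rho u u1 v v1 ->
  regular_solution alpha beta p q sigma rho u' u1' v' v1' ->
  forall x, in_open01 x -> u' x = u x /\ v' x = v x.
Proof.
  intros S S'.
  destruct (regular_solution_lower u u1 v v1 S) as [k [c [Hk [Hc B]]]].
  destruct (regular_solution_lower u' u1' v' v1' S') as [k' [c' [Hk' [Hc' B']]]].
  destruct (derive_bound_parabola u u1) as [M [HM BM]]; try apply S.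
  destruct (derive_bound_parabola u' u1') as [M' [HM' BM']]; try apply S'.
  set (k0 := Rmin k k'). set (c0 := Rmin c c'). set (M0 := Rmax M M').
  assert (Hk0 : 0 < k0) by (apply Rmin_pos; auto).
  assert (Hc0 : 0 < c0) by (apply Rmin_pos; auto).
  assert (LM : M <= M0) by apply Rmax_l. assert (LM' : M' <= M0) by apply Rmax_r.
  assert (Lk : k0 <= k) by apply Rmin_l. assert (Lk' : k0 <= k') by apply Rmin_r.
  assert (Lc : c0 <= c) by apply Rmin_l. assert (Lc' : c0 <= c') by apply Rmin_r.
  destruct (power_ratio_lipschitz p q k0 M0 c0) as [K1 [HK1 L1]]; try lra.
  destruct (power_ratio_lipschitz (p + sigma) (q + sigma) k0 M0 c0) as [K2 [HK2 L2]]; try lra.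
  assert (Hd : forall x, in_open01 x -> 0 < x * (1 - x) <= 1).
  { intros x [H1 H2]; split; [apply Rmult_lt_0_compat; lra | nra]. }
  assert (Bd : forall x, in_open01 x ->
    k0 * (x * (1 - x)) <= u x <= M0 * (x * (1 - x)) /\
    k0 * (x * (1 - x)) <= u' x <= M0 * (x * (1 - x)) /\
    c0 * (x * (1 - x)) <= v x /\ c0 * (x * (1 - x)) <= v' x).
  { intros x Hx. specialize (Hd x Hx). specialize (B x Hx). specialize (B' x Hx).
    specialize (BM x Hx). specialize (BM' x Hx). nra. }
  (* The linear term is absorbed into the singular bound because [1 <= 1 / d]. *)
  assert (Sc : forall a K g X Y d : R, 0 < a -> 0 < d <= 1 ->
     Rabs g <= K * (Rabs X + Rabs Y) / d ->
     forall Z, (Z = X \/ Z = Y) -> Rabs (a * Z - g) <= (a + K) * (Rabs X + Rabs Y) / d).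
  { intros a K g X Y d Ha Hd' Hg Z HZ.
    apply Rle_trans with (1 := Rabs_triang _ _). rewrite Rabs_Ropp, Rabs_mult, (Rabs_pos_eq a) by lra.
    replace ((a + K) * (Rabs X + Rabs Y) / d) with
      (a * (Rabs X + Rabs Y) / d + K * (Rabs X + Rabs Y) / d) by (field; lra).
    apply Rplus_le_compat; [|exact Hg].
    assert (0 <= Rabs X) by apply Rabs_pos. assert (0 <= Rabs Y) by apply Rabs_pos.
    apply Rle_trans with (a * (Rabs X + Rabs Y)).
    - apply Rmult_le_compat_l; [lra|]. destruct HZ; subst; lra.
    - rewrite <- (Rdiv_1_r (a * (Rabs X + Rabs Y))) at 1.
      apply Rmult_le_compat_l; [apply Rmult_le_pos; lra|]. apply Rinv_le_contravar; lra. }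
  assert (HV : forall x, in_open01 x -> (fun x => u x - u' x) x = 0 /\ (fun x => v x - v' x) x = 0).
  { apply (detects_vanish _ (fun x => u1 x - u1' x)
      (fun x => (alpha * u x - power_ratio p q (u x) (v x) - rho x)
         - (alpha * u' x - power_ratio p q (u' x) (v' x) - rho x))
      _ (fun x => v1 x - v1' x)
      (fun x => (beta * v x - power_ratio (p + sigma) (q + sigma) (u x) (v x))
          - (beta * v' x - power_ratio (p + sigma) (q + sigma) (u' x) (v' x)))
      (alpha + beta + K1 + K2));
     try (intros x; apply continuous_minus_R; first [apply S | apply S']);
     try (intros x Hx; apply is_derive_minus_R; first [apply S | apply S']; exact Hx).
    - lra.
    - intros x Hx. specialize (Hd x Hx). specialize (Bd x Hx).
      replace (alpha * u x - power_ratio p q (u x) (v x) - rho x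
         - (alpha * u' x - power_ratio p q (u' x) (v' x) - rho x))
        with (alpha * (u x - u' x) - (power_ratio p q (u x) (v x) - power_ratio p q (u' x) (v' x))) by ring.
      apply Rle_trans with ((alpha + K1) * (Rabs (u x - u' x) + Rabs (v x - v' x)) / (x * (1 - x))).
      + apply Sc; auto. apply L1; tauto.
      + apply Rmult_le_compat_r; [left; apply Rinv_0_lt_compat; lra|].
        apply Rmult_le_compat_r; [|lra]. apply Rplus_le_le_0_compat; apply Rabs_pos.
    - intros x Hx. specialize (Hd x Hx). specialize (Bd x Hx).
      replace (beta * v x - power_ratio (p + sigma) (q + sigma) (u x) (v x)
         - (beta * v' x - power_ratio (p + sigma) (q + sigma) (u' x) (v' x)))
        with (beta * (v x - v' x) - (power_ratio (p + sigma) (q + sigma) (u x) (v x)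
           - power_ratio (p + sigma) (q + sigma) (u' x) (v' x))) by ring.
      apply Rle_trans with ((beta + K2) * (Rabs (u x - u' x) + Rabs (v x - v' x)) / (x * (1 - x))).
      + apply Sc; auto. apply L2; tauto.
      + apply Rmult_le_compat_r; [left; apply Rinv_0_lt_compat; lra|].
        apply Rmult_le_compat_r; [|lra]. apply Rplus_le_le_0_compat; apply Rabs_pos.
    (* The third and fourth detections are the first two with the solutions exchanged. *)
    - split; [|split; [|split]].
      + apply (difference_detects_u u u1 v v1 u' u1' v' v1' S S').
      + apply (detects_ext (fun x => v' x - v x) _ (fun x => u x - u' x) _); auto.
        * intros; ring.
        * apply (difference_detects_v u u1 v v1 u' u1' v' v1' S S').
      + apply (detects_ext (fun x => u' x - u x) _ (fun x => v' x - v x) _); try (intros; ring).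
        apply (difference_detects_u u' u1' v' v1' u u1 v v1 S' S).
      + apply (detects_ext (fun x => v x - v' x) _ (fun x => u' x - u x) _); try (intros; ring).
        apply (difference_detects_v u' u1' v' v1' u u1 v v1 S' S). }
  intros x Hx. specialize (HV x Hx). simpl in HV. lra.
Qed.
End Uniqueness.

(** * The planar Poincare-Miranda theorem *)

(* The pairs [(a, b)] encode three labels: 1 if [a], 2 if [~ a /\ b], 0 otherwise. *)
Definition edge01 (a b a' b' : bool) : bool :=
  (a && negb a' && negb b') || (a' && negb a && negb b).

Fixpoint row_parity (a b : nat -> bool) (n : nat) : bool :=
  match n with
  | O => false
  | S m => xorb (row_parity a b m) (edge01 (a m) (b m) (a (S m)) (b (S m)))
  end.

(** Parity of the number of edges of a grid square with labels 0 and 1. Sperner's argument is run on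
    squares instead of triangles: around a square with labels 0 and 1 only, changes occur an even
    number of times, so an odd parity forces all three labels. *)
Definition cell_parity (a b : nat -> nat -> bool) (i j : nat) : bool :=
  xorb (xorb (edge01 (a i j) (b i j) (a (S i) j) (b (S i) j))
             (edge01 (a i (S j)) (b i (S j)) (a (S i) (S j)) (b (S i) (S j))))
       (xorb (edge01 (a i j) (b i j) (a i (S j)) (b i (S j)))
             (edge01 (a (S i) j) (b (S i) j) (a (S i) (S j)) (b (S i) (S j)))).

(** When the cell parities of a strip are added, each interior vertical edge occurs twice and
    cancels. *)
Lemma strip_parity (a b : nat -> nat -> bool) (j n : nat) :
  (forall i, (i < n)%nat -> cell_parity a b i j = false) ->
  xorb (row_parity (fun i => a i j) (fun i => b i j) n)
       (row_parity (fun i => a i (S j)) (fun i => b i (S j)) n)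
  = xorb (edge01 (a O j) (b O j) (a O (S j)) (b O (S j)))
         (edge01 (a n j) (b n j) (a n (S j)) (b n (S j))).
Proof.
  induction n as [|n IH]; intros H.
  - simpl. rewrite Bool.xorb_nilpotent. reflexivity.
  - assert (Hn := H n ltac:(lia)). unfold cell_parity in Hn.
    specialize (IH (fun i Hi => H i ltac:(lia))). simpl.
    revert IH Hn.
    generalize (row_parity (fun i => a i j) (fun i => b i j) n)
      (row_parity (fun i => a i (S j)) (fun i => b i (S j)) n)
      (edge01 (a O j) (b O j) (a O (S j)) (b O (S j)))
      (edge01 (a n j) (b n j) (a (S n) j) (b (S n) j))
      (edge01 (a n (S j)) (b n (S j)) (a (S n) (S j)) (b (S n) (S j)))
      (edge01 (a n j) (b n j) (a n (S j)) (b n (S j)))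
      (edge01 (a (S n) j) (b (S n) j) (a (S n) (S j)) (b (S n) (S j))).
    intros [] [] [] [] [] [] []; simpl; congruence.
Qed.

Lemma row_parity_no_zero (a b : nat -> bool) (n : nat) :
  (forall i, b i = true) -> row_parity a b n = false.
Proof.
  intros H. induction n as [|n IH]; [reflexivity|]. simpl. rewrite IH. unfold edge01.
  rewrite !H. destruct (a n), (a (S n)); reflexivity.
Qed.

Lemma row_parity_no_two (a b : nat -> bool) (n : nat) :
  (forall i, b i = false) -> row_parity a b n = xorb (a O) (a n).
Proof.
  intros H. induction n as [|n IH]; simpl; [symmetry; apply Bool.xorb_nilpotent|].
  rewrite IH. unfold edge01. rewrite !H.
  destruct (a O), (a n), (a (S n)); reflexivity.
Qed.

Definition cell_corner (i j i' j' : nat) : Prop :=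
  (i' = i \/ i' = S i) /\ (j' = j \/ j' = S j).

Lemma cell_parity_trichromatic (a b : nat -> nat -> bool) (i j : nat) :
  cell_parity a b i j = true ->
  exists i1 j1 i2 j2 i0 j0,
    cell_corner i j i1 j1 /\ cell_corner i j i2 j2 /\ cell_corner i j i0 j0 /\
    a i1 j1 = true /\ (a i2 j2 = false /\ b i2 j2 = true) /\
    (a i0 j0 = false /\ b i0 j0 = false).
Proof.
  intros H.
  assert (C : forall P : nat -> nat -> bool,
    P i j || P (S i) j || P i (S j) || P (S i) (S j) = true ->
    exists i' j', cell_corner i j i' j' /\ P i' j' = true).
  { intros P HP. unfold cell_corner.
    destruct (P i j) eqn:E1; [exists i, j; auto|].
    destruct (P (S i) j) eqn:E2; [exists (S i), j; auto|].
    destruct (P i (S j)) eqn:E3; [exists i, (S j); auto|].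
    destruct (P (S i) (S j)) eqn:E4; [exists (S i), (S j); auto|discriminate]. }
  destruct (C a) as [i1 [j1 [C1 E1]]].
  { revert H; unfold cell_parity, edge01.
    destruct (a i j), (a (S i) j), (a i (S j)), (a (S i) (S j)); simpl; congruence. }
  destruct (C (fun i j => negb (a i j) && b i j)%bool) as [i2 [j2 [C2 E2]]].
  { revert H; unfold cell_parity, edge01.
    destruct (a i j), (a (S i) j), (a i (S j)), (a (S i) (S j)),
      (b i j), (b (S i) j), (b i (S j)), (b (S i) (S j)); simpl; congruence. }
  destruct (C (fun i j => negb (a i j) && negb (b i j))%bool) as [i0 [j0 [C0 E0]]].
  { revert H; unfold cell_parity, edge01.
    destruct (a i j), (a (S i) j), (a i (S j)), (a (S i) (S j)),
      (b i j), (b (S i) j), (b i (S j)), (b (S i) (S j)); simpl; congruence. }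
  exists i1, j1, i2, j2, i0, j0.
  apply andb_prop in E2, E0. destruct E2 as [E2 E2'], E0 as [E0 E0'].
  apply Bool.negb_true_iff in E2, E0, E0'. repeat split; auto; try apply C1; try apply C2; apply C0.
Qed.

(** The bottom row has labels 0 and 1 only and passes from 0 to 1, so its parity is odd. The left
    side has no label 1 and the right side has only label 1, so neither contributes an edge, and
    even cells would carry the odd parity up to the top row, which has no label 0. *)
Lemma sperner_grid (a b : nat -> nat -> bool) (N : nat) :
  (forall j, a O j = false) -> (forall j, a N j = true) ->
  (forall i, b i O = false) -> (forall i, b i N = true) ->
  exists i j, (i < N)%nat /\ (j < N)%nat /\ cell_parity a b i j = true.
Proof.
  intros HL HR HB HT.
  destruct (Classical_Prop.classic
    (exists i j, (i < N)%nat /\ (j < N)%nat /\ cell_parity a b i j = true)) as [C|C];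
    [exact C | exfalso].
  assert (Even : forall i j, (i < N)%nat -> (j < N)%nat -> cell_parity a b i j = false).
  { intros i j Hi Hj. destruct (cell_parity a b i j) eqn:E; [|reflexivity].
    exfalso; apply C; exists i, j; auto. }
  assert (Row : forall j, (j <= N)%nat ->
    row_parity (fun i => a i j) (fun i => b i j) N = true).
  { induction j as [|j IH]; intros Hj.
    - rewrite row_parity_no_two by auto. rewrite HL, HR. reflexivity.
    - specialize (IH ltac:(lia)).
      assert (Sp := strip_parity a b j N (fun i Hi => Even i j Hi ltac:(lia))).
      rewrite IH in Sp. unfold edge01 in Sp. rewrite !HL, !HR in Sp. simpl in Sp.
      destruct (row_parity (fun i => a i (S j)) (fun i => b i (S j)) N); [reflexivity|discriminate]. }
  specialize (Row N (Nat.le_refl N)). rewrite row_parity_no_zero in Row by auto. discriminate.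
Qed.

Definition lipschitz2 (L : R) (F : R -> R -> R) : Prop :=
  forall a b a' b', Rabs (F a b - F a' b') <= L * (Rabs (a - a') + Rabs (b - b')).

Definition is_pos (x : R) : bool := if Rlt_dec 0 x then true else false.

Lemma is_pos_true (x : R) : is_pos x = true -> 0 < x.
Proof. unfold is_pos; destruct (Rlt_dec 0 x); [auto | discriminate]. Qed.

Lemma is_pos_false (x : R) : is_pos x = false -> x <= 0.
Proof. unfold is_pos; destruct (Rlt_dec 0 x); [discriminate | lra]. Qed.

(** Label a grid point 1 if [F > 0], 2 if [F <= 0 < G], and 0 if both are nonpositive. In a cell of
    side [h] with all three labels, the Lipschitz bound keeps both functions at the corner labelled
    0 between [- 2 L h] and [0]. *)
Lemma poincare_miranda_approx (F G : R -> R -> R) (A L e : R) :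
  0 < A -> 0 < L -> 0 < e -> lipschitz2 L F -> lipschitz2 L G ->
  (forall b, F (- A) b <= 0) -> (forall b, 0 < F A b) ->
  (forall a, G a (- A) <= 0) -> (forall a, 0 < G a A) ->
  exists a b, - A <= a <= A /\ - A <= b <= A /\ Rabs (F a b) + Rabs (G a b) <= e.
Proof.
  intros HA HL He LF LG F0 F1 G0 G1.
  (* With [h = 2 A / N] the two errors [2 L h] add up to [8 L A / N], which has to be at most
     [e]. *)
  destruct (nfloor_ex (8 * L * A / e)) as [n [_ Hn]].
  { apply Rdiv_le_0_compat; [|lra]. apply Rmult_le_pos; lra. }
  set (N := S n). assert (HN : 8 * L * A / e < INR N) by (unfold N; rewrite S_INR; lra).
  assert (HN0 : 0 < INR N) by (apply lt_0_INR; unfold N; lia).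
  set (t := fun i : nat => - A + 2 * A * (INR i / INR N)).
  assert (t0 : t O = - A) by (unfold t; simpl; unfold Rdiv; ring).
  assert (tN : t N = A) by (unfold t; field; lra).
  assert (tS : forall i, t (S i) - t i = 2 * A / INR N).
  { intros i; unfold t; rewrite S_INR; field; lra. }
  set (h := 2 * A / INR N). assert (Hh : 0 < h) by (apply Rdiv_lt_0_compat; lra).
  assert (tb : forall i, (i <= N)%nat -> - A <= t i <= A).
  { intros i Hi. unfold t. assert (0 <= INR i) by apply pos_INR.
    assert (INR i <= INR N) by (apply le_INR, Hi).
    assert (0 <= INR i / INR N) by (apply Rdiv_le_0_compat; lra).
    assert (INR i / INR N <= 1).
    { apply Rmult_le_reg_r with (INR N); [lra|].
      replace (INR i / INR N * INR N) with (INR i) by (field; lra). lra. }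
    nra. }
  destruct (sperner_grid (fun i j => is_pos (F (t i) (t j))) (fun i j => is_pos (G (t i) (t j))) N)
    as [i [j [Hi [Hj Hc]]]].
  - intros j; simpl. rewrite t0. unfold is_pos. destruct (Rlt_dec _ _); [|reflexivity].
    specialize (F0 (t j)); lra.
  - intros j; rewrite tN. unfold is_pos. destruct (Rlt_dec _ _); [reflexivity|].
    specialize (F1 (t j)); lra.
  - intros j; rewrite t0. unfold is_pos. destruct (Rlt_dec _ _); [|reflexivity].
    specialize (G0 (t j)); lra.
  - intros j; rewrite tN. unfold is_pos. destruct (Rlt_dec _ _); [reflexivity|].
    specialize (G1 (t j)); lra.
  - destruct (cell_parity_trichromatic _ _ i j Hc)
      as [i1 [j1 [i2 [j2 [i0 [j0 [C1 [C2 [C0 [E1 [[_ E2] [E3 E4]]]]]]]]]]]].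
    apply is_pos_true in E1, E2. apply is_pos_false in E3, E4.
    assert (W : forall i i' i'', (i' = i \/ i' = S i) -> (i'' = i \/ i'' = S i) ->
      Rabs (t i' - t i'') <= h).
    { intros k k' k'' [->| ->] [->| ->];
        rewrite ?(Rminus_diag_eq _ _ eq_refl), ?Rabs_R0; try lra.
      - rewrite Rabs_minus_sym, tS, Rabs_pos_eq; fold h; lra.
      - rewrite tS, Rabs_pos_eq; fold h; lra. }
    assert (D : forall H i' j' i'' j'', lipschitz2 L H -> cell_corner i j i' j' ->
      cell_corner i j i'' j'' ->
      Rabs (H (t i') (t j') - H (t i'') (t j'')) <= L * (2 * h)).
    { intros H i' j' i'' j'' LH [A1 A2] [A3 A4].
      apply Rle_trans with (1 := LH _ _ _ _). apply Rmult_le_compat_l; [lra|].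
      assert (B1 := W _ _ _ A1 A3). assert (B2 := W _ _ _ A2 A4). lra. }
    exists (t i0), (t j0).
    destruct C0 as [K1 K2].
    split; [apply tb; lia|]. split; [apply tb; lia|].
    assert (D1 := D F _ _ _ _ LF C1 (conj K1 K2)). assert (D2 := D G _ _ _ _ LG C2 (conj K1 K2)).
    apply Rabs_le_between in D1, D2.
    rewrite !Rabs_left1 by lra.
    assert (4 * (L * h) <= e); [|lra].
    unfold h. replace (4 * (L * (2 * A / INR N))) with (8 * L * A / INR N) by (field; lra).
    apply Rmult_le_reg_r with (INR N); [lra|].
    replace (8 * L * A / INR N * INR N) with (8 * L * A) by (field; lra).
    apply Rmult_lt_compat_r with (r := e) in HN; [|lra].
    replace (8 * L * A / e * e) with (8 * L * A) in HN by (field; lra). lra.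
Qed.

Lemma lipschitz_continuous (f : R -> R) (L : R) :
  (forall x y, Rabs (f x - f y) <= L * Rabs (x - y)) -> forall x, continuous f x.
Proof.
  intros H x. apply eps_continuous. intros e He.
  assert (HL : 0 < Rabs L + 1) by (generalize (Rabs_pos L); lra).
  exists (e / (Rabs L + 1)). split; [apply Rdiv_lt_0_compat; lra|].
  intros y Hy. apply Rle_lt_trans with (1 := H y x).
  apply Rle_lt_trans with ((Rabs L + 1) * Rabs (y - x)).
  - apply Rmult_le_compat_r; [apply Rabs_pos | generalize (Rle_abs L); lra].
  - apply Rmult_lt_compat_l with (r := Rabs L + 1) in Hy; [|lra].
    replace ((Rabs L + 1) * (e / (Rabs L + 1))) with e in Hy by (field; lra). exact Hy.
Qed.

(** Minimising in [b] first reduces this to one variable twice: the partial minimum is again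
    Lipschitz in [a] with the constant [L]. *)
Lemma lipschitz2_min (H : R -> R -> R) (A L : R) :
  0 < A -> lipschitz2 L H ->
  exists a b, - A <= a <= A /\ - A <= b <= A /\
    forall a' b', - A <= a' <= A -> - A <= b' <= A -> H a b <= H a' b'.
Proof.
  intros HA LH.
  assert (M : forall a, exists b, - A <= b <= A /\ forall b', - A <= b' <= A -> H a b <= H a b').
  { intros a. apply continuous_min_ab; [lra|]. intros x _.
    apply (lipschitz_continuous (H a) L). intros y z.
    replace (L * Rabs (y - z)) with (L * (Rabs (a - a) + Rabs (y - z))); [apply LH|].
    rewrite (Rminus_diag_eq a a eq_refl), Rabs_R0. ring. }
  destruct (functional_choice _ M) as [m Hm].
  destruct (continuous_min_ab (fun a => H a (m a)) (- A) A) as [a [Ha Hmin]]; [lra| |].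
  { intros x _. apply (lipschitz_continuous _ L).
    assert (W : forall x y, H x (m x) - H y (m y) <= L * Rabs (x - y)).
    { intros y z. destruct (Hm y) as [_ My]. destruct (Hm z) as [Bz _].
      specialize (My (m z) Bz). assert (B := LH y (m z) z (m z)).
      rewrite (Rminus_diag_eq (m z) (m z) eq_refl), Rabs_R0, Rplus_0_r in B.
      apply Rabs_le_between in B. lra. }
    intros y z. apply Rabs_le. assert (W1 := W y z). assert (W2 := W z y).
    rewrite (Rabs_minus_sym z y) in W2. lra. }
  exists a, (m a). split; [exact Ha|]. split; [apply Hm|].
  intros a' b' Ha' Hb'. apply Rle_trans with (1 := Hmin a' Ha'). apply Hm, Hb'.
Qed.

Lemma poincare_miranda (F G : R -> R -> R) (A L : R) :
  0 < A -> 0 < L -> lipschitz2 L F -> lipschitz2 L G ->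
  (forall b, F (- A) b <= 0) -> (forall b, 0 < F A b) ->
  (forall a, G a (- A) <= 0) -> (forall a, 0 < G a A) ->
  exists a b, F a b = 0 /\ G a b = 0.
Proof.
  intros HA HL LF LG F0 F1 G0 G1.
  destruct (lipschitz2_min (fun a b => Rabs (F a b) + Rabs (G a b)) A (2 * L) HA)
    as [a [b [Ha [Hb Hmin]]]].
  { intros a b a' b'.
    replace (Rabs (F a b) + Rabs (G a b) - (Rabs (F a' b') + Rabs (G a' b')))
      with ((Rabs (F a b) - Rabs (F a' b')) + (Rabs (G a b) - Rabs (G a' b'))) by ring.
    apply Rle_trans with (1 := Rabs_triang _ _).
    assert (B1 := LF a b a' b'). assert (B2 := LG a b a' b').
    assert (T1 := Rabs_triang_inv2 (F a b) (F a' b')).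
    assert (T2 := Rabs_triang_inv2 (G a b) (G a' b')). lra. }
  exists a, b.
  (* An approximate zero with half of the minimal value as its error would lie below the minimum. *)
  assert (S0 : Rabs (F a b) + Rabs (G a b) <= 0).
  { apply Rnot_lt_le; intro C.
    destruct (poincare_miranda_approx F G A L ((Rabs (F a b) + Rabs (G a b)) / 2))
      as [a' [b' [Ha' [Hb' B]]]]; auto; [lra|].
    specialize (Hmin a' b' Ha' Hb'). simpl in Hmin. lra. }
  generalize (Rabs_pos (F a b)) (Rabs_pos (G a b)); intros.
  split; apply Rabs_eq_0; lra.
Qed.

(** * The Cauchy problem with bounded right-hand side *)

(** McShane's extension: the upper envelope of the cones [f y - L |x - y|] with apex over
    [(0, 1)]. *)
Lemma lipschitz_extension (f : R -> R) (L : R) :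
  (forall x y, in_open01 x -> in_open01 y -> Rabs (f x - f y) <= L * Rabs (x - y)) ->
  exists g, (forall x y, Rabs (g x - g y) <= L * Rabs (x - y)) /\
    forall x, in_open01 x -> g x = f x.
Proof.
  intros HL.
  assert (I2 : in_open01 (1/2)) by (split; lra).
  assert (L0 : 0 <= L).
  { assert (H := HL (1/2) (1/4) I2 ltac:(split; lra)).
    generalize (Rabs_pos (f (1/2) - f (1/4))); intros. rewrite (Rabs_pos_eq (1/2 - 1/4)) in H by lra.
    lra. }
  assert (M : forall x, exists l, is_lub (fun r => exists y, in_open01 y /\ r = f y - L * Rabs (x - y)) l).
  { intros x. destruct (completeness (fun r => exists y, in_open01 y /\ r = f y - L * Rabs (x - y)))
      as [l Hl]; [| |exists l; exact Hl].
    - exists (f (1/2) + L * 1). intros r [y [Hy ->]].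
      assert (H := HL y (1/2) Hy I2). apply Rabs_le_between in H.
      assert (Rabs (y - 1/2) <= 1) by (unfold in_open01 in Hy; apply Rabs_le; lra).
      assert (0 <= L * Rabs (x - y)) by (apply Rmult_le_pos; [lra | apply Rabs_pos]).
      assert (L * Rabs (y - 1/2) <= L * 1) by (apply Rmult_le_compat_l; lra). lra.
    - exists (f (1/2) - L * Rabs (x - 1/2)), (1/2). auto. }
  destruct (functional_choice _ M) as [g Hg]. exists g.
  assert (W : forall x y, g x - g y <= L * Rabs (x - y)).
  { intros x y. assert (g x <= g y + L * Rabs (x - y)); [|lra].
    apply (Hg x). intros r [t [Ht ->]].
    assert (f t - L * Rabs (y - t) <= g y) by (apply (Hg y); exists t; auto).
    assert (T := Rabs_triang (y - x) (x - t)). replace (y - x + (x - t)) with (y - t) in T by ring.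
    rewrite (Rabs_minus_sym y x) in T.
    assert (L * Rabs (y - t) <= L * (Rabs (x - y) + Rabs (x - t))) by (apply Rmult_le_compat_l; lra).
    lra. }
  split.
  - intros x y. apply Rabs_le. assert (W1 := W x y). assert (W2 := W y x).
    rewrite (Rabs_minus_sym y x) in W2. lra.
  - intros x Hx. apply Rle_antisym.
    + apply (Hg x). intros r [t [Ht ->]]. assert (H := HL t x Ht Hx).
      rewrite (Rabs_minus_sym t x) in H. apply Rabs_le_between in H. lra.
    + apply (Hg x). exists x. split; [exact Hx|].
      rewrite (Rminus_diag_eq x x eq_refl), Rabs_R0. ring.
Qed.

Lemma derive_bound_lipschitz (f f1 : R -> R) (L a b : R) :
  (forall x, a <= x <= b -> continuous f x) ->
  (forall x, a < x < b -> is_derive f x (f1 x)) ->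
  (forall x, a < x < b -> Rabs (f1 x) <= L) ->
  forall x y, a <= x <= b -> a <= y <= b -> Rabs (f x - f y) <= L * Rabs (x - y).
Proof.
  intros Hc Hd Hb.
  assert (W : forall x y, a <= x -> y <= b -> x < y -> Rabs (f x - f y) <= L * Rabs (x - y)).
  { intros x y Hx Hy Hl. destruct (MVT_open f f1 x y Hl) as [c [Hc' E]].
    - intros t Ht; apply Hc; lra.
    - intros t Ht; apply Hd; lra.
    - rewrite Rabs_minus_sym, E, Rabs_mult, (Rabs_minus_sym x y).
      apply Rmult_le_compat_r; [apply Rabs_pos | apply Hb; lra]. }
  intros x y Hx Hy. destruct (Rtotal_order x y) as [H|[->|H]].
  - apply W; lra.
  - rewrite !(Rminus_diag_eq _ _ eq_refl), Rabs_R0. lra.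
  - rewrite Rabs_minus_sym, (Rabs_minus_sym x y). apply W; lra.
Qed.

(** [h] may have no limit at [0] and [1]. The integral is therefore based at [1/2]; being Lipschitz
    with constant [B], it extends to the closed interval and is then normalised at [0]. *)
Lemma bounded_primitive (h : R -> R) (B : R) :
  (forall x, in_open01 x -> continuous h x) -> (forall x, in_open01 x -> Rabs (h x) <= B) ->
  exists J, (forall x, continuous J x) /\ J 0 = 0 /\
    forall x, in_open01 x -> is_derive J x (h x).
Proof.
  intros Hc Hb.
  set (H := fun x => RInt h (1/2) x).
  assert (DH : forall x, in_open01 x -> is_derive H x (h x)).
  { intros x Hx. apply (is_derive_RInt h H (1/2)); [|apply Hc, Hx].
    generalize (in01_locally x Hx). apply filter_imp. intros y Hy.
    apply (RInt_correct (V := R_CompleteNormedModule)), (ex_RInt_continuous (V := R_CompleteNormedModule)).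
    intros z Hz. apply Hc. unfold in_open01 in *. unfold Rmin, Rmax in Hz.
    destruct (Rle_dec (1/2) y); lra. }
  destruct (lipschitz_extension H B) as [g [Lg Eg]].
  { intros x y [Hx0 Hx1] [Hy0 Hy1].
    apply (derive_bound_lipschitz H h B (Rmin x y) (Rmax x y));
      try (split; [apply Rmin_l || apply Rmin_r | apply Rmax_l || apply Rmax_r]).
    all: assert (I : forall t, Rmin x y <= t <= Rmax x y -> in_open01 t)
      by (intros t; unfold Rmin, Rmax, in_open01; destruct (Rle_dec x y); lra).
    - intros t Ht. apply (ex_derive_continuous H). exists (h t). auto.
    - intros t Ht. apply DH, I; lra.
    - intros t Ht. apply Hb, I; lra. }
  exists (fun x => g x - g 0). split; [|split; [apply Rminus_diag_eq; reflexivity|]].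
  - intros x. apply continuous_minus_R; [apply (lipschitz_continuous g B Lg) | apply continuous_const].
  - intros x Hx. rewrite <- (Rminus_0_r (h x)). apply is_derive_minus_R.
    + apply (is_derive_ext_loc H); [|apply DH, Hx].
      generalize (in01_locally x Hx). apply filter_imp. intros y Hy. symmetry; auto.
    + apply (is_derive_const (V := R_NormedModule)).
Qed.

Record cauchy_solution (h : R -> R) (a : R) (w w1 : R -> R) : Prop := {
  cs_c : forall x, continuous w x;
  cs_c1 : forall x, continuous w1 x;
  cs_d : forall x, in_open01 x -> is_derive w x (w1 x);
  cs_d1 : forall x, in_open01 x -> is_derive w1 x (h x);
  cs_0 : w 0 = 0;
  cs_a : w1 0 = a
}.

Lemma cauchy_solution_exists (h : R -> R) (B a : R) :
  (forall x, in_open01 x -> continuous h x) -> (forall x, in_open01 x -> Rabs (h x) <= B) ->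
  exists w w1, cauchy_solution h a w w1.
Proof.
  intros Hc Hb. destruct (bounded_primitive h B Hc Hb) as [J [CJ [J0 DJ]]].
  set (w1 := fun x => J x - (- a)).
  assert (C1 : forall x, continuous w1 x).
  { intros x. apply continuous_minus_R; [apply CJ | apply continuous_const]. }
  assert (DW : forall x, is_derive (fun y => RInt w1 0 y) x (w1 x)).
  { intros x. apply (is_derive_RInt w1 _ 0); [|apply C1].
    exists (mkposreal 1 Rlt_0_1). intros y _.
    apply (RInt_correct (V := R_CompleteNormedModule)), (ex_RInt_continuous (V := R_CompleteNormedModule)).
    intros z _. apply C1. }
  exists (fun x => RInt w1 0 x), w1. constructor; auto.
  - intros x. apply (ex_derive_continuous (fun y => RInt w1 0 y)). exists (w1 x); auto.
  - intros x Hx. rewrite <- (Rminus_0_r (h x)). apply is_derive_minus_R; [apply DJ, Hx|].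
    apply (is_derive_const (V := R_NormedModule)).
  - apply (RInt_point (V := R_CompleteNormedModule)).
  - unfold w1. lra.
Qed.

Lemma cauchy_solution_minus (h h' : R -> R) (a a' : R) (w w1 w' w1' : R -> R) :
  cauchy_solution h a w w1 -> cauchy_solution h' a' w' w1' ->
  cauchy_solution (fun x => h x - h' x) (a - a') (fun x => w x - w' x) (fun x => w1 x - w1' x).
Proof.
  intros S S'. constructor;
    try (intros x; apply continuous_minus_R; first [apply S | apply S']);
    try (intros x Hx; apply is_derive_minus_R; first [apply S | apply S']; exact Hx).
  - rewrite (cs_0 _ _ _ _ S), (cs_0 _ _ _ _ S'); ring.
  - rewrite (cs_a _ _ _ _ S), (cs_a _ _ _ _ S'); ring.
Qed.

Lemma cauchy_solution_linear (a : R) : cauchy_solution (fun _ => 0) a (fun x => a * x) (fun _ => a).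
Proof.
  constructor; try (simpl; ring).
  - intros x. apply (ex_derive_continuous (fun x => a * x)). auto_derive; auto.
  - intros x. apply continuous_const.
  - intros x _. auto_derive; [auto | ring].
  - intros x _. apply (is_derive_const (V := R_NormedModule)).
Qed.

(* [(x - t) w'(t) + w(t)] has derivative [(x - t) h(t)], and [(x - t) / (1 - t) <= x]. *)
Lemma cauchy_solution_bound (h : R -> R) (a : R) (w w1 : R -> R) (C l : R) :
  0 <= C -> 0 < l -> cauchy_solution h a w w1 ->
  (forall t, in_open01 t -> Rabs (h t) <= C * exp (l * t) / (1 - t)) ->
  forall x, 0 <= x <= 1 -> Rabs (w x) <= Rabs a * x + C / l * (x * exp (l * x)).
Proof.
  intros HC Hl S Hh.
  assert (W : forall a w w1 h, cauchy_solution h a w w1 ->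
    (forall t, in_open01 t -> h t <= C * exp (l * t) / (1 - t)) ->
    forall x, 0 <= x <= 1 -> w x <= a * x + C / l * (x * exp (l * x))).
  { clear a w w1 h S Hh. intros a w w1 h S Hh x Hx.
    assert (Mono := nonincreasing_of_derive
      (fun t => ((x - t) * w1 t + w t) - C / l * (x * exp (l * t)))
      (fun t => (x - t) * h t - C * (x * exp (l * t))) 0 x).
    assert (M : (x - x) * w1 x + w x - C / l * (x * exp (l * x))
        <= (x - 0) * w1 0 + w 0 - C / l * (x * exp (l * 0))).
    { apply (Mono); try lra.
      - intros t _. apply continuous_minus_R.
        + apply (continuous_plus (V := R_NormedModule)); [|apply S].
          apply continuous_mult_R; [|apply S].
          apply continuous_minus_R; [apply continuous_const | apply continuous_id].
        + apply (ex_derive_continuous (fun t => C / l * (x * exp (l * t)))). auto_derive; auto.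
      - intros t Ht. assert (I : in_open01 t) by (split; lra).
        apply is_derive_minus_R.
        + replace ((x - t) * h t) with ((-1 * w1 t + (x - t) * h t) + w1 t) by ring.
          apply (is_derive_plus (V := R_NormedModule)); [|apply S, I].
          apply (is_derive_mult_R (fun t => x - t) w1); [|apply S, I].
          auto_derive; auto; ring.
        + auto_derive; auto. field; lra.
      - intros t Ht. assert (I : in_open01 t) by (split; lra). specialize (Hh t I).
        assert (He := exp_pos (l * t)).
        apply Rle_minus.
        apply Rle_trans with ((x - t) * (C * exp (l * t) / (1 - t))).
        + apply Rmult_le_compat_l; lra.
        + apply Rmult_le_reg_r with (1 - t); [lra|].
          replace ((x - t) * (C * exp (l * t) / (1 - t)) * (1 - t)) with ((C * exp (l * t)) * (x - t))
            by (field; lra).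
          replace (C * (x * exp (l * t)) * (1 - t)) with ((C * exp (l * t)) * (x * (1 - t))) by ring.
          apply Rmult_le_compat_l; [apply Rmult_le_pos; lra | nra]. }
    rewrite (cs_0 _ _ _ _ S), (cs_a _ _ _ _ S), Rmult_0_r, exp_0 in M.
    assert (0 <= C / l * (x * 1)).
    { apply Rmult_le_pos; [apply Rdiv_le_0_compat; lra | lra]. }
    lra. }
  intros x Hx. apply Rabs_le. split.
  - assert (H := W (- a) (fun x => - w x) (fun x => - w1 x) (fun x => - h x)).
    assert (- w x <= - a * x + C / l * (x * exp (l * x))).
    { apply H; auto.
      - constructor; try (intros t; apply continuous_opp_R, S);
          try (intros t Ht; apply is_derive_opp_R, S, Ht).
        + rewrite (cs_0 _ _ _ _ S); ring.
        + rewrite (cs_a _ _ _ _ S); ring.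
      - intros t Ht. specialize (Hh t Ht). apply Rabs_le_between in Hh. lra. }
    assert (- a * x <= Rabs a * x).
    { apply Rmult_le_compat_r; [lra|]. rewrite <- Rabs_Ropp. apply Rle_abs. }
    lra.
  - assert (w x <= a * x + C / l * (x * exp (l * x))).
    { apply (W a w w1 h); auto. intros t Ht. apply Rle_trans with (2 := Hh t Ht). apply Rle_abs. }
    assert (a * x <= Rabs a * x) by (apply Rmult_le_compat_r; [lra | apply Rle_abs]).
    lra.
Qed.

Lemma geometric_limit (s : nat -> R) (M : R) :
  (forall n, Rabs (s (S n) - s n) <= M * (/ 2) ^ n) ->
  exists l, forall n, Rabs (l - s n) <= 2 * M * (/ 2) ^ n.
Proof.
  intros H.
  assert (Hp : forall n, 0 < (/ 2) ^ n) by (intros; apply pow_lt; lra).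
  assert (HM : 0 <= M).
  { specialize (H O). simpl in H. generalize (Rabs_pos (s 1%nat - s O)). lra. }
  assert (K : forall n k, Rabs (s (n + k)%nat - s n) <= 2 * M * (/ 2) ^ n * (1 - (/ 2) ^ k)).
  { intros n k. induction k as [|k IH].
    - rewrite Nat.add_0_r, (Rminus_diag_eq _ _ eq_refl), Rabs_R0. simpl; lra.
    - rewrite Nat.add_succ_r. specialize (H (n + k)%nat).
      replace (s (S (n + k)) - s n) with ((s (S (n + k)) - s (n + k)%nat) + (s (n + k)%nat - s n)) by ring.
      apply Rle_trans with (1 := Rabs_triang _ _). rewrite pow_add in H. simpl pow. lra. }
  assert (K' : forall n m, (n <= m)%nat -> Rabs (s m - s n) <= 2 * M * (/ 2) ^ n).
  { intros n m Hnm. replace m with (n + (m - n))%nat by lia. apply Rle_trans with (1 := K n (m - n)%nat).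
    rewrite <- (Rmult_1_r (2 * M * (/ 2) ^ n)) at 2. apply Rmult_le_compat_l.
    - apply Rmult_le_pos; [lra | left; apply Hp].
    - specialize (Hp (m - n)%nat). lra. }
  assert (CC : Cauchy_crit s).
  { intros e He.
    destruct (pow_lt_1_zero (/ 2) ltac:(rewrite Rabs_pos_eq; lra) (e / (4 * M + 1))) as [N HN].
    { apply Rdiv_lt_0_compat; lra. }
    exists N. intros n m Hn Hm. unfold Rdist.
    specialize (HN N (Nat.le_refl N)). rewrite Rabs_pos_eq in HN by (left; apply Hp).
    replace (s n - s m) with ((s n - s N) - (s m - s N)) by ring.
    apply Rle_lt_trans with (1 := Rabs_triang _ _). rewrite Rabs_Ropp.
    assert (B1 := K' N n Hn). assert (B2 := K' N m Hm).
    apply Rmult_lt_compat_l with (r := 4 * M + 1) in HN; [|lra].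
    replace ((4 * M + 1) * (e / (4 * M + 1))) with e in HN by (field; lra).
    specialize (Hp N). lra. }
  destruct (Rcomplete.R_complete s CC) as [l Hl]. exists l. intros n.
  apply Rnot_lt_le; intro C.
  destruct (Hl (Rabs (l - s n) - 2 * M * (/ 2) ^ n) ltac:(lra)) as [N HN].
  specialize (HN (n + N)%nat ltac:(lia)). unfold Rdist in HN.
  assert (B := K' n (n + N)%nat ltac:(lia)).
  assert (T := Rabs_triang (l - s (n + N)%nat) (s (n + N)%nat - s n)).
  replace (l - s (n + N)%nat + (s (n + N)%nat - s n)) with (l - s n) in T by ring.
  rewrite (Rabs_minus_sym l (s (n + N)%nat)) in T. lra.
Qed.

Lemma le_of_geometric (x y M : R) : (forall n : nat, x <= y + M * (/ 2) ^ n) -> x <= y.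
Proof.
  intros H. apply Rnot_lt_le; intro C.
  assert (HM : 0 < Rabs M + 1) by (generalize (Rabs_pos M); lra).
  destruct (pow_lt_1_zero (/ 2) ltac:(rewrite Rabs_pos_eq; lra) ((x - y) / (Rabs M + 1))) as [N HN].
  { apply Rdiv_lt_0_compat; lra. }
  specialize (HN N (Nat.le_refl N)). specialize (H N).
  assert (Hp : 0 < (/ 2) ^ N) by (apply pow_lt; lra).
  rewrite Rabs_pos_eq in HN by lra.
  apply Rmult_lt_compat_l with (r := Rabs M + 1) in HN; [|lra].
  replace ((Rabs M + 1) * ((x - y) / (Rabs M + 1))) with (x - y) in HN by (field; lra).
  assert (M * (/ 2) ^ N <= Rabs M * (/ 2) ^ N).
  { apply Rmult_le_compat_r; [lra | apply Rle_abs]. }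
  lra.
Qed.

(** * Shooting *)

(** Continuity is required along continuous curves [(u, v)], the form in which Picard iteration uses
    it. *)
Record admissible (B K : R) (H : R -> R -> R -> R) : Prop := {
  adm_c : forall u v : R -> R, (forall x, continuous u x) -> (forall x, continuous v x) ->
    forall x, in_open01 x -> continuous (fun t => H t (u t) (v t)) x;
  adm_b : forall x u v, in_open01 x -> Rabs (H x u v) <= B;
  adm_l : forall x u v u' v', in_open01 x ->
    Rabs (H x u v - H x u' v') <= K * (Rabs (u - u') + Rabs (v - v')) / (x * (1 - x))
}.

Lemma cauchy_solution_ext (h h' : R -> R) (a : R) (w w1 : R -> R) :
  (forall x, in_open01 x -> h x = h' x) ->
  cauchy_solution h a w w1 -> cauchy_solution h' a w w1.
Proof. intros E S. constructor; try apply S. intros x Hx. rewrite <- E by exact Hx. apply S, Hx. Qed.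

Lemma exp_ge_1 (x : R) : 0 <= x -> 1 <= exp x.
Proof. intros H. rewrite <- exp_0. apply exp_le, H. Qed.

Lemma cauchy_solution_difference_bound (h h' : R -> R) (a a' B l : R) (w w1 w' w1' : R -> R) :
  0 < l ->
  (forall t, in_open01 t -> Rabs (h t) <= B) -> (forall t, in_open01 t -> Rabs (h' t) <= B) ->
  cauchy_solution h a w w1 -> cauchy_solution h' a' w' w1' ->
  forall x, 0 <= x <= 1 ->
    Rabs (w x - w' x) <= Rabs (a - a') * x + 2 * B / l * (x * exp (l * x)).
Proof.
  intros Hl Hb Hb' S S'.
  assert (HB : 0 <= B).
  { assert (I : in_open01 (1/2)) by (split; lra). specialize (Hb _ I).
    generalize (Rabs_pos (h (1/2))); lra. }
  apply (cauchy_solution_bound (fun x => h x - h' x) (a - a')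
    (fun x => w x - w' x) (fun x => w1 x - w1' x)); auto; [lra| apply cauchy_solution_minus; auto |].
  intros t Ht. specialize (Hb t Ht). specialize (Hb' t Ht).
  apply Rle_trans with (2 * B).
  - apply Rle_trans with (1 := Rabs_triang _ _). rewrite Rabs_Ropp. lra.
  - destruct Ht as [Ht0 Ht1].
    assert (1 <= exp (l * t)) by (apply exp_ge_1, Rmult_le_pos; lra).
    apply Rmult_le_reg_r with (1 - t); [lra|].
    replace (2 * B * exp (l * t) / (1 - t) * (1 - t)) with (2 * B * exp (l * t)) by (field; lra).
    rewrite Rmult_assoc. rewrite Rmult_assoc. apply Rmult_le_compat_l; [lra|].
    apply Rmult_le_compat_l; lra.
Qed.

Lemma cauchy_solution_lipschitz (h : R -> R) (a B : R) (w w1 : R -> R) :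
  cauchy_solution h a w w1 -> (forall t, in_open01 t -> Rabs (h t) <= B) ->
  forall x y, 0 <= x <= 1 -> 0 <= y <= 1 -> Rabs (w x - w y) <= (Rabs a + B) * Rabs (x - y).
Proof.
  intros S Hb.
  assert (HB : 0 <= B).
  { assert (I : in_open01 (1/2)) by (split; lra). specialize (Hb _ I).
    generalize (Rabs_pos (h (1/2))); lra. }
  apply (derive_bound_lipschitz w w1).
  - intros x _; apply S.
  - intros x Hx; apply S; split; lra.
  - intros x Hx.
    assert (D := derive_bound_lipschitz w1 h B 0 1 (fun t _ => cs_c1 _ _ _ _ S t)
      (fun t Ht => cs_d1 _ _ _ _ S t Ht) (fun t Ht => Hb t Ht) x 0 ltac:(lra) ltac:(lra)).
    rewrite (cs_a _ _ _ _ S), Rminus_0_r, (Rabs_pos_eq x) in D by lra.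
    assert (T := Rabs_triang (w1 x - a) a). replace (w1 x - a + a) with (w1 x) in T by ring.
    assert (B * x <= B * 1) by (apply Rmult_le_compat_l; lra). lra.
Qed.

Section Shooting.
Variables (B K : R) (H1 H2 : R -> R -> R -> R).
Hypothesis (HK : 0 < K) (A1 : admissible B K H1) (A2 : admissible B K H2).

(** The factor [x] of the weight [E] cancels the [1 / x] in the Lipschitz constant, and the
    exponential rate makes the iteration a contraction: with [l = 4 K] each component gains a factor
    [1/4], so the sum of the two is halved. *)
Let l := 4 * K.
Let E (x : R) := x * exp (l * x).

Local Lemma weight_pos (x : R) : 0 <= x -> 0 <= E x.
Proof. intros Hx. unfold E. apply Rmult_le_pos; [lra | left; apply exp_pos]. Qed.

Local Lemma weight_le (x : R) : 0 <= x <= 1 -> E x <= exp l.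
Proof.
  intros Hx. unfold E. rewrite <- (Rmult_1_l (exp l)).
  apply Rmult_le_compat; try lra; [left; apply exp_pos|].
  apply exp_le. unfold l. nra.
Qed.

Local Lemma bound_nonneg : 0 <= B.
Proof.
  assert (I : in_open01 (1/2)) by (split; lra).
  generalize (adm_b _ _ _ A1 (1/2) 0 0 I) (Rabs_pos (H1 (1/2) 0 0)). lra.
Qed.

Local Lemma picard_contraction (H : R -> R -> R -> R) (u v u' v' : R -> R) (a a' C : R)
  (w w1 w' w1' : R -> R) :
  admissible B K H -> 0 <= C ->
  (forall x, in_open01 x -> Rabs (u x - u' x) + Rabs (v x - v' x) <= C * E x) ->
  cauchy_solution (fun t => H t (u t) (v t)) a w w1 ->
  cauchy_solution (fun t => H t (u' t) (v' t)) a' w' w1' ->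
  forall x, 0 <= x <= 1 -> Rabs (w x - w' x) <= Rabs (a - a') * x + C / 4 * E x.
Proof.
  intros A HC Hd S S' x Hx.
  replace (C / 4) with (K * C / l) by (unfold l; field; lra).
  apply (cauchy_solution_bound _ _ _ _ (K * C) l) with (1 := Rmult_le_pos _ _ (Rlt_le _ _ HK) HC)
    (3 := cauchy_solution_minus _ _ _ _ _ _ _ _ S S'); auto; [unfold l; lra|].
  intros t Ht. apply Rle_trans with (1 := adm_l _ _ _ A _ _ _ _ _ Ht).
  specialize (Hd t Ht). destruct Ht as [Ht0 Ht1].
  replace (K * C * exp (l * t) / (1 - t)) with (K * (C * E t) / (t * (1 - t)))
    by (unfold E; field; lra).
  apply Rmult_le_compat_r; [left; apply Rinv_0_lt_compat, Rmult_lt_0_compat; lra|].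
  apply Rmult_le_compat_l; lra.
Qed.

Lemma ivp_exists (a b : R) :
  exists u u1 v v1, cauchy_solution (fun t => H1 t (u t) (v t)) a u u1 /\
    cauchy_solution (fun t => H2 t (u t) (v t)) b v v1.
Proof.
  assert (HB := bound_nonneg).
  assert (Hl : 0 < l) by (unfold l; lra).
  (* One Picard step, stated for every pair so that choice yields an operator [T]. A discontinuous
     pair gets itself as default value, since the implication is then vacuous. *)
  assert (M : forall s : (R -> R) * (R -> R), exists s' : (R -> R) * (R -> R),
    (forall x, continuous (fst s) x) -> (forall x, continuous (snd s) x) ->
    exists w1 y1, cauchy_solution (fun t => H1 t (fst s t) (snd s t)) a (fst s') w1 /\
      cauchy_solution (fun t => H2 t (fst s t) (snd s t)) b (snd s') y1).
  { intros [u v]. simpl.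
    destruct (Classical_Prop.classic ((forall x, continuous u x) /\ (forall x, continuous v x)))
      as [[Cu Cv]|N].
    - destruct (cauchy_solution_exists (fun t => H1 t (u t) (v t)) B a) as [w [w1 S]].
      { apply (adm_c _ _ _ A1); auto. } { intros; apply (adm_b _ _ _ A1); auto. }
      destruct (cauchy_solution_exists (fun t => H2 t (u t) (v t)) B b) as [y [y1 S']].
      { apply (adm_c _ _ _ A2); auto. } { intros; apply (adm_b _ _ _ A2); auto. }
      exists (w, y). intros _ _. exists w1, y1. auto.
    - exists (u, v). intros C1 C2. exfalso; apply N; auto. }
  destruct (functional_choice _ M) as [T HT].
  set (s := fun n : nat => Nat.iter n T ((fun x => a * x), (fun x => b * x))).
  assert (Cont : forall n, (forall x, continuous (fst (s n)) x) /\ (forall x, continuous (snd (s n)) x)).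
  { induction n as [|n [C1 C2]].
    - split; simpl; apply (cs_c _ _ _ _ (cauchy_solution_linear _)).
    - destruct (HT (s n) C1 C2) as [w1 [y1 [S S']]]. split; [apply S | apply S']. }
  assert (Step : forall n, exists w1 y1,
     cauchy_solution (fun t => H1 t (fst (s n) t) (snd (s n) t)) a (fst (s (S n))) w1 /\
     cauchy_solution (fun t => H2 t (fst (s n) t) (snd (s n) t)) b (snd (s (S n))) y1).
  { intros n. destruct (Cont n) as [C1 C2]. apply (HT (s n) C1 C2). }
  set (Q := 4 * B / l). assert (HQ : 0 <= Q) by (apply Rdiv_le_0_compat; lra).
  assert (Hp : forall n, 0 < (/ 2) ^ n) by (intros; apply pow_lt; lra).
  assert (D : forall n x, 0 <= x <= 1 ->
    Rabs (fst (s (S n)) x - fst (s n) x) + Rabs (snd (s (S n)) x - snd (s n) x)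
      <= Q * (/ 2) ^ n * E x).
  { induction n as [|n IH]; intros x Hx.
    - destruct (Step O) as [w1 [y1 [S S']]].
      assert (B1 := cauchy_solution_difference_bound _ _ a a B l _ _ _ _ Hl
        (fun t Ht => adm_b _ _ _ A1 t _ _ Ht)
        (fun t Ht => eq_ind_r (fun z => z <= B) HB (Rabs_R0)) S (cauchy_solution_linear a) x Hx).
      assert (B2 := cauchy_solution_difference_bound _ _ b b B l _ _ _ _ Hl
        (fun t Ht => adm_b _ _ _ A2 t _ _ Ht)
        (fun t Ht => eq_ind_r (fun z => z <= B) HB (Rabs_R0)) S' (cauchy_solution_linear b) x Hx).
      rewrite (Rminus_diag_eq a a eq_refl), Rabs_R0 in B1. rewrite (Rminus_diag_eq b b eq_refl), Rabs_R0 in B2.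
      replace (Q * (/ 2) ^ 0 * E x) with
        (2 * B / l * (x * exp (l * x)) + 2 * B / l * (x * exp (l * x)))
        by (unfold Q, E; simpl; field; lra).
      change (fst (s 0%nat) x) with (a * x). change (snd (s 0%nat) x) with (b * x). lra.
    - destruct (Step n) as [w1 [y1 [S0 S0']]]. destruct (Step (S n)) as [w1' [y1' [S S']]].
      assert (HC : 0 <= Q * (/ 2) ^ n) by (apply Rmult_le_pos; [lra | left; apply Hp]).
      assert (Hd : forall t, in_open01 t ->
         Rabs (fst (s (Datatypes.S n)) t - fst (s n) t) + Rabs (snd (s (Datatypes.S n)) t - snd (s n) t)
         <= Q * (/ 2) ^ n * E t) by (intros t [Ht0 Ht1]; apply IH; lra).
      assert (B1 := picard_contraction H1 _ _ _ _ _ _ _ _ _ _ _ A1 HC Hd S S0 x Hx).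
      assert (B2 := picard_contraction H2 _ _ _ _ _ _ _ _ _ _ _ A2 HC Hd S' S0' x Hx).
      rewrite (Rminus_diag_eq a a eq_refl), Rabs_R0 in B1. rewrite (Rminus_diag_eq b b eq_refl), Rabs_R0 in B2. simpl pow. lra. }
  (* Limits are taken at [clamp01 x], where the estimate [D] applies, so that the limit functions
     are continuous on the whole line. *)
  assert (Lim : forall x, exists lim : R * R, forall n,
     Rabs (fst lim - fst (s n) (clamp01 x)) <= 2 * (Q * E (clamp01 x)) * (/ 2) ^ n /\
     Rabs (snd lim - snd (s n) (clamp01 x)) <= 2 * (Q * E (clamp01 x)) * (/ 2) ^ n).
  { intros x. assert (Hc := clamp01_in x).
    destruct (geometric_limit (fun n => fst (s n) (clamp01 x)) (Q * E (clamp01 x))) as [p Hp1].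
    { intros n. specialize (D n _ Hc). generalize (Rabs_pos (snd (s (S n)) (clamp01 x) - snd (s n) (clamp01 x))).
      lra. }
    destruct (geometric_limit (fun n => snd (s n) (clamp01 x)) (Q * E (clamp01 x))) as [q Hq1].
    { intros n. specialize (D n _ Hc). generalize (Rabs_pos (fst (s (S n)) (clamp01 x) - fst (s n) (clamp01 x))).
      lra. }
    exists (p, q). intros n. split; [apply Hp1 | apply Hq1]. }
  destruct (functional_choice _ Lim) as [lim Hlim].
  set (u := fun x => fst (lim x)). set (v := fun x => snd (lim x)).
  assert (EW : forall x, Q * E (clamp01 x) <= Q * exp l).
  { intros x. apply Rmult_le_compat_l; [exact HQ | apply weight_le, clamp01_in]. }
  (* The iterates have the common Lipschitz constant [|c| + B] on [[0, 1]], and the limit inherits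
     it. *)
  assert (LipLim : forall (f : R -> R) (g : nat -> R -> R) (c : R),
    (forall n x, Rabs (f x - g n (clamp01 x)) <= 2 * (Q * E (clamp01 x)) * (/ 2) ^ n) ->
    (forall n x y, 0 <= x <= 1 -> 0 <= y <= 1 ->
       Rabs (g (S n) x - g (S n) y) <= (Rabs c + B) * Rabs (x - y)) ->
    forall x, continuous f x).
  { intros f g c Hf Hg. apply (lipschitz_continuous f (Rabs c + B)). intros x y.
    apply le_of_geometric with (2 * (Q * exp l)). intros n.
    assert (F1 := Hf (S n) x). assert (F2 := Hf (S n) y).
    assert (G := Hg n (clamp01 x) (clamp01 y) (clamp01_in x) (clamp01_in y)).
    assert (W1 := EW x). assert (W2 := EW y). specialize (Hp n). simpl pow in F1, F2.
    apply Rmult_le_compat_r with (r := (/ 2) ^ n) in W1, W2; try lra.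
    assert (CC := clamp01_contract x y).
    apply Rmult_le_compat_l with (r := Rabs c + B) in CC; [|generalize (Rabs_pos c); lra].
    replace (f x - f y) with ((f x - g (S n) (clamp01 x)) + (g (S n) (clamp01 x) - g (S n) (clamp01 y))
       - (f y - g (S n) (clamp01 y))) by ring.
    apply Rle_trans with (1 := Rabs_triang _ _). rewrite Rabs_Ropp.
    assert (T1 := Rabs_triang (f x - g (S n) (clamp01 x)) (g (S n) (clamp01 x) - g (S n) (clamp01 y))).
    lra. }
  assert (Cu : forall x, continuous u x).
  { apply (LipLim u (fun n => fst (s n)) a).
    - intros n x. apply Hlim.
    - intros n. destruct (Step n) as [w1 [y1 [S _]]].
      apply (cauchy_solution_lipschitz _ _ _ _ _ S). intros t Ht. apply (adm_b _ _ _ A1 _ _ _ Ht). }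
  assert (Cv : forall x, continuous v x).
  { apply (LipLim v (fun n => snd (s n)) b).
    - intros n x. apply Hlim.
    - intros n. destruct (Step n) as [w1 [y1 [_ S]]].
      apply (cauchy_solution_lipschitz _ _ _ _ _ S). intros t Ht. apply (adm_b _ _ _ A2 _ _ _ Ht). }
  destruct (HT (u, v) Cu Cv) as [w1 [y1 [S S']]]. simpl fst in S; simpl snd in S'; simpl in S, S'.
  destruct (T (u, v)) as [w y]. simpl in S, S'.
  assert (Close : forall n x, 0 <= x <= 1 ->
     Rabs (u x - fst (s n) x) <= 2 * (Q * E x) * (/ 2) ^ n /\
     Rabs (v x - snd (s n) x) <= 2 * (Q * E x) * (/ 2) ^ n).
  { intros n x Hx. assert (R := Hlim x n). rewrite (clamp01_id x Hx) in R. exact R. }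
  (* [(w, y)] and iterate [n + 1] are the Picard images of [(u, v)] and iterate [n]. By contraction
     the iterates tend to [(w, y)] as well as to [(u, v)]. *)
  assert (Fix : forall x, in_open01 x -> u x = w x /\ v x = y x).
  { intros x Hx. assert (Hx' := open_closed01 x Hx). unfold in_closed01 in Hx'.
    assert (Both : forall n, Rabs (u x - w x) <= 0 + 2 * (Q * E x) * (/ 2) ^ n /\
                      Rabs (v x - y x) <= 0 + 2 * (Q * E x) * (/ 2) ^ n).
    { intros n. destruct (Step n) as [w1' [y1' [S0 S0']]].
      assert (HC : 0 <= 4 * (Q * (/ 2) ^ n)) by (specialize (Hp n); nra).
      assert (Hd : forall t, in_open01 t ->
         Rabs (u t - fst (s n) t) + Rabs (v t - snd (s n) t) <= 4 * (Q * (/ 2) ^ n) * E t).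
      { intros t [Ht0 Ht1]. destruct (Close n t ltac:(lra)). lra. }
      assert (B1 := picard_contraction H1 _ _ _ _ _ _ _ _ _ _ _ A1 HC Hd S S0 x Hx').
      assert (B2 := picard_contraction H2 _ _ _ _ _ _ _ _ _ _ _ A2 HC Hd S' S0' x Hx').
      rewrite (Rminus_diag_eq a a eq_refl), Rabs_R0 in B1. rewrite (Rminus_diag_eq b b eq_refl), Rabs_R0 in B2.
      destruct (Close (Datatypes.S n) x Hx') as [K1 K2]. simpl pow in K1, K2.
      assert (T1 := Rabs_triang (u x - fst (s (Datatypes.S n)) x) (- (w x - fst (s (Datatypes.S n)) x))).
      assert (T2 := Rabs_triang (v x - snd (s (Datatypes.S n)) x) (- (y x - snd (s (Datatypes.S n)) x))).
      rewrite Rabs_Ropp in T1, T2.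
      replace (u x - fst (s (Datatypes.S n)) x + - (w x - fst (s (Datatypes.S n)) x)) with (u x - w x) in T1 by ring.
      replace (v x - snd (s (Datatypes.S n)) x + - (y x - snd (s (Datatypes.S n)) x)) with (v x - y x) in T2 by ring.
      lra. }
    assert (Z1 := le_of_geometric _ _ _ (fun n => proj1 (Both n))).
    assert (Z2 := le_of_geometric _ _ _ (fun n => proj2 (Both n))).
    generalize (Rabs_pos (u x - w x)) (Rabs_pos (v x - y x)); intros P1 P2.
    split; apply Rminus_diag_uniq, Rabs_eq_0; lra. }
  (* The images [w] and [y] are returned because they come with their derivatives; on [(0, 1)] they
     may replace [u] and [v] inside the right-hand sides. *)
  exists w, w1, y, y1.
  split; [revert S | revert S']; apply cauchy_solution_ext; intros x Hx;
    destruct (Fix x Hx) as [-> ->]; reflexivity.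
Qed.

(** Boundedness of the right-hand sides gives a first estimate in the weight [E]. With
    [e = |a - a'| + |b - b'|], each use of [picard_contraction] replaces its constant [C] by
    [e + C / 2], and these constants tend to the fixed point [2 e]. *)
Lemma ivp_dependence (a b a' b' : R) (u u1 v v1 u' u1' v' v1' : R -> R) :
  cauchy_solution (fun t => H1 t (u t) (v t)) a u u1 ->
  cauchy_solution (fun t => H2 t (u t) (v t)) b v v1 ->
  cauchy_solution (fun t => H1 t (u' t) (v' t)) a' u' u1' ->
  cauchy_solution (fun t => H2 t (u' t) (v' t)) b' v' v1' ->
  forall x, 0 <= x <= 1 -> Rabs (u x - u' x) + Rabs (v x - v' x)
    <= 2 * (Rabs (a - a') + Rabs (b - b')) * E x.
Proof.
  intros Su Sv Su' Sv'.
  assert (HB := bound_nonneg).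
  assert (Hl : 0 < l) by (unfold l; lra).
  set (e := Rabs (a - a') + Rabs (b - b')).
  assert (He : 0 <= e) by (unfold e; generalize (Rabs_pos (a - a')) (Rabs_pos (b - b')); lra).
  set (Q := 4 * B / l). assert (HQ : 0 <= Q) by (apply Rdiv_le_0_compat; lra).
  assert (xE : forall x, 0 <= x -> x <= E x).
  { intros x Hx. unfold E. rewrite <- (Rmult_1_r x) at 1. apply Rmult_le_compat_l; [lra|].
    apply exp_ge_1, Rmult_le_pos; lra. }
  assert (It : forall n x, 0 <= x <= 1 -> Rabs (u x - u' x) + Rabs (v x - v' x)
    <= (2 * e + Q * (/ 2) ^ n) * E x).
  { induction n as [|n IH]; intros x Hx.
    - assert (B1 := cauchy_solution_difference_bound _ _ _ _ B l _ _ _ _ Hl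
        (fun t Ht => adm_b _ _ _ A1 t _ _ Ht) (fun t Ht => adm_b _ _ _ A1 t _ _ Ht) Su Su' x Hx).
      assert (B2 := cauchy_solution_difference_bound _ _ _ _ B l _ _ _ _ Hl
        (fun t Ht => adm_b _ _ _ A2 t _ _ Ht) (fun t Ht => adm_b _ _ _ A2 t _ _ Ht) Sv Sv' x Hx).
      replace ((2 * e + Q * (/ 2) ^ 0) * E x) with
        (2 * (e * E x) + (2 * B / l * (x * exp (l * x)) + 2 * B / l * (x * exp (l * x))))
        by (unfold Q, E; simpl; field; lra).
      assert (e * x <= e * E x) by (apply Rmult_le_compat_l; [lra | apply xE; lra]).
      assert (0 <= e * E x) by (apply Rmult_le_pos; [lra | apply weight_pos; lra]).
      unfold e in *. lra.
    - assert (HC : 0 <= 2 * e + Q * (/ 2) ^ n).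
      { assert (0 <= Q * (/ 2) ^ n) by (apply Rmult_le_pos; [lra | left; apply pow_lt; lra]). lra. }
      assert (Hd : forall t, in_open01 t -> Rabs (u t - u' t) + Rabs (v t - v' t)
        <= (2 * e + Q * (/ 2) ^ n) * E t) by (intros t [Ht0 Ht1]; apply IH; lra).
      assert (B1 := picard_contraction H1 _ _ _ _ _ _ _ _ _ _ _ A1 HC Hd Su Su' x Hx).
      assert (B2 := picard_contraction H2 _ _ _ _ _ _ _ _ _ _ _ A2 HC Hd Sv Sv' x Hx).
      assert (e * x <= e * E x) by (apply Rmult_le_compat_l; [lra | apply xE; lra]).
      unfold e in *. simpl pow. lra. }
  intros x Hx. apply le_of_geometric with (Q * E x). intros n.
  specialize (It n x Hx). fold e. lra.
Qed.

(** The end values at [1] are Lipschitz functions of the two slopes and differ from the slopes by at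
    most [Q], because the right-hand sides are bounded. On the square of half-side [Q + 1] they thus
    have the signs required by [poincare_miranda]. *)
Lemma bvp_exists :
  exists u u1 v v1 a b, cauchy_solution (fun t => H1 t (u t) (v t)) a u u1 /\
    cauchy_solution (fun t => H2 t (u t) (v t)) b v v1 /\ u 1 = 0 /\ v 1 = 0.
Proof.
  assert (HB := bound_nonneg).
  assert (Hl : 0 < l) by (unfold l; lra).
  assert (M : forall ab : R * R, exists s : (R -> R) * (R -> R), exists u1 v1,
    cauchy_solution (fun t => H1 t (fst s t) (snd s t)) (fst ab) (fst s) u1 /\
    cauchy_solution (fun t => H2 t (fst s t) (snd s t)) (snd ab) (snd s) v1).
  { intros [a b]. destruct (ivp_exists a b) as [u [u1 [v [v1 [S S']]]]].
    exists (u, v), u1, v1. auto. }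
  destruct (functional_choice _ M) as [s Hs].
  set (Q := 2 * B / l * exp l). assert (HQ : 0 <= Q).
  { apply Rmult_le_pos; [apply Rdiv_le_0_compat; lra | left; apply exp_pos]. }
  assert (Far : forall a b, Rabs (fst (s (a, b)) 1 - a) <= Q /\ Rabs (snd (s (a, b)) 1 - b) <= Q).
  { intros a b. destruct (Hs (a, b)) as [u1 [v1 [S S']]]. simpl in S, S'.
    assert (B1 := cauchy_solution_difference_bound _ _ a a B l _ _ _ _ Hl
        (fun t Ht => adm_b _ _ _ A1 t _ _ Ht)
        (fun t Ht => eq_ind_r (fun z => z <= B) HB (Rabs_R0)) S (cauchy_solution_linear a) 1 ltac:(lra)).
    assert (B2 := cauchy_solution_difference_bound _ _ b b B l _ _ _ _ Hl
        (fun t Ht => adm_b _ _ _ A2 t _ _ Ht)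
        (fun t Ht => eq_ind_r (fun z => z <= B) HB (Rabs_R0)) S' (cauchy_solution_linear b) 1 ltac:(lra)).
    rewrite (Rminus_diag_eq a a eq_refl), Rabs_R0, !Rmult_1_r in B1.
    rewrite (Rminus_diag_eq b b eq_refl), Rabs_R0, !Rmult_1_r in B2. unfold Q. lra. }
  destruct (poincare_miranda (fun a b => fst (s (a, b)) 1) (fun a b => snd (s (a, b)) 1)
    (Q + 1) (2 * exp l)) as [a [b [Z1 Z2]]]; try lra.
  - generalize (exp_pos l); lra.
  - intros a b a' b'.
    destruct (Hs (a, b)) as [u1 [v1 [S S']]]. destruct (Hs (a', b')) as [u1' [v1' [T T']]].
    simpl in *. assert (Dp := ivp_dependence _ _ _ _ _ _ _ _ _ _ _ _ S S' T T' 1 ltac:(lra)).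
    replace (E 1) with (exp l) in Dp by (unfold E; rewrite !Rmult_1_r; ring).
    generalize (Rabs_pos (snd (s (a, b)) 1 - snd (s (a', b')) 1)). lra.
  - intros a b a' b'.
    destruct (Hs (a, b)) as [u1 [v1 [S S']]]. destruct (Hs (a', b')) as [u1' [v1' [T T']]].
    simpl in *. assert (Dp := ivp_dependence _ _ _ _ _ _ _ _ _ _ _ _ S S' T T' 1 ltac:(lra)).
    replace (E 1) with (exp l) in Dp by (unfold E; rewrite !Rmult_1_r; ring).
    generalize (Rabs_pos (fst (s (a, b)) 1 - fst (s (a', b')) 1)). lra.
  - intros b. destruct (Far (- (Q + 1)) b) as [F _]. apply Rabs_le_between in F. lra.
  - intros b. destruct (Far (Q + 1) b) as [F _]. apply Rabs_le_between in F. lra.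
  - intros a. destruct (Far a (- (Q + 1))) as [_ F]. apply Rabs_le_between in F. lra.
  - intros a. destruct (Far a (Q + 1)) as [_ F]. apply Rabs_le_between in F. lra.
  - destruct (Hs (a, b)) as [u1 [v1 [S S']]]. simpl in *.
    exists (fst (s (a, b))), u1, (snd (s (a, b))), v1, a, b. auto.
Qed.
End Shooting.

(** * Barriers and truncation *)

Lemma continuous_plus_R (f g : R -> R) (x : R) :
  continuous f x -> continuous g x -> continuous (fun y => f y + g y) x.
Proof. intros Hf Hg; apply (continuous_plus (V := R_NormedModule)); assumption. Qed.

Lemma Rmax_contract (a b a' b' : R) :
  Rabs (Rmax a b - Rmax a' b') <= Rmax (Rabs (a - a')) (Rabs (b - b')).
Proof.
  unfold Rmax at 1 2. destruct (Rle_dec a b); destruct (Rle_dec a' b');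
  generalize (Rmax_l (Rabs (a - a')) (Rabs (b - b'))) (Rmax_r (Rabs (a - a')) (Rabs (b - b')));
  generalize (Rmax (Rabs (a - a')) (Rabs (b - b'))); intros z; unfold Rabs;
  repeat destruct (Rcase_abs _); lra.
Qed.

Lemma Rmin_contract (a b b' : R) : Rabs (Rmin a b - Rmin a b') <= Rabs (b - b').
Proof.
  unfold Rmin. destruct (Rle_dec a b); destruct (Rle_dec a b'); unfold Rabs;
  repeat destruct (Rcase_abs _); lra.
Qed.

Lemma continuous_Rmax (f g : R -> R) (x : R) :
  continuous f x -> continuous g x -> continuous (fun y => Rmax (f y) (g y)) x.
Proof.
  intros Hf Hg. apply (continuous_ext (fun y => (f y + g y + Rabs (f y - g y)) * / 2)).
  - intros y. unfold Rmax, Rabs. destruct (Rle_dec (f y) (g y)); destruct (Rcase_abs _); lra.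
  - apply continuous_mult_R; [|apply continuous_const].
    apply continuous_plus_R; [apply continuous_plus_R; assumption|].
    apply (continuous_comp (fun y => f y - g y) Rabs); [apply continuous_minus_R; assumption|].
    apply continuous_Rabs.
Qed.

Lemma continuous_Rmin (f g : R -> R) (x : R) :
  continuous f x -> continuous g x -> continuous (fun y => Rmin (f y) (g y)) x.
Proof.
  intros Hf Hg. apply (continuous_ext (fun y => - Rmax (- f y) (- g y))).
  - intros y. unfold Rmax, Rmin. destruct (Rle_dec (f y) (g y)); destruct (Rle_dec _ _); lra.
  - apply continuous_opp_R, continuous_Rmax; apply continuous_opp_R; assumption.
Qed.

Lemma continuous_ln_pos (x : R) : 0 < x -> continuous ln x.
Proof.
  intros Hx. apply (ex_derive_continuous ln). exists (/ x).
  apply is_derive_Reals, derivable_pt_lim_ln, Hx.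
Qed.

Lemma continuous_power_ratio (P Q : R) (f g : R -> R) (x : R) :
  0 < f x -> 0 < g x -> continuous f x -> continuous g x ->
  continuous (fun y => power_ratio P Q (f y) (g y)) x.
Proof.
  intros Hf Hg Cf Cg.
  apply (continuous_ext (fun y => exp (P * ln (f y) - Q * ln (g y)))).
  { intros y; symmetry; apply power_ratio_exp. }
  apply (continuous_comp (fun y => P * ln (f y) - Q * ln (g y)) exp).
  - apply continuous_minus_R; apply continuous_mult_R; try apply continuous_const.
    + apply (continuous_comp f ln); [exact Cf | apply continuous_ln_pos, Hf].
    + apply (continuous_comp g ln); [exact Cg | apply continuous_ln_pos, Hg].
  - apply (ex_derive_continuous exp). auto_derive; auto.
Qed.

Lemma div_parabola_ge (K X x : R) : in_open01 x -> 0 <= K * X -> K * X <= K * X / (x * (1 - x)).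
Proof.
  intros [H0 H1] H.
  assert (Hd : 0 < x * (1 - x)) by (apply Rmult_lt_0_compat; lra).
  assert (Hd1 : x * (1 - x) <= 1) by nra.
  rewrite <- (Rdiv_1_r (K * X)) at 1. apply Rmult_le_compat_l; [exact H|].
  apply Rinv_le_contravar; lra.
Qed.

(** The scalar problem is put into the shooting scheme by truncating the unknown to
    [[0, R0 / alpha]] and using the same right-hand side in both equations. The two bounds then
    follow from the minimum principle; since [rho] is not zero, neither is [m], and the Hopf
    estimate gives [k]. *)
Lemma linear_problem (alpha : R) (rho : R -> R) (R0 : R) :
  0 < alpha -> (forall x, in_open01 x -> continuous rho x) ->
  (forall x, in_open01 x -> 0 <= rho x <= R0) -> (exists x, in_open01 x /\ rho x <> 0) ->
  exists m m1 a k M, cauchy_solution (fun t => alpha * m t - rho t) a m m1 /\ m 1 = 0 /\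
    0 < k /\ 0 < M /\
    forall x, in_open01 x -> k * (x * (1 - x)) <= m x <= M * (x * (1 - x)).
Proof.
  intros Ha Crho Brho [x0 [Hx0 Nx0]].
  assert (HR0 : 0 <= R0) by (specialize (Brho x0 Hx0); lra).
  set (L := R0 / alpha). assert (HL : 0 <= L) by (apply Rdiv_le_0_compat; lra).
  set (H := fun (x u v : R) => alpha * Rmax 0 (Rmin L u) - rho x).
  assert (Bc : forall u, 0 <= Rmax 0 (Rmin L u) <= L).
  { intros u. split; [apply Rmax_l|]. apply Rmax_lub; [exact HL | apply Rmin_l]. }
  assert (A : admissible R0 alpha H).
  { constructor.
    - intros u v Cu Cv x Hx. apply continuous_minus_R; [|apply Crho, Hx].
      apply continuous_mult_R; [apply continuous_const|].
      apply continuous_Rmax; [apply continuous_const|].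
      apply continuous_Rmin; [apply continuous_const | apply Cu].
    - intros x u v Hx. unfold H. specialize (Bc u). specialize (Brho x Hx).
      assert (alpha * L = R0) by (unfold L; field; lra).
      assert (0 <= alpha * Rmax 0 (Rmin L u)) by (apply Rmult_le_pos; lra).
      assert (alpha * Rmax 0 (Rmin L u) <= alpha * L) by (apply Rmult_le_compat_l; lra).
      apply Rabs_le; lra.
    - intros x u v u' v' Hx. unfold H.
      assert (P : 0 <= alpha * (Rabs (u - u') + Rabs (v - v'))).
      { apply Rmult_le_pos; [lra|]. apply Rplus_le_le_0_compat; apply Rabs_pos. }
      apply Rle_trans with (2 := div_parabola_ge _ _ _ Hx P).
      replace (alpha * Rmax 0 (Rmin L u) - rho x - (alpha * Rmax 0 (Rmin L u') - rho x))
        with (alpha * (Rmax 0 (Rmin L u) - Rmax 0 (Rmin L u'))) by ring.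
      rewrite Rabs_mult, (Rabs_pos_eq alpha) by lra. apply Rmult_le_compat_l; [lra|].
      apply Rle_trans with (1 := Rmax_contract _ _ _ _).
      rewrite (Rminus_diag_eq 0 0 eq_refl), Rabs_R0.
      generalize (Rmin_contract L u u') (Rabs_pos (u - u')) (Rabs_pos (v - v')); intros.
      apply Rmax_lub; lra. }
  destruct (bvp_exists R0 alpha H H Ha A A) as [m [m1 [v [v1 [a [b [S [_ [m_1 _]]]]]]]]].
  assert (I : forall x, 0 < x < 1 -> in_open01 x) by (intros; assumption).
  assert (Pm : forall x, 0 <= x <= 1 -> 0 <= m x).
  { apply (min_principle m m1 (fun t => H t (m t) (v t))); try lra.
    - intros x _; apply S.
    - intros x Hx; apply S, I, Hx.
    - intros x Hx; apply (cs_d1 _ _ _ _ S), I, Hx.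
    - rewrite (cs_0 _ _ _ _ S); lra.
    - intros x Hx Hn. unfold H. rewrite Rmax_left; [|generalize (Rmin_r L (m x)); lra].
      specialize (Brho x (I x Hx)). lra. }
  assert (Um : forall x, 0 <= x <= 1 -> 0 <= L - m x).
  { apply (min_principle (fun x => L - m x) (fun x => 0 - m1 x) (fun t => 0 - H t (m t) (v t)));
      try lra.
    - intros x _; apply continuous_minus_R; [apply continuous_const | apply S].
    - intros x Hx. apply is_derive_minus_R;
        [apply (is_derive_const (V := R_NormedModule)) | apply S, I, Hx].
    - intros x Hx. apply is_derive_minus_R;
        [apply (is_derive_const (V := R_NormedModule)) | apply (cs_d1 _ _ _ _ S), I, Hx].
    - rewrite (cs_0 _ _ _ _ S); lra.
    - intros x Hx Hn. unfold H. rewrite Rmin_left, Rmax_right by lra.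
      specialize (Brho x (I x Hx)). assert (alpha * L = R0) by (unfold L; field; lra). lra. }
  assert (S' : cauchy_solution (fun t => alpha * m t - rho t) a m m1).
  { revert S. apply cauchy_solution_ext. intros x [Hx0' Hx1].
    specialize (Pm x ltac:(lra)). specialize (Um x ltac:(lra)).
    unfold H. rewrite Rmin_right, Rmax_right by lra. reflexivity. }
  assert (Ex : exists y, 0 < y < 1 /\ 0 < m y).
  { destruct (Classical_Prop.classic (exists y, 0 < y < 1 /\ 0 < m y)) as [C|C]; [exact C|exfalso].
    assert (Z : forall y, in_open01 y -> m y = 0).
    { intros y Hy. apply Rle_antisym; [|apply Pm; unfold in_open01 in Hy; lra].
      apply Rnot_lt_le; intro C'. apply C. exists y. auto. }
    assert (Z1 : forall y, in_open01 y -> m1 y = 0).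
    { intros y Hy. apply (is_derive_locally_zero m y); [|apply S, Hy].
      generalize (in01_locally y Hy). apply filter_imp, Z. }
    assert (Z2 : alpha * m x0 - rho x0 = 0).
    { apply (is_derive_locally_zero m1 x0); [|apply (cs_d1 _ _ _ _ S'), Hx0].
      generalize (in01_locally x0 Hx0). apply filter_imp, Z1. }
    rewrite (Z x0 Hx0) in Z2. lra. }
  destruct Ex as [y [Hy Py]].
  destruct (hopf_bound alpha m m1 (fun t => alpha * m t - rho t) y Ha Hy) as [k [Hk Bk]];
    try apply S'; auto.
  { intros x Hx. specialize (Brho x Hx). lra. }
  { rewrite (cs_0 _ _ _ _ S); lra. } { lra. }
  destruct (derive_bound_parabola m m1) as [M [HM BM]]; try apply S; auto.
  exists m, m1, a, k, M. split; [exact S'|]. split; [exact m_1|].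
  split; [exact Hk|]. split; [exact HM|]. intros x Hx.
  split; [apply Bk; unfold in_open01 in Hx; lra | apply BM, Hx].
Qed.

Lemma power_lt_linear (A R0 e M0 : R) :
  e < 1 -> exists M, 0 < M /\ M0 <= M /\ A * Rpower M e + R0 <= 2 * M.
Proof.
  intros He.
  set (A' := Rmax A 1). assert (HA : A <= A') by apply Rmax_l. assert (HA1 : 1 <= A') by apply Rmax_r.
  (* Chosen so that [M1^(1 - e) = A'], whence [A' M^e <= M] for all [M >= M1]. *)
  set (M1 := Rpower A' (/ (1 - e))).
  assert (H1 : 0 < M1) by apply exp_pos.
  set (M := Rmax M1 (Rmax M0 R0)).
  assert (L1 : M1 <= M) by apply Rmax_l.
  assert (L2 : Rmax M0 R0 <= M) by apply Rmax_r.
  assert (L3 := Rmax_l M0 R0). assert (L4 := Rmax_r M0 R0).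
  exists M. split; [lra|]. split; [lra|].
  assert (A' * Rpower M e <= M); [|
    assert (A * Rpower M e <= A' * Rpower M e)
      by (apply Rmult_le_compat_r; [left; apply exp_pos | lra]); lra].
  replace A' with (Rpower M1 (1 - e)).
  - apply Rle_trans with (Rpower M (1 - e) * Rpower M e).
    + apply Rmult_le_compat_r; [left; apply exp_pos|].
      apply Rle_Rpower_l; lra.
    + rewrite <- Rpower_plus. replace (1 - e + e) with 1 by ring. rewrite Rpower_1; lra.
  - unfold M1. rewrite Rpower_mult. replace (/ (1 - e) * (1 - e)) with 1 by (field; lra).
    apply Rpower_1; lra.
Qed.

(** The two quotients differ by the factor [(u / v)^s >= 1]. *)
Lemma power_ratio_raise (p q s u v : R) :
  0 <= s -> 0 < v <= u -> power_ratio p q u v <= power_ratio (p + s) (q + s) u v.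
Proof.
  intros Hs Hv. rewrite !power_ratio_exp. apply exp_le.
  assert (ln v <= ln u) by (apply ln_le_mono; lra). nra.
Qed.

Lemma power_ratio_diag_le (P Q u u' : R) :
  Q <= P -> 0 < u <= u' -> power_ratio P Q u u <= power_ratio P Q u' u'.
Proof.
  intros HPQ Hu. rewrite !power_ratio_exp. apply exp_le.
  assert (ln u <= ln u') by (apply ln_le_mono; lra). nra.
Qed.

(** By homogeneity, since [d^(P - Q) >= d] for [d <= 1] and [P - Q <= 1]. This is the lower bound of
    order [d] that the barrier for [v] has to match. *)
Lemma power_ratio_ge_parabola (P Q k c d : R) :
  P - Q <= 1 -> 0 < k -> 0 < c -> 0 < d <= 1 ->
  power_ratio P Q k c * d <= power_ratio P Q (k * d) (c * d).
Proof.
  intros HPQ Hk Hc Hd. rewrite power_ratio_scale by lra.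
  apply Rmult_le_compat_l; [left; apply power_ratio_pos | apply Rpower_ge_self; lra].
Qed.

Lemma Rabs_div_parabola (a X Y x : R) :
  in_open01 x -> 0 <= a -> Rabs X <= Y -> Rabs (a * X) <= a * Y / (x * (1 - x)).
Proof.
  intros Hx Ha H. rewrite Rabs_mult, (Rabs_pos_eq a) by exact Ha.
  apply Rle_trans with (a * Y); [apply Rmult_le_compat_l; assumption|].
  apply div_parabola_ge; [exact Hx|]. apply Rmult_le_pos; [exact Ha|].
  generalize (Rabs_pos X); lra.
Qed.

Section Truncation.
Variables (alpha beta p q sigma : R) (rho : R -> R) (R0 : R).
Hypothesis (halpha : 0 < alpha) (hbeta : 0 < beta) (hba : beta <= alpha).
Hypothesis (hq : 0 < q) (hqp : q <= p) (hp : p <= 1) (hsigma : 0 <= sigma).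
Hypothesis (Crho : forall x, in_open01 x -> continuous rho x).
Hypothesis (Brho : forall x, in_open01 x -> 0 <= rho x <= R0).

Variables (m : R -> R) (k c M L : R).
Hypothesis (Cm : forall x, continuous m x).
Hypothesis (Hk : 0 < k) (Hc : 0 < c) (HM : 0 < M).
Hypothesis (Bm : forall x, in_open01 x -> k * (x * (1 - x)) <= m x <= M * (x * (1 - x))).

Let d (x : R) : R := x * (1 - x).
Let b (x : R) : R := c * (d x * (1 + d x)).
Let us (x u : R) : R := Rmax (m x) (Rmin (M * d x) u).
(** The denominator is truncated from below only: large values of [v] make the quotient small. *)
Let vs (x u v : R) : R := Rmax (Rmax v (b x)) (us x u - m x).
(** For the linear term, where an upper truncation at [L] is what keeps the right-hand side
    bounded. *)
Let vh (x v : R) : R := Rmax (b x) (Rmin L v).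
Let H1 (x u v : R) : R := alpha * us x u - power_ratio p q (us x u) (vs x u v) - rho x.
Let H2 (x u v : R) : R :=
  beta * vh x v - power_ratio (p + sigma) (q + sigma) (us x u) (vs x u v).

Local Lemma d_bounds (x : R) : in_open01 x -> 0 < d x <= 1.
Proof. intros [H H']; unfold d; split; [apply Rmult_lt_0_compat; lra | nra]. Qed.

Local Lemma b_bounds (x : R) : in_open01 x -> 0 < c * d x <= b x /\ b x <= 2 * c * d x.
Proof.
  intros Hx. assert (Hd := d_bounds x Hx). unfold b.
  assert (0 < c * d x) by (apply Rmult_lt_0_compat; lra).
  assert (0 <= c * d x * d x) by (apply Rmult_le_pos; lra).
  assert (c * d x * d x <= c * d x * 1) by (apply Rmult_le_compat_l; lra).
  lra.
Qed.

Local Lemma us_bounds (x u : R) : in_open01 x -> k * d x <= us x u <= M * d x /\ m x <= us x u.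
Proof.
  intros Hx. specialize (Bm x Hx). fold (d x) in Bm. unfold us.
  assert (m x <= Rmax (m x) (Rmin (M * d x) u)) by apply Rmax_l.
  assert (Rmax (m x) (Rmin (M * d x) u) <= M * d x).
  { apply Rmax_lub; [lra | apply Rmin_l]. }
  lra.
Qed.

Local Lemma vs_bounds (x u v : R) : in_open01 x ->
  v <= vs x u v /\ b x <= vs x u v /\ us x u - m x <= vs x u v.
Proof.
  intros Hx. unfold vs.
  assert (A1 := Rmax_l v (b x)). assert (A2 := Rmax_r v (b x)).
  assert (A3 := Rmax_l (Rmax v (b x)) (us x u - m x)).
  assert (A4 := Rmax_r (Rmax v (b x)) (us x u - m x)). lra.
Qed.

Local Lemma us_contract (x u u' : R) : Rabs (us x u - us x u') <= Rabs (u - u').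
Proof.
  unfold us. apply Rle_trans with (1 := Rmax_contract _ _ _ _).
  rewrite (Rminus_diag_eq (m x) (m x) eq_refl), Rabs_R0.
  apply Rmax_lub; [apply Rabs_pos | apply Rmin_contract].
Qed.

Local Lemma vs_contract (x u v u' v' : R) :
  Rabs (vs x u v - vs x u' v') <= Rabs (u - u') + Rabs (v - v').
Proof.
  unfold vs. apply Rle_trans with (1 := Rmax_contract _ _ _ _).
  assert (Pu := Rabs_pos (u - u')). assert (Pv := Rabs_pos (v - v')).
  apply Rmax_lub.
  - apply Rle_trans with (1 := Rmax_contract _ _ _ _).
    rewrite (Rminus_diag_eq (b x) (b x) eq_refl), Rabs_R0. apply Rmax_lub; lra.
  - replace (us x u - m x - (us x u' - m x)) with (us x u - us x u') by ring.
    generalize (us_contract x u u'); lra.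
Qed.

Local Lemma vh_contract (x v v' : R) : Rabs (vh x v - vh x v') <= Rabs (v - v').
Proof.
  unfold vh. apply Rle_trans with (1 := Rmax_contract _ _ _ _).
  rewrite (Rminus_diag_eq (b x) (b x) eq_refl), Rabs_R0.
  apply Rmax_lub; [apply Rabs_pos | apply Rmin_contract].
Qed.

Local Lemma continuous_d (x : R) : continuous d x.
Proof. apply (ex_derive_continuous d). unfold d. auto_derive; auto. Qed.

Local Lemma continuous_b (x : R) : continuous b x.
Proof. apply (ex_derive_continuous b). unfold b, d. auto_derive; auto. Qed.

Local Lemma continuous_us (u : R -> R) (x : R) :
  continuous u x -> continuous (fun t => us t (u t)) x.
Proof.
  intros Cu. apply continuous_Rmax; [apply Cm|]. apply continuous_Rmin; [|exact Cu].
  apply continuous_mult_R; [apply continuous_const | apply continuous_d].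
Qed.

Local Lemma continuous_vs (u v : R -> R) (x : R) :
  continuous u x -> continuous v x -> continuous (fun t => vs t (u t) (v t)) x.
Proof.
  intros Cu Cv. apply continuous_Rmax.
  - apply continuous_Rmax; [exact Cv | apply continuous_b].
  - apply continuous_minus_R; [apply continuous_us, Cu | apply Cm].
Qed.

Local Lemma continuous_vh (v : R -> R) (x : R) :
  continuous v x -> continuous (fun t => vh t (v t)) x.
Proof.
  intros Cv. apply continuous_Rmax; [apply continuous_b|].
  apply continuous_Rmin; [apply continuous_const | exact Cv].
Qed.

Local Lemma truncated_ratio_continuous (P Q : R) (u v : R -> R) (x : R) :
  in_open01 x -> continuous u x -> continuous v x ->
  continuous (fun t => power_ratio P Q (us t (u t)) (vs t (u t) (v t))) x.
Proof.
  intros Hx Cu Cv.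
  assert (Hd := d_bounds x Hx). assert (Hb := b_bounds x Hx).
  assert (Hu := us_bounds x (u x) Hx). assert (Hv := vs_bounds x (u x) (v x) Hx).
  assert (0 < k * d x) by (apply Rmult_lt_0_compat; lra).
  apply continuous_power_ratio; try lra; [apply continuous_us, Cu | apply continuous_vs; assumption].
Qed.

Local Lemma truncated_ratio_bound (P Q x u v : R) :
  0 <= Q <= P -> in_open01 x ->
  0 < power_ratio P Q (us x u) (vs x u v) <= power_ratio P Q M c.
Proof.
  intros HPQ Hx.
  assert (Hd := d_bounds x Hx). assert (Hb := b_bounds x Hx).
  assert (Hu := us_bounds x u Hx). assert (Hv := vs_bounds x u v Hx).
  assert (0 < k * d x) by (apply Rmult_lt_0_compat; lra).
  split; [apply power_ratio_pos|].
  apply power_ratio_bound with (d x); lra.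
Qed.

Local Lemma truncated_ratio_lipschitz (P Q : R) :
  0 <= Q <= P -> exists K, 0 < K /\ forall x u v u' v', in_open01 x ->
    Rabs (power_ratio P Q (us x u) (vs x u v) - power_ratio P Q (us x u') (vs x u' v'))
      <= K * (Rabs (u - u') + Rabs (v - v')) / (x * (1 - x)).
Proof.
  intros HPQ. destruct (power_ratio_lipschitz P Q k M c HPQ Hk HM Hc) as [K [HK HL]].
  exists (2 * K). split; [lra|]. intros x u v u' v' Hx.
  assert (Hd := d_bounds x Hx). assert (Hb := b_bounds x Hx).
  assert (Hu := us_bounds x u Hx). assert (Hv := vs_bounds x u v Hx).
  assert (Hu' := us_bounds x u' Hx). assert (Hv' := vs_bounds x u' v' Hx).
  apply Rle_trans with (1 := HL (d x) (us x u) (us x u') (vs x u v) (vs x u' v')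
    Hd (proj1 Hu) (proj1 Hu') ltac:(lra) ltac:(lra)).
  fold (d x). apply Rmult_le_compat_r; [left; apply Rinv_0_lt_compat; lra|].
  rewrite (Rmult_comm 2), Rmult_assoc. apply Rmult_le_compat_l; [lra|].
  generalize (us_contract x u u') (vs_contract x u v u' v') (Rabs_pos (v - v')); lra.
Qed.

Lemma truncation_admissible : exists B K, 0 < K /\ admissible B K H1 /\ admissible B K H2.
Proof.
  assert (PQ1 : 0 <= q <= p) by lra.
  assert (PQ2 : 0 <= q + sigma <= p + sigma) by lra.
  destruct (truncated_ratio_lipschitz p q PQ1) as [K1 [HK1 L1]].
  destruct (truncated_ratio_lipschitz (p + sigma) (q + sigma) PQ2) as [K2 [HK2 L2]].
  set (B1 := alpha * M + power_ratio p q M c + R0).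
  set (B2 := beta * (2 * c + Rabs L) + power_ratio (p + sigma) (q + sigma) M c).
  assert (Gen : forall (H : R -> R -> R -> R) B K B' K', B <= B' -> K <= K' ->
     admissible B K H -> admissible B' K' H).
  { intros H B K B' K' HB HK A. constructor.
    - apply (adm_c _ _ _ A).
    - intros x u v Hx. apply Rle_trans with (1 := adm_b _ _ _ A x u v Hx). exact HB.
    - intros x u v u' v' Hx. apply Rle_trans with (1 := adm_l _ _ _ A x u v u' v' Hx).
      apply Rmult_le_compat_r.
      + left; apply Rinv_0_lt_compat. apply (d_bounds x Hx).
      + apply Rmult_le_compat_r; [apply Rplus_le_le_0_compat; apply Rabs_pos | exact HK]. }
  assert (Split : forall a X Y N W x K, in_open01 x -> 0 < a -> Rabs X <= N ->
    Rabs Y <= K * N / (x * (1 - x)) -> W = a * X - Y -> Rabs W <= (a + K) * N / (x * (1 - x))).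
  { intros a X Y N W x K Hx Ha HX HY ->. assert (Hd := d_bounds x Hx). unfold d in Hd.
    apply Rle_trans with (1 := Rabs_triang _ _). rewrite Rabs_Ropp.
    assert (T := Rabs_div_parabola a X N x Hx ltac:(lra) HX).
    replace ((a + K) * N / (x * (1 - x))) with (a * N / (x * (1 - x)) + K * N / (x * (1 - x)))
      by (field; unfold in_open01 in Hx; lra). lra. }
  assert (A1 : admissible B1 (alpha + K1) H1).
  { constructor.
    - intros u v Cu Cv x Hx. apply continuous_minus_R; [|apply Crho, Hx].
      apply continuous_minus_R; [|apply truncated_ratio_continuous; auto].
      apply continuous_mult_R; [apply continuous_const | apply continuous_us, Cu].
    - intros x u v Hx. unfold H1, B1.
      assert (T := truncated_ratio_bound p q x u v PQ1 Hx).
      assert (Hd := d_bounds x Hx). assert (Hu := us_bounds x u Hx). specialize (Brho x Hx).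
      assert (0 <= k * d x) by (apply Rmult_le_pos; lra).
      assert (M * d x <= M * 1) by (apply Rmult_le_compat_l; lra).
      assert (0 <= alpha * us x u) by (apply Rmult_le_pos; lra).
      assert (alpha * us x u <= alpha * M) by (apply Rmult_le_compat_l; lra).
      apply Rabs_le; lra.
    - intros x u v u' v' Hx.
      apply (Split alpha (us x u - us x u') (power_ratio p q (us x u) (vs x u v)
         - power_ratio p q (us x u') (vs x u' v'))); auto; [|unfold H1; ring].
      generalize (us_contract x u u') (Rabs_pos (v - v')); lra. }
  assert (A2 : admissible B2 (beta + K2) H2).
  { constructor.
    - intros u v Cu Cv x Hx.
      apply continuous_minus_R; [|apply truncated_ratio_continuous; auto].
      apply continuous_mult_R; [apply continuous_const | apply continuous_vh, Cv].
    - intros x u v Hx. unfold H2, B2.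
      assert (T := truncated_ratio_bound (p + sigma) (q + sigma) x u v PQ2 Hx).
      assert (Hd := d_bounds x Hx). assert (Hb := b_bounds x Hx).
      assert (2 * c * d x <= 2 * c * 1) by (apply Rmult_le_compat_l; lra).
      assert (0 <= vh x v) by (unfold vh; generalize (Rmax_l (b x) (Rmin L v)); lra).
      assert (vh x v <= 2 * c + Rabs L).
      { unfold vh. apply Rmax_lub; [generalize (Rabs_pos L); lra|].
        generalize (Rmin_l L v) (Rle_abs L); lra. }
      assert (0 <= beta * vh x v) by (apply Rmult_le_pos; lra).
      assert (beta * vh x v <= beta * (2 * c + Rabs L)) by (apply Rmult_le_compat_l; lra).
      apply Rabs_le; lra.
    - intros x u v u' v' Hx.
      apply (Split beta (vh x v - vh x v') (power_ratio (p + sigma) (q + sigma) (us x u) (vs x u v)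
         - power_ratio (p + sigma) (q + sigma) (us x u') (vs x u' v'))); auto; [|unfold H2; ring].
      generalize (vh_contract x v v') (Rabs_pos (u - u')); lra. }
  exists (Rmax B1 B2), (Rmax (alpha + K1) (beta + K2)).
  split; [apply Rlt_le_trans with (alpha + K1); [lra | apply Rmax_l]|].
  split; [apply (Gen H1 B1 (alpha + K1)) | apply (Gen H2 B2 (beta + K2))]; auto;
    (apply Rmax_l || apply Rmax_r).
Qed.

Variables (m1 : R -> R) (am : R).
Hypothesis (Sm : cauchy_solution (fun t => alpha * m t - rho t) am m m1) (m_1 : m 1 = 0).
Hypothesis (HL1 : 2 * c <= L) (HL2 : power_ratio (p + sigma) (q + sigma) M c <= beta * L).
(* [C] bounds [us / vs], because [us <= vs + m] and [c d <= vs]. *)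
Variable (C : R).
Hypothesis (HC : 0 < C) (HC2 : forall x, in_open01 x -> m x <= (C - 1) * (c * d x)) (HC1 : 1 <= C).
(** The quotient here is [C^q]. The left side bounds the source of [u] wherever [u] exceeds [M d],
    and [2 M = - (M d)'']. *)
Hypothesis (HM2 : power_ratio p q 1 (/ C) * Rpower M (p - q) + R0 <= 2 * M).
(** The [2 beta] comes from [b <= 2 c d] and the [12] from [(d (1 + d))'' = - 12 d]. Where [v < b],
    the two quotients serve the cases [vs = b], with [b <= d] by [Hc2], and [vs = us - m]. *)
Hypothesis (Hc2 : c <= / 2)
  (Hc3 : c * (2 * beta + 12) <= power_ratio (p + sigma) (q + sigma) k 1)
  (Hc4 : c * (2 * beta + 12) <= power_ratio (p + sigma) (q + sigma) k k).

(** Each truncation is shown to be inactive by the minimum principle. The bounds [m <= u <= M d] and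
    [b <= v] precede [v >= u - m], whose proof relies on them. *)
Lemma truncation_solution (u u1 v v1 : R -> R) (au av : R) :
  cauchy_solution (fun t => H1 t (u t) (v t)) au u u1 ->
  cauchy_solution (fun t => H2 t (u t) (v t)) av v v1 ->
  u 1 = 0 -> v 1 = 0 ->
  regular_solution alpha beta p q sigma rho u u1 v v1.
Proof.
  intros Su Sv u_1 v_1.
  assert (I : forall x, 0 < x < 1 -> in_open01 x) by (intros; assumption).
  assert (d0 : d 0 = 0) by (unfold d; ring). assert (d1 : d 1 = 0) by (unfold d; ring).
  assert (b0 : b 0 = 0) by (unfold b; rewrite d0; ring).
  assert (b1 : b 1 = 0) by (unfold b; rewrite d1; ring).
  assert (Pm : forall x, 0 <= x <= 1 -> 0 <= u x - m x).
  { apply (min_principle (fun x => u x - m x) (fun x => u1 x - m1 x)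
      (fun x => H1 x (u x) (v x) - (alpha * m x - rho x))); try lra.
    - intros x _; apply continuous_minus_R; [apply Su | apply Cm].
    - intros x Hx; apply is_derive_minus_R; [apply Su | apply Sm]; exact Hx.
    - intros x Hx; apply is_derive_minus_R; [apply (cs_d1 _ _ _ _ Su) | apply (cs_d1 _ _ _ _ Sm)]; exact Hx.
    - rewrite (cs_0 _ _ _ _ Su), (cs_0 _ _ _ _ Sm); lra.
    - intros x Hx Hn. specialize (I x Hx). assert (Bm' := Bm x I). fold (d x) in Bm'.
      assert (Eu : us x (u x) = m x).
      { unfold us. rewrite Rmin_right, Rmax_left; lra. }
      assert (T := truncated_ratio_bound p q x (u x) (v x) ltac:(lra) I).
      unfold H1. rewrite Eu in *. lra. }
  (* Where [u > M d], the truncated value [us = M d] is at most [C vs], so the quotient is at most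
     [C^q (M d)^(p - q) <= C^q M^(p - q)], and [HM2] applies. *)
  assert (PM : forall x, 0 <= x <= 1 -> 0 <= M * d x - u x).
  { apply (min_principle (fun x => M * d x - u x) (fun x => M * (1 - 2 * x) - u1 x)
      (fun x => - 2 * M - H1 x (u x) (v x))); try lra.
    - intros x _; apply continuous_minus_R; [|apply Su].
      apply continuous_mult_R; [apply continuous_const | apply continuous_d].
    - intros x Hx; apply is_derive_minus_R; [|apply Su; exact Hx].
      unfold d; auto_derive; auto; ring.
    - intros x Hx; apply is_derive_minus_R; [|apply (cs_d1 _ _ _ _ Su); exact Hx].
      auto_derive; auto; ring.
    - rewrite (cs_0 _ _ _ _ Su), d0; lra.
    - rewrite u_1, d1; lra.
    - intros x Hx Hn. specialize (I x Hx). assert (Bm' := Bm x I). fold (d x) in Bm'.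
      assert (Hd := d_bounds x I). assert (Hb := b_bounds x I).
      assert (Eu : us x (u x) = M * d x).
      { unfold us. rewrite Rmin_left, Rmax_right; lra. }
      assert (Hv := vs_bounds x (u x) (v x) I). rewrite Eu in Hv.
      assert (HCx := HC2 x I).
      assert (HMd : 0 < M * d x) by (apply Rmult_lt_0_compat; lra).
      assert (Hvs : M * d x <= C * vs x (u x) (v x)).
      { assert ((C - 1) * (c * d x) <= (C - 1) * vs x (u x) (v x))
          by (apply Rmult_le_compat_l; lra). lra. }
      assert (HMC : 0 < / C) by (apply Rinv_0_lt_compat; lra).
      assert (T1 : power_ratio p q (M * d x) (vs x (u x) (v x))
         <= power_ratio p q (1 * (M * d x)) (/ C * (M * d x))).
      { apply power_ratio_le; try lra. split; [apply Rmult_lt_0_compat; lra|].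
        apply Rmult_le_reg_l with C; [lra|]. rewrite <- Rmult_assoc, Rinv_r, Rmult_1_l by lra. exact Hvs. }
      rewrite power_ratio_scale in T1 by lra.
      assert (T2 : Rpower (M * d x) (p - q) <= Rpower M (p - q)).
      { apply Rle_Rpower_l; [lra|]. split; [exact HMd|].
        rewrite <- (Rmult_1_r M) at 2. apply Rmult_le_compat_l; lra. }
      apply Rmult_le_compat_l with (r := power_ratio p q 1 (/ C)) in T2;
        [|left; apply power_ratio_pos].
      specialize (Brho x I).
      assert (0 < alpha * (M * d x)) by (apply Rmult_lt_0_compat; lra).
      unfold H1. rewrite Eu. lra. }
  assert (Eus : forall x, in_open01 x -> us x (u x) = u x).
  { intros x [Hx0 Hx1]. specialize (Pm x ltac:(lra)). specialize (PM x ltac:(lra)).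
    unfold us. rewrite Rmin_right, Rmax_right; lra. }
  assert (Pb : forall x, 0 <= x <= 1 -> 0 <= v x - b x).
  { apply (min_principle (fun x => v x - b x) (fun x => v1 x - c * ((1 - 2 * x) * (1 + 2 * d x)))
      (fun x => H2 x (u x) (v x) - c * (- 12 * d x))); try lra.
    - intros x _; apply continuous_minus_R; [apply Sv | apply continuous_b].
    - intros x Hx; apply is_derive_minus_R; [apply Sv; exact Hx|].
      unfold b, d; auto_derive; auto; ring.
    - intros x Hx; apply is_derive_minus_R; [apply (cs_d1 _ _ _ _ Sv); exact Hx|].
      unfold d; auto_derive; auto; ring.
    - rewrite (cs_0 _ _ _ _ Sv), b0; lra.
    - intros x Hx Hn. specialize (I x Hx).
      assert (Hd := d_bounds x I). assert (Hb := b_bounds x I).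
      assert (Hu := us_bounds x (u x) I).
      assert (Hkd : 0 < k * d x) by (apply Rmult_lt_0_compat; lra).
      assert (HbL : 2 * c * d x <= 2 * c * 1) by (apply Rmult_le_compat_l; lra).
      assert (Ev : vh x (v x) = b x).
      { unfold vh. rewrite Rmin_right, Rmax_left; lra. }
      assert (T : c * (2 * beta + 12) * d x
         <= power_ratio (p + sigma) (q + sigma) (us x (u x)) (vs x (u x) (v x))).
      { unfold vs. rewrite (Rmax_right (v x)) by lra.
        destruct (Rle_lt_dec (us x (u x) - m x) (b x)) as [Hle|Hlt].
        - rewrite Rmax_left by lra.
          apply Rle_trans with (power_ratio (p + sigma) (q + sigma) (k * d x) (1 * d x)).
          + apply Rle_trans with (power_ratio (p + sigma) (q + sigma) k 1 * d x).
            * apply Rmult_le_compat_r; lra.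
            * apply power_ratio_ge_parabola; lra.
          + apply power_ratio_le; try lra. split; [lra|].
            apply Rle_trans with (1 := proj2 Hb). apply Rmult_le_compat_r; lra.
        - rewrite Rmax_right by lra. assert (Hmx := Bm x I). fold (d x) in Hmx.
          apply Rle_trans with (power_ratio (p + sigma) (q + sigma) (k * d x) (k * d x)).
          + apply Rle_trans with (power_ratio (p + sigma) (q + sigma) k k * d x).
            * apply Rmult_le_compat_r; lra.
            * apply power_ratio_ge_parabola; lra.
          + apply Rle_trans with (power_ratio (p + sigma) (q + sigma) (us x (u x)) (us x (u x))).
            * apply power_ratio_diag_le; lra.
            * apply power_ratio_le; lra. }
      unfold H2. rewrite Ev.
      assert (beta * b x <= beta * (2 * c * d x)) by (apply Rmult_le_compat_l; lra).
      lra. }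
  (* In the equation for [u - m] the term [rho] cancels. Where [v < u - m], both quotients have
     denominator [u - m < u], so the one with exponents raised by [sigma] dominates, while
     [beta <= alpha] orders the linear terms. *)
  assert (Pv : forall x, 0 <= x <= 1 -> 0 <= v x - (u x - m x)).
  { apply (min_principle (fun x => v x - (u x - m x)) (fun x => v1 x - (u1 x - m1 x))
      (fun x => H2 x (u x) (v x) - (H1 x (u x) (v x) - (alpha * m x - rho x)))); try lra.
    - intros x _; apply continuous_minus_R; [apply Sv|].
      apply continuous_minus_R; [apply Su | apply Cm].
    - intros x Hx; apply is_derive_minus_R; [apply Sv; exact Hx|].
      apply is_derive_minus_R; [apply Su | apply Sm]; exact Hx.
    - intros x Hx; apply is_derive_minus_R; [apply (cs_d1 _ _ _ _ Sv); exact Hx|].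
      apply is_derive_minus_R; [apply (cs_d1 _ _ _ _ Su) | apply (cs_d1 _ _ _ _ Sm)]; exact Hx.
    - rewrite (cs_0 _ _ _ _ Su), (cs_0 _ _ _ _ Sv), (cs_0 _ _ _ _ Sm); lra.
    - intros x Hx Hn. specialize (I x Hx).
      assert (Hb := b_bounds x I). assert (Bx := Pb x ltac:(lra)).
      assert (Bm' := Bm x I). assert (Hd := d_bounds x I). fold (d x) in Bm'.
      assert (0 < k * d x) by (apply Rmult_lt_0_compat; lra).
      assert (Ev : vs x (u x) (v x) = u x - m x).
      { unfold vs. rewrite Eus by exact I. rewrite (Rmax_left (v x)), Rmax_right by lra. reflexivity. }
      assert (Eh : vh x (v x) <= v x).
      { unfold vh. apply Rmax_lub; [lra | apply Rmin_r]. }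
      unfold H1, H2. rewrite Ev, Eus by exact I.
      assert (T := power_ratio_raise p q sigma (u x) (u x - m x) hsigma ltac:(lra)).
      assert (beta * vh x (v x) <= beta * (u x - m x)) by (apply Rmult_le_compat_l; lra).
      assert (beta * (u x - m x) <= alpha * (u x - m x)) by (apply Rmult_le_compat_r; lra).
      lra. }
  assert (PL : forall x, 0 <= x <= 1 -> 0 <= L - v x).
  { apply (min_principle (fun x => L - v x) (fun x => 0 - v1 x) (fun x => 0 - H2 x (u x) (v x)));
      try lra.
    - intros x _; apply continuous_minus_R; [apply continuous_const | apply Sv].
    - intros x Hx. apply is_derive_minus_R;
        [apply (is_derive_const (V := R_NormedModule)) | apply Sv; exact Hx].
    - intros x Hx. apply is_derive_minus_R;
        [apply (is_derive_const (V := R_NormedModule)) | apply (cs_d1 _ _ _ _ Sv); exact Hx].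
    - rewrite (cs_0 _ _ _ _ Sv); lra.
    - intros x Hx Hn. specialize (I x Hx).
      assert (Hd := d_bounds x I). assert (Hb := b_bounds x I).
      assert (HbL : 2 * c * d x <= 2 * c * 1) by (apply Rmult_le_compat_l; lra).
      assert (Ev : vh x (v x) = L).
      { unfold vh. rewrite Rmin_left, Rmax_right; lra. }
      assert (T := truncated_ratio_bound (p + sigma) (q + sigma) x (u x) (v x) ltac:(lra) I).
      unfold H2. rewrite Ev. lra. }
  assert (Evs : forall x, in_open01 x -> vs x (u x) (v x) = v x).
  { intros x Hx. assert (Hx' := Hx). destruct Hx' as [Hx0 Hx1].
    specialize (Pb x ltac:(lra)). specialize (Pv x ltac:(lra)).
    unfold vs. rewrite Eus by exact Hx. rewrite (Rmax_left (v x)), Rmax_left by lra. reflexivity. }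
  assert (Evh : forall x, in_open01 x -> vh x (v x) = v x).
  { intros x [Hx0 Hx1]. specialize (Pb x ltac:(lra)). specialize (PL x ltac:(lra)).
    unfold vh. rewrite Rmin_right, Rmax_right; lra. }
  constructor; try apply Su; try apply Sv; try assumption.
  - intros x Hx. replace (alpha * u x - power_ratio p q (u x) (v x) - rho x)
      with (H1 x (u x) (v x)); [apply (cs_d1 _ _ _ _ Su), Hx|].
    unfold H1. rewrite Evs, Eus by exact Hx. reflexivity.
  - intros x Hx. replace (beta * v x - power_ratio (p + sigma) (q + sigma) (u x) (v x))
      with (H2 x (u x) (v x)); [apply (cs_d1 _ _ _ _ Sv), Hx|].
    unfold H2. rewrite Evs, Eus, Evh by exact Hx. reflexivity.
  - intros x Hx. assert (Hd := d_bounds x Hx). specialize (Bm x Hx). fold (d x) in Bm.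
    assert (0 < k * d x) by (apply Rmult_lt_0_compat; lra).
    destruct Hx. specialize (Pm x ltac:(lra)). lra.
  - intros x Hx. assert (Hb := b_bounds x Hx).
    destruct Hx. specialize (Pb x ltac:(lra)). lra.
Qed.
End Truncation.

Lemma regular_solution_exists (alpha beta p q sigma : R) (rho : R -> R) (R0 : R) :
  0 < alpha -> 0 < beta -> beta <= alpha -> 0 < q -> q <= p -> p <= 1 -> 0 <= sigma ->
  (forall x, in_open01 x -> continuous rho x) ->
  (forall x, in_open01 x -> 0 <= rho x <= R0) -> (exists x, in_open01 x /\ rho x <> 0) ->
  exists u u1 v v1, regular_solution alpha beta p q sigma rho u u1 v v1.
Proof.
  intros halpha hbeta hba hq hqp hp hsigma Crho Brho Nrho.
  destruct (linear_problem alpha rho R0 halpha Crho Brho Nrho)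
    as [m [m1 [am [k [M0 [Sm [m_1 [Hk [HM0 Bm]]]]]]]]].
  assert (Hd : forall x, in_open01 x -> 0 < x * (1 - x)).
  { intros x [Hx0 Hx1]; apply Rmult_lt_0_compat; lra. }
  set (g1 := power_ratio (p + sigma) (q + sigma) k 1).
  set (g2 := power_ratio (p + sigma) (q + sigma) k k).
  assert (Hg1 : 0 < g1) by apply power_ratio_pos. assert (Hg2 : 0 < g2) by apply power_ratio_pos.
  (* There is no circularity in the constants: [c] depends on [k] and the parameters, [C] on [c] and
     the first bound [M0] of [m], then [M >= M0] on [C], and finally [L] on [M] and [c]. *)
  set (c := Rmin (/ 2) (Rmin g1 g2 / (2 * beta + 12))).
  assert (Hg : 0 < Rmin g1 g2) by (apply Rmin_pos; assumption).
  assert (Hc : 0 < c) by (apply Rmin_pos; [lra | apply Rdiv_lt_0_compat; lra]).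
  assert (Hc2 : c <= / 2) by apply Rmin_l.
  assert (Hc0 : c * (2 * beta + 12) <= Rmin g1 g2).
  { apply Rle_trans with (Rmin g1 g2 / (2 * beta + 12) * (2 * beta + 12)).
    - apply Rmult_le_compat_r; [lra | apply Rmin_r].
    - right; field; lra. }
  assert (G1 := Rmin_l g1 g2). assert (G2 := Rmin_r g1 g2).
  set (C := 1 + M0 / c).
  assert (HMc : 0 < M0 / c) by (apply Rdiv_lt_0_compat; lra).
  destruct (power_lt_linear (power_ratio p q 1 (/ C)) R0 (p - q) M0) as [M [HM [HMM HM2]]]; [lra|].
  set (g := power_ratio (p + sigma) (q + sigma) M c).
  set (L := Rmax (2 * c) (g / beta)).
  assert (HL1 : 2 * c <= L) by apply Rmax_l.
  assert (HL2 : g <= beta * L).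
  { apply Rle_trans with (beta * (g / beta)); [right; field; lra|].
    apply Rmult_le_compat_l; [lra | apply Rmax_r]. }
  assert (Bm' : forall x, in_open01 x -> k * (x * (1 - x)) <= m x <= M * (x * (1 - x))).
  { intros x Hx. specialize (Bm x Hx). specialize (Hd x Hx).
    assert (M0 * (x * (1 - x)) <= M * (x * (1 - x))) by (apply Rmult_le_compat_r; lra). lra. }
  destruct (truncation_admissible alpha beta p q sigma rho R0 halpha hbeta hq hqp hsigma Crho Brho
    m k c M L (cs_c _ _ _ _ Sm) Hk Hc HM Bm') as [B [K [HK [A1 A2]]]].
  destruct (bvp_exists B K _ _ HK A1 A2) as [u [u1 [v [v1 [au [av [Su [Sv [u_1 v_1]]]]]]]]].
  exists u, u1, v, v1.
  apply (truncation_solution alpha beta p q sigma rho R0 halpha hbeta hba hq hqp hp hsigma Brho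
    m k c M L (cs_c _ _ _ _ Sm) Hk Hc HM Bm' m1 am Sm m_1 HL1 HL2 C) with au av; auto; try lra.
  - unfold C; lra.
  - intros x Hx. unfold C. replace ((1 + M0 / c - 1) * (c * (x * (1 - x)))) with (M0 * (x * (1 - x)))
      by (field; lra). apply Bm, Hx.
  - unfold C; lra.
  - fold g1; lra.
  - fold g2; lra.
Qed.

(** * Regularity at the boundary *)

Lemma at_right_eps (f : R -> R) (l : R) :
  (forall e, 0 < e -> exists d, 0 < d /\ forall x, 0 < x < d -> Rabs (f x - l) < e) ->
  filterlim f (at_right 0) (locally l).
Proof.
  intros H. apply filterlim_locally. intros e.
  destruct (H e (cond_pos e)) as [d [Hd H']].
  exists (mkposreal d Hd). intros y Hy Hy0. apply H'.
  change (Rabs (y - 0) < d) in Hy. rewrite Rminus_0_r in Hy.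
  rewrite Rabs_pos_eq in Hy; lra.
Qed.

Lemma at_right_interval (b : R) : 0 < b -> at_right 0 (fun x => 0 < x < b).
Proof.
  intros Hb. exists (mkposreal b Hb). intros y Hy Hy0.
  change (Rabs (y - 0) < b) in Hy. rewrite Rminus_0_r, Rabs_pos_eq in Hy; lra.
Qed.

Lemma filterlim_comp_continuous (F : (R -> Prop) -> Prop) (f g : R -> R) (a : R) :
  filterlim f F (locally a) -> continuous g a -> filterlim (fun x => g (f x)) F (locally (g a)).
Proof. intros Hf Hg. apply (filterlim_comp _ _ _ f g F (locally a)); assumption. Qed.

Lemma filterlim_mult_R (F : (R -> Prop) -> Prop) (FF : Filter F) (f g : R -> R) (a b : R) :
  filterlim f F (locally a) -> filterlim g F (locally b) ->
  filterlim (fun x => f x * g x) F (locally (a * b)).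
Proof.
  intros Hf Hg. apply (filterlim_comp_2 f g Rmult Hf Hg), (filterlim_mult (K := R_AbsRing)).
Qed.

Lemma filterlim_minus_R (F : (R -> Prop) -> Prop) (FF : Filter F) (f g : R -> R) (a b : R) :
  filterlim f F (locally a) -> filterlim g F (locally b) ->
  filterlim (fun x => f x - g x) F (locally (a - b)).
Proof.
  intros Hf Hg.
  apply (filterlim_comp_2 f (fun x => - g x) Rplus Hf (filterlim_comp_continuous F g Ropp b Hg
    (continuous_opp_R _ _ (continuous_id b)))),
    (filterlim_plus (V := R_NormedModule)).
Qed.

Lemma filterlim_at_right_continuous (f : R -> R) :
  continuous f 0 -> filterlim f (at_right 0) (locally (f 0)).
Proof.
  intros H. apply (filterlim_filter_le_1 f (F := locally 0)); [|exact H].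
  apply filter_le_within.
Qed.

Lemma uniform_right_limit (f : R -> R) :
  (forall e, 0 < e -> exists d, 0 < d /\ forall x y, in_open01 x -> in_open01 y ->
     Rabs (x - y) < d -> Rabs (f x - f y) < e) ->
  exists l, filterlim f (at_right 0) (locally l).
Proof.
  intros H. apply (filterlim_locally_cauchy (U := R_CompleteSpace)). intros e.
  destruct (H e (cond_pos e)) as [d [Hd H']].
  exists (fun x => 0 < x < Rmin d 1). split.
  - apply at_right_interval, Rmin_pos; lra.
  - intros x y Hx Hy. assert (Rmin d 1 <= d) by apply Rmin_l. assert (Rmin d 1 <= 1) by apply Rmin_r.
    change (Rabs (f y - f x) < e). apply H'; unfold in_open01; try lra. apply Rabs_def1; lra.
Qed.

Lemma continuous_on_extension (f : R -> R) (l0 l1 : R) :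
  (forall x, in_open01 x -> continuous f x) ->
  filterlim f (at_right 0) (locally l0) ->
  filterlim (fun x => f (1 - x)) (at_right 0) (locally l1) ->
  exists g, continuous_on in_closed01 g /\ forall x, in_open01 x -> g x = f x.
Proof.
  intros Hc H0 H1.
  set (g := fun x => if Rle_dec x 0 then l0 else if Rle_dec 1 x then l1 else f x).
  assert (Eg : forall x, in_open01 x -> g x = f x).
  { intros x [Hx0 Hx1]. unfold g. destruct (Rle_dec x 0); [lra|]. destruct (Rle_dec 1 x); [lra | reflexivity]. }
  assert (g0 : g 0 = l0) by (unfold g; destruct (Rle_dec 0 0); [reflexivity | lra]).
  assert (g1 : g 1 = l1).
  { unfold g. destruct (Rle_dec 1 0); [lra|]. destruct (Rle_dec 1 1); [reflexivity | lra]. }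
  exists g. split; [|exact Eg]. intros x [Hx0 Hx1].
  destruct (Req_dec x 0) as [->|N0]; [|destruct (Req_dec x 1) as [->|N1]].
  - rewrite g0. apply filterlim_locally. intros e.
    destruct (proj1 (filterlim_locally f l0) H0 e) as [d Hd].
    exists (mkposreal _ (Rmin_pos d 1 (cond_pos d) Rlt_0_1)). intros y Hy [Hy0 Hy1].
    change (Rabs (y - 0) < Rmin d 1) in Hy.
    assert (Rmin d 1 <= d) by apply Rmin_l. assert (Rmin d 1 <= 1) by apply Rmin_r.
    destruct Hy0 as [Hy0|<-].
    + rewrite Eg by (apply Rabs_def2 in Hy; split; lra).
      apply Hd; [|exact Hy0]. change (Rabs (y - 0) < d). lra.
    + rewrite g0. apply ball_center.
  - rewrite g1. apply filterlim_locally. intros e.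
    destruct (proj1 (filterlim_locally _ l1) H1 e) as [d Hd].
    exists (mkposreal _ (Rmin_pos d 1 (cond_pos d) Rlt_0_1)). intros y Hy [Hy0 Hy1].
    change (Rabs (y - 1) < Rmin d 1) in Hy.
    assert (Rmin d 1 <= d) by apply Rmin_l. assert (Rmin d 1 <= 1) by apply Rmin_r.
    apply Rabs_def2 in Hy.
    destruct Hy1 as [Hy1| ->].
    + rewrite Eg by (split; lra). replace y with (1 - (1 - y)) by ring.
      apply Hd; [|lra]. change (Rabs (1 - y - 0) < d). apply Rabs_def1; lra.
    + rewrite g1. apply ball_center.
  - assert (I : in_open01 x) by (split; lra).
    apply (filterlim_filter_le_1 g (F := locally x)); [apply filter_le_within|].
    rewrite Eg by exact I.
    apply (filterlim_ext_loc f); [|apply Hc, I].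
    generalize (in01_locally x I). apply filter_imp. intros y Hy; symmetry; auto.
Qed.

Lemma holder01_uniform (gamma : R) (rho : R -> R) :
  0 < gamma -> holder01 gamma rho ->
  forall e, 0 < e -> exists d, 0 < d /\ forall x y, in_open01 x -> in_open01 y ->
     Rabs (x - y) < d -> Rabs (rho x - rho y) < e.
Proof.
  intros Hg [C HC] e He.
  assert (HA : 0 < Rabs C + 1) by (generalize (Rabs_pos C); lra).
  assert (Hq : 0 < e / (Rabs C + 1)) by (apply Rdiv_lt_0_compat; lra).
  exists (Rpower (e / (Rabs C + 1)) (/ gamma)). split; [apply exp_pos|].
  intros x y Hx Hy Hd. destruct (Req_dec x y) as [->|N].
  { rewrite (Rminus_diag_eq _ _ eq_refl), Rabs_R0. exact He. }
  apply Rle_lt_trans with (1 := HC x y Hx Hy N).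
  assert (Hp : 0 < Rabs (x - y)) by (apply Rabs_pos_lt; lra).
  assert (T := Rlt_Rpower_l _ _ gamma Hg (conj Hp Hd)).
  rewrite Rpower_mult, Rinv_l, Rpower_1 in T by lra.
  apply Rle_lt_trans with ((Rabs C + 1) * Rpower (Rabs (x - y)) gamma).
  - apply Rmult_le_compat_r; [left; apply exp_pos | generalize (Rle_abs C); lra].
  - apply Rmult_lt_compat_l with (r := Rabs C + 1) in T; [|lra].
    replace ((Rabs C + 1) * (e / (Rabs C + 1))) with e in T by (field; lra). exact T.
Qed.

Lemma holder01_bounded (gamma : R) (rho : R -> R) :
  0 < gamma -> holder01 gamma rho -> exists R0, forall x, in_open01 x -> rho x <= R0.
Proof.
  intros Hg [C HC]. exists (rho (1/2) + Rabs C). intros x Hx.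
  destruct (Req_dec x (1/2)) as [->|N]; [generalize (Rabs_pos C); lra|].
  assert (H := HC x (1/2) Hx ltac:(split; lra) N).
  assert (Hp : 0 < Rabs (x - 1/2)) by (apply Rabs_pos_lt; lra).
  assert (H1 : Rabs (x - 1/2) <= 1) by (destruct Hx; apply Rabs_le; lra).
  assert (T := Rpower_le_1 (Rabs (x - 1/2)) gamma (conj Hp H1) ltac:(lra)).
  assert (T0 : 0 < Rpower (Rabs (x - 1/2)) gamma) by apply exp_pos.
  assert (C * Rpower (Rabs (x - 1/2)) gamma <= Rabs C * 1).
  { apply Rle_trans with (Rabs C * Rpower (Rabs (x - 1/2)) gamma).
    - apply Rmult_le_compat_r; [lra | apply Rle_abs].
    - apply Rmult_le_compat_l; [apply Rabs_pos | lra]. }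
  generalize (Rle_abs (rho x - rho (1/2))); lra.
Qed.

Lemma quotient_right_limit (f f1 : R -> R) :
  (forall x, continuous f x) -> continuous f1 0 ->
  (forall x, in_open01 x -> is_derive f x (f1 x)) -> f 0 = 0 ->
  filterlim (fun x => f x / x) (at_right 0) (locally (f1 0)).
Proof.
  intros C C1 D f0. apply at_right_eps. intros e He.
  destruct (continuous_eps f1 0 e C1 He) as [d [Hd H]].
  exists (Rmin d 1). split; [apply Rmin_pos; lra|]. intros x Hx.
  assert (Rmin d 1 <= d) by apply Rmin_l. assert (Rmin d 1 <= 1) by apply Rmin_r.
  destruct (MVT_open f f1 0 x) as [c [Hc E]]; try lra; auto.
  { intros t Ht; apply D; split; lra. }
  replace (f x / x) with (f1 c).
  - apply H, Rabs_def1; lra.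
  - rewrite f0, !Rminus_0_r in E. rewrite E. field; lra.
Qed.

(** On [(0, 1/2)] the parabola lies above the line [k x / 2], so the slope at [0] is at least
    [k / 2]. *)
Lemma derive_pos_of_parabola (f f1 : R -> R) (k : R) :
  0 < k -> (forall x, continuous f x) -> continuous f1 0 ->
  (forall x, in_open01 x -> is_derive f x (f1 x)) -> f 0 = 0 ->
  (forall x, in_open01 x -> k * (x * (1 - x)) <= f x) -> 0 < f1 0.
Proof.
  intros Hk C C1 D f0 B.
  assert (0 <= f1 0 - k / 2); [|lra].
  apply (derive_nonneg_left_min (fun x => f x - k / 2 * x) (fun x => f1 x - k / 2) 0 (1/2)); try lra.
  - intros x _. apply continuous_minus_R; [apply C|].
    apply continuous_mult_R; [apply continuous_const | apply continuous_id].
  - intros x Hx. apply is_derive_minus_R; [apply D; split; lra|].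
    auto_derive; auto; ring.
  - apply continuous_minus_R; [exact C1 | apply continuous_const].
  - intros x Hx. rewrite f0. specialize (B x ltac:(split; lra)).
    assert (0 <= k * (x * (1/2 - x))) by (apply Rmult_le_pos; [lra | apply Rmult_le_pos; lra]).
    lra.
Qed.

Lemma Rpower_right_limit (e : R) : 0 <= e ->
  exists l, filterlim (fun x => Rpower x e) (at_right 0) (locally l).
Proof.
  intros [He|<-].
  - exists 0. apply at_right_eps. intros eps Heps.
    exists (Rpower eps (/ e)). split; [apply exp_pos|]. intros x Hx.
    assert (T := Rlt_Rpower_l _ _ e He Hx).
    rewrite Rpower_mult, Rinv_l, Rpower_1 in T by lra.
    rewrite Rminus_0_r, Rabs_pos_eq; [exact T | left; apply exp_pos].
  - exists 1. apply (filterlim_ext_loc (fun _ => 1)); [|apply filterlim_const].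
    generalize (at_right_interval 1 Rlt_0_1). apply filter_imp. intros x Hx.
    symmetry; apply Rpower_O; lra.
Qed.

(** By homogeneity the quotient is a continuous function of [u / x] and [v / x], whose limits are
    positive, times [x^(P - Q)], which converges because [Q <= P]. Hence the second derivatives of a
    solution have limits at the boundary. *)
Lemma power_ratio_right_limit (P Q a b : R) (u v : R -> R) :
  Q <= P -> 0 < a -> 0 < b ->
  (forall x, in_open01 x -> 0 < u x /\ 0 < v x) ->
  filterlim (fun x => u x / x) (at_right 0) (locally a) ->
  filterlim (fun x => v x / x) (at_right 0) (locally b) ->
  exists l, filterlim (fun x => power_ratio P Q (u x) (v x)) (at_right 0) (locally l).
Proof.
  intros HPQ Ha Hb Pos Lu Lv. destruct (Rpower_right_limit (P - Q)) as [l Hl]; [lra|].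
  exists (exp (P * ln a - Q * ln b) * l).
  apply (filterlim_ext_loc (fun x => exp (P * ln (u x / x) - Q * ln (v x / x)) * Rpower x (P - Q))).
  - generalize (at_right_interval 1 Rlt_0_1). apply filter_imp. intros x Hx.
    destruct (Pos x Hx) as [Pu Pv].
    rewrite <- power_ratio_exp, <- power_ratio_scale;
      try (apply Rdiv_lt_0_compat; lra); try lra.
    f_equal; field; lra.
  - apply filterlim_mult_R; [typeclasses eauto | | exact Hl].
    apply (filterlim_comp_continuous _ (fun x => P * ln (u x / x) - Q * ln (v x / x)) exp).
    + apply filterlim_minus_R; [typeclasses eauto | |];
        (apply filterlim_mult_R; [typeclasses eauto | apply filterlim_const |]).
      * apply (filterlim_comp_continuous _ (fun x => u x / x) ln); [exact Lu | apply continuous_ln_pos, Ha].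
      * apply (filterlim_comp_continuous _ (fun x => v x / x) ln); [exact Lv | apply continuous_ln_pos, Hb].
    + apply (ex_derive_continuous exp). auto_derive; auto.
Qed.

Lemma regular_solution_reflect (alpha beta p q sigma : R) (rho u u1 v v1 : R -> R) :
  regular_solution alpha beta p q sigma rho u u1 v v1 ->
  regular_solution alpha beta p q sigma (fun x => rho (1 - x))
    (fun x => u (1 - x)) (fun x => - u1 (1 - x)) (fun x => v (1 - x)) (fun x => - v1 (1 - x)).
Proof.
  intros S.
  assert (I : forall x, in_open01 x -> in_open01 (1 - x)) by (unfold in_open01; intros; lra).
  constructor; try (intros x; apply continuous_reflect, S);
    try (intros x; apply continuous_opp_R, (continuous_reflect u1), S);
    try (intros x; apply continuous_opp_R, (continuous_reflect v1), S);
    try (intros x Hx; apply is_derive_reflect, S; auto);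
    try (intros x Hx; apply S; auto).
  - intros x Hx. rewrite <- (Ropp_involutive (alpha * u (1 - x) - _ - _)).
    apply is_derive_opp_R, is_derive_reflect, S; auto.
  - intros x Hx. rewrite <- (Ropp_involutive (beta * v (1 - x) - _)).
    apply is_derive_opp_R, is_derive_reflect, S; auto.
  - rewrite Rminus_0_r; apply S.
  - replace (1 - 1) with 0 by ring; apply S.
  - rewrite Rminus_0_r; apply S.
  - replace (1 - 1) with 0 by ring; apply S.
Qed.

Lemma regular_solution_right_limits (alpha beta p q sigma l : R) (rho u u1 v v1 : R -> R) :
  0 < alpha -> 0 < beta -> q <= p ->
  (forall x, in_open01 x -> 0 <= rho x) ->
  filterlim rho (at_right 0) (locally l) ->
  regular_solution alpha beta p q sigma rho u u1 v v1 ->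
  (exists a, filterlim (fun x => alpha * u x - power_ratio p q (u x) (v x) - rho x)
     (at_right 0) (locally a)) /\
  (exists b, filterlim (fun x => beta * v x - power_ratio (p + sigma) (q + sigma) (u x) (v x))
     (at_right 0) (locally b)).
Proof.
  intros Ha Hb Hqp Prho Lrho S.
  destruct (regular_solution_lower alpha beta p q sigma rho Ha Hb Prho u u1 v v1 S)
    as [k [c [Hk [Hc B]]]].
  assert (Pos : forall x, in_open01 x -> 0 < u x /\ 0 < v x) by (intros; split; apply S; assumption).
  assert (Pu : 0 < u1 0) by (apply (derive_pos_of_parabola u u1 k); try apply S; auto; intros; apply B; auto).
  assert (Pv : 0 < v1 0) by (apply (derive_pos_of_parabola v v1 c); try apply S; auto; intros; apply B; auto).
  assert (Lu : filterlim (fun x => u x / x) (at_right 0) (locally (u1 0)))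
    by (apply quotient_right_limit; apply S).
  assert (Lv : filterlim (fun x => v x / x) (at_right 0) (locally (v1 0)))
    by (apply quotient_right_limit; apply S).
  destruct (power_ratio_right_limit p q _ _ u v Hqp Pu Pv Pos Lu Lv) as [l1 L1].
  destruct (power_ratio_right_limit (p + sigma) (q + sigma) _ _ u v ltac:(lra) Pu Pv Pos Lu Lv) as [l2 L2].
  assert (Cu := filterlim_at_right_continuous u (reg_cu _ _ _ _ _ _ _ _ _ _ S 0)).
  assert (Cv := filterlim_at_right_continuous v (reg_cv _ _ _ _ _ _ _ _ _ _ S 0)).
  split.
  - exists (alpha * u 0 - l1 - l).
    apply filterlim_minus_R; [typeclasses eauto | | exact Lrho].
    apply filterlim_minus_R; [typeclasses eauto | | exact L1].
    apply filterlim_mult_R; [typeclasses eauto | apply filterlim_const | exact Cu].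
  - exists (beta * v 0 - l2).
    apply filterlim_minus_R; [typeclasses eauto | | exact L2].
    apply filterlim_mult_R; [typeclasses eauto | apply filterlim_const | exact Cv].
Qed.

Lemma continuous_continuous_on (D : R -> Prop) (f : R -> R) :
  (forall x, continuous f x) -> continuous_on D f.
Proof.
  intros H x _. apply (filterlim_filter_le_1 f (F := locally x)); [|apply H].
  apply filter_le_within.
Qed.

(** The limits of the second derivatives at [1] are those at [0] for the reflected solution; Hölder
    continuity of [rho] enters through uniform continuity, which provides its limits at both
    ends. *)
Lemma regular_solution_C2 (alpha beta p q sigma : R) (rho u u1 v v1 : R -> R) :
  0 < alpha -> 0 < beta -> q <= p ->
  (forall x, in_open01 x -> 0 <= rho x) ->
  (forall e, 0 < e -> exists d, 0 < d /\ forall x y, in_open01 x -> in_open01 y ->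
     Rabs (x - y) < d -> Rabs (rho x - rho y) < e) ->
  (forall x, in_open01 x -> continuous rho x) ->
  regular_solution alpha beta p q sigma rho u u1 v v1 ->
  C2_positive_solution alpha beta p q sigma rho u v.
Proof.
  intros Ha Hb Hqp Prho Urho Crho S.
  assert (I : forall x, in_open01 x -> in_open01 (1 - x)) by (unfold in_open01; intros; lra).
  assert (S' := regular_solution_reflect _ _ _ _ _ _ _ _ _ _ S).
  destruct (uniform_right_limit rho Urho) as [l Hl].
  destruct (uniform_right_limit (fun x => rho (1 - x))) as [l' Hl'].
  { intros e He. destruct (Urho e He) as [d [Hd H]]. exists d. split; [exact Hd|].
    intros x y Hx Hy Hxy. apply H; auto. replace (1 - x - (1 - y)) with (- (x - y)) by ring.
    rewrite Rabs_Ropp; exact Hxy. }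
  destruct (regular_solution_right_limits _ _ _ _ _ l _ _ _ _ _ Ha Hb Hqp Prho Hl S)
    as [[a0 A0] [b0 B0]].
  destruct (regular_solution_right_limits _ _ _ _ _ l' _ _ _ _ _ Ha Hb Hqp
    (fun x Hx => Prho (1 - x) (I x Hx)) Hl' S') as [[a1 A1] [b1 B1]].
  assert (CP : forall P Q x, in_open01 x -> continuous (fun t => power_ratio P Q (u t) (v t)) x).
  { intros P Q x Hx. apply continuous_power_ratio; apply S; exact Hx. }
  destruct (continuous_on_extension
    (fun x => alpha * u x - power_ratio p q (u x) (v x) - rho x) a0 a1) as [u2 [Cu2 Eu2]]; auto.
  { intros x Hx. apply continuous_minus_R; [|apply Crho, Hx].
    apply continuous_minus_R; [|apply CP, Hx].
    apply continuous_mult_R; [apply continuous_const | apply S]. }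
  destruct (continuous_on_extension
    (fun x => beta * v x - power_ratio (p + sigma) (q + sigma) (u x) (v x)) b0 b1)
    as [v2 [Cv2 Ev2]]; auto.
  { intros x Hx. apply continuous_minus_R; [|apply CP, Hx].
    apply continuous_mult_R; [apply continuous_const | apply S]. }
  assert (Du : forall x, in_open01 x -> is_derive u x (u1 x)) by apply S.
  assert (Dv : forall x, in_open01 x -> is_derive v x (v1 x)) by apply S.
  split; [|split].
  - exists u1, u2. split; [exact Du|]. split.
    { intros x Hx. rewrite Eu2 by exact Hx. apply S, Hx. }
    split; [apply continuous_continuous_on, S|]. split; [apply continuous_continuous_on, S | exact Cu2].
  - exists v1, v2. split; [exact Dv|]. split.
    { intros x Hx. rewrite Ev2 by exact Hx. apply S, Hx. }
    split; [apply continuous_continuous_on, S|]. split; [apply continuous_continuous_on, S | exact Cv2].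
  - split; [intros x Hx; split; apply S, Hx|]. split; [|split; [|repeat split; apply S]].
    + intros x Hx. rewrite (Derive_n_2_open01 u u1 _ x Du (reg_du1 _ _ _ _ _ _ _ _ _ _ S) Hx).
      unfold power_ratio; ring.
    + intros x Hx. rewrite (Derive_n_2_open01 v v1 _ x Dv (reg_dv1 _ _ _ _ _ _ _ _ _ _ S) Hx).
      unfold power_ratio; ring.
Qed.

Theorem theorem4p1 (alpha beta p q sigma gamma : R) (rho : R -> R)
  (halpha : 0 < alpha) (hbeta : 0 < beta) (hba : beta <= alpha)
  (hgamma : 0 < gamma < 1)
  (hrho_holder : holder01 gamma rho)
  (hrho_nonneg : forall x : R, in_open01 x -> 0 <= rho x)
  (hrho_nonzero : exists x : R, in_open01 x /\ rho x <> 0)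
  (hq : 0 < q) (hqp : q <= p) (hp : p <= 1) (hsigma : 0 <= sigma) :
  exists u v : R -> R,
    C2_positive_solution alpha beta p q sigma rho u v /\
    (forall u' v' : R -> R,
       C2_positive_solution alpha beta p q sigma rho u' v' ->
       forall x : R, in_closed01 x -> u' x = u x /\ v' x = v x).
Proof.
  assert (Urho := holder01_uniform gamma rho (proj1 hgamma) hrho_holder).
  assert (Crho : forall x, in_open01 x -> continuous rho x).
  { intros x Hx. apply eps_continuous. intros e He.
    destruct (Urho e He) as [d [Hd H]]. destruct (in01_locally x Hx) as [d' Hd'].
    exists (Rmin d d'). split; [apply Rmin_pos; [exact Hd | apply cond_pos]|].
    intros y Hy. apply H; auto.
    - apply Hd'. change (Rabs (y - x) < d'). generalize (Rmin_r d d'); lra.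
    - generalize (Rmin_l d d'); lra. }
  destruct (holder01_bounded gamma rho (proj1 hgamma) hrho_holder) as [R0 HR0].
  destruct (regular_solution_exists alpha beta p q sigma rho R0)
    as [u [u1 [v [v1 S]]]]; auto.
  exists u, v. split; [apply (regular_solution_C2 _ _ _ _ _ _ u u1 v v1); auto|].
  intros u' v' S' x [Hx0 Hx1].
  destruct (C2_positive_solution_regular _ _ _ _ _ _ _ _ S') as [u1' [v1' T]].
  destruct S' as [_ [_ [_ [_ [_ [[U0 U1] [V0 V1]]]]]]].
  destruct (Req_dec x 0) as [->|N0]; [|destruct (Req_dec x 1) as [->|N1]].
  - rewrite U0, V0. split; symmetry; apply S.
  - rewrite U1, V1. split; symmetry; apply S.
  - assert (I : in_open01 x) by (split; lra).
    assert (Un := regular_solution_unique alpha beta p q sigma rho halpha hbeta hrho_nonneg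
      hrho_nonzero hq hqp hp hsigma _ _ _ _ _ _ _ _ S T x I).
    simpl in Un. rewrite (clamp01_id x) in Un by (split; lra). exact Un.
Qed.
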